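(* Let $d\ge2$, let $X_n$ be finite $(d-1)$-connected uniform $d$-complexes and $X$ a countable $(d-1)$-connected uniform $d$-complex, all with $(d-1)$-degrees bounded by a common constant, such that $X_n\to X$. Suppose one of the following holds: (1) $0\notin\operatorname{Spec}(\Delta^+_X|_{Z_{d-1}(X)})$, i.e. $\lambda(X)\neq0$; (2) $0$ is a non-isolated point of $\operatorname{Spec}(\Delta^+_X|_{Z_{d-1}(X)})$; (3) the $(d-2)$-cells of all $X_n$ have degrees bounded by a common constant, and $\inf_n\lambda_{d-2}(X_n)>0$. Then $\liminf_{n\to\infty}\lambda(X_n)\le\lambda(X)$.
   Context: A simplicial complex is a collection of finite subsets (cells) of a vertex set closed under taking subsets (the empty set is a cell); a $j$-cell has $j+1$ vertices; $X^j$ is the set of $j$-cells; the degree $\deg\sigma$ of a $j$-cell is the number of $(j+1)$-cells containing it; a $d$-complex has maximal cell dimension $d$ and is uniform if every cell lies in a $d$-cell. For $j\ge1$ each $j$-cell has two orientations (orderings of its vertices modulo even permutations); $X^j_\pm$ is the set of oriented $j$-cells, $\bar\sigma$ the opposite orientation. The oriented cell $[v_0,\dots,v_j]$ induces on its face $\{v_0,\dots,v_j\}\setminus\{v_i\}$ the orientation $(-1)^i[v_0,\dots,\widehat{v_i},\dots,v_j]$ ($-1$ meaning reversal). For $v\notin\sigma$ write $v\triangleleft\sigma$ if $\sigma\cup\{v\}\in X$, and $v\sigma=[v,\sigma_0,\dots,\sigma_k]$ for $\sigma=[\sigma_0,\dots,\sigma_k]$. $\Omega^j(X)$ is the space of real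 functions $f$ on $X^j_\pm$ with $f(\bar\sigma)=-f(\sigma)$ ($j=0$: functions on vertices; $j=-1$: functions on $\{\emptyset\}$). Two oriented $(d-1)$-cells are neighbours, $\sigma\sim\sigma'$, if some oriented $d$-cell $\tau$ has both $\sigma$ and $\overline{\sigma'}$ as faces with the induced orientations; $X$ is $(d-1)$-connected if any two oriented $(d-1)$-cells are joined by a chain of neighbours. Norms: on $\Omega^{d-1}$, $\|f\|^2=\sum_{\sigma\in X^{d-1}}f(\sigma)^2/\deg\sigma$; on $\Omega^k$, $k\neq d-1$, $\|f\|^2=\sum_{\sigma\in X^k}f(\sigma)^2$; $\Omega^k_{L^2}$ denotes the forms of finite norm. Boundary $\partial_k:\Omega^k\to\Omega^{k-1}$, $(\partial_kf)(\sigma)=\sum_{v\triangleleft\sigma}f(v\sigma)$. Coboundary (pointwise), writing $\sigma\setminus\sigma_i=[\sigma_0,\dots,\widehat{\sigma_i},\dots,\sigma_k]$: $(\delta_{d-1}f)(\sigma)=\deg\sigma\sum_{i=0}^{d-1}(-1)^if(\sigma\setminus\sigma_i)$ for $f\in\Omega^{d-2}$, and $(\delta_df)(\sigma)=\sum_{i=0}^d(-1)^if(\sigma\setminus\sigma_i)/\deg(\sigma\setminus\sigma_i)$. Upper Laplacian $\Delta^+_X=\partial_d\delta_d$ on $\Omega^{d-1}_{L^2}$: $(\Delta^+f)(\sigma)=f(\sigma)-\sum_{\sigma'\sim\sigma}f(\sigma')/\deg\sigma'$. $B^{d-1}(X)=\{\delta_{d-1}f:f\in\Omega^{d-2}_{L^2}\}\cap\Omega^{d-1}_{L^2}$,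 $Z_{d-1}(X)=(B^{d-1})^\perp$ (a $\Delta^+$-invariant subspace of $\Omega^{d-1}_{L^2}$; for finite $X$ it equals $\ker\partial_{d-1}$), and the spectral gap is $\lambda(X)=\min\operatorname{Spec}(\Delta^+_X|_{Z_{d-1}(X)})$. For a finite complex $Y$, $\lambda_{d-2}(Y)=\min\operatorname{Spec}\big(\partial_{d-1}\delta_{d-1}|_{\ker\partial_{d-2}}\big)$, where $\partial_{d-1}\delta_{d-1}$ acts on $\Omega^{d-2}(Y)$. The distance between $(d-1)$-cells $\sigma,\sigma'$ is the minimal $n$ such that there are $(d-1)$-cells $\sigma=\tau_0,\dots,\tau_n=\sigma'$ with $\tau_i\cup\tau_{i+1}\in X^d$. The ball $B_R(X,\sigma)$ is the subcomplex consisting of the $(d-1)$-cells at distance $\le R$ from $\sigma$, the $d$-cells all of whose $(d-1)$-faces are at distance $\le R$, and all subsets of these. $X_n\to X$ means: there are $\sigma_n\in X_n^{d-1}$, $\sigma\in X^{d-1}$ such that for every $R$ there is $N$ such that for $n\ge N$ there is a simplicial isomorphism $B_R(X_n,\sigma_n)\to B_R(X,\sigma)$ sending $\sigma_n$ to $\sigma$. *)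

(* Defs.v *)
From Stdlib Require Import Reals Lra List Permutation Sorted Classical ClassicalEpsilon Relations.
Import ListNotations.
Open Scope R_scope.

(** * Simplicial complexes on the countable vertex set nat.
    A cell {v_0,...,v_j} is represented by any duplicate-free list of its
    vertices; an ordering of the list is an oriented cell.  A j-cell is a
    cell-list of length j+1. *)
Record complex := mkComplex {
  cell : list nat -> Prop;
  cell_nodup : forall s, cell s -> NoDup s;
  cell_perm : forall s t, Permutation s t -> cell s -> cell t;
  cell_sub : forall s t, cell s -> NoDup t -> incl t s -> cell t;
  cell_nil : cell []
}.

(** cell with k vertices (i.e. a (k-1)-cell), as an oriented cell *)
Definition dcell (X : complex) (k : nat) (s : list nat) : Prop :=
  cell X s /\ length s = k.

(** canonical representative of an unoriented cell: increasing list *)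
Definition canon (X : complex) (k : nat) (s : list nat) : Prop :=
  dcell X k s /\ Sorted lt s.

Definition finite_complex (X : complex) : Prop :=
  exists N, forall s, cell X s -> forall v, In v s -> (v < N)%nat.

Definition uniform_dcomplex (d : nat) (X : complex) : Prop :=
  (forall s, cell X s -> (length s <= S d)%nat) /\
  (exists s, dcell X (S d) s) /\
  (forall s, cell X s -> exists t, dcell X (S d) t /\ incl s t).

Inductive adj_swap : list nat -> list nat -> Prop :=
  | AdjSwap l1 a b l2 : adj_swap (l1 ++ a :: b :: l2) (l1 ++ b :: a :: l2).

Inductive perm_par : bool -> list nat -> list nat -> Prop :=
  | pp_refl s : perm_par false s s
  | pp_step b s t u : perm_par b s t -> adj_swap t u -> perm_par (negb b) s u.

Definition rem (i : nat) (s : list nat) : list nat := firstn i s ++ skipn (S i) s.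

Definition induced_face (sigma tau : list nat) : Prop :=
  exists i, (i < length tau)%nat /\ perm_par (Nat.odd i) sigma (rem i tau).

Definition nbr (d : nat) (X : complex) (sigma sigma' : list nat) : Prop :=
  dcell X d sigma /\ dcell X d sigma' /\
  exists tau, dcell X (S d) tau /\ induced_face sigma tau /\
    exists sigma'', perm_par true sigma' sigma'' /\ induced_face sigma'' tau.

(** (d-1)-connected (chains of neighbours; lists representing the same
    oriented cell are identified) *)
Definition connected_top (d : nat) (X : complex) : Prop :=
  forall sigma sigma', dcell X d sigma -> dcell X d sigma' ->
    clos_refl_trans (list nat)
      (fun a b => nbr d X a b \/ (dcell X d a /\ perm_par false a b)) sigma sigma'.

Definition lsum (l : list R) : R := fold_right Rplus 0 l.

Definition enumerates (P : nat -> Prop) (L : list nat) : Prop :=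
  NoDup L /\ forall v, In v L <-> P v.

(** sum of g over a finite set P of vertices (0 if P is infinite;
    independent of the enumeration chosen) *)
Definition fsum (P : nat -> Prop) (g : nat -> R) : R :=
  match excluded_middle_informative (exists L, enumerates P L) with
  | left H => lsum (map g (proj1_sig (constructive_indefinite_description _ H)))
  | right _ => 0
  end.

(** number of elements of a finite set P of vertices (0 if infinite) *)
Definition fcard (P : nat -> Prop) : nat :=
  match excluded_middle_informative (exists L, enumerates P L) with
  | left H => length (proj1_sig (constructive_indefinite_description _ H))
  | right _ => O
  end.

Definition nbv (X : complex) (s : list nat) (v : nat) : Prop :=
  ~ In v s /\ cell X (v :: s).

Definition deg (X : complex) (s : list nat) : nat := fcard (nbv X s).

(** deg s <= D (meaningful also for cells of infinite degree) *)
Definition deg_le (X : complex) (s : list nat) (D : nat) : Prop :=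
  forall L, NoDup L -> (forall v, In v L -> nbv X s v) -> (length L <= D)%nat.

Definition form := list nat -> R.
Definition zero_form : form := fun _ => 0.

Definition is_form (X : complex) (k : nat) (f : form) : Prop :=
  forall s t, dcell X k s -> perm_par true s t -> f t = - f s.

Definition feq (X : complex) (k : nat) (f g : form) : Prop :=
  forall s, dcell X k s -> f s = g s.

Definition bdry (X : complex) (f : form) : form :=
  fun s => fsum (nbv X s) (fun v => f (v :: s)).

(** δ_d (on d-cells τ, f a (d-1)-form) *)
Definition delta_top (X : complex) (f : form) : form :=
  fun tau => lsum (map (fun i => (-1) ^ i * f (rem i tau) / INR (deg X (rem i tau)))
                       (seq 0 (length tau))).

(** δ_{d-1} (on (d-1)-cells σ, f a (d-2)-form) *)
Definition delta_low (X : complex) (f : form) : form :=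
  fun sigma => INR (deg X sigma) *
    lsum (map (fun i => (-1) ^ i * f (rem i sigma)) (seq 0 (length sigma))).

Definition lapl_up (X : complex) (f : form) : form := bdry X (delta_top X f).

(** * Countable sums of nonnegative terms and L^2 *)
Definition psums (P : list nat -> Prop) (g : list nat -> R) (x : R) : Prop :=
  exists L, NoDup L /\ (forall s, In s L -> P s) /\ x = lsum (map g L).

Definition HasSum (P : list nat -> Prop) (g : list nat -> R) (S : R) : Prop :=
  is_lub (psums P g) S.

Definition wsq (X : complex) (f : form) : list nat -> R :=
  fun s => (f s) ^ 2 / INR (deg X s).

Definition L2_top (d : nat) (X : complex) (f : form) : Prop :=
  exists S, HasSum (canon X d) (wsq X f) S.

Definition L2_low (k : nat) (X : complex) (f : form) : Prop :=
  exists S, HasSum (canon X k) (fun s => (f s) ^ 2) S.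

(** orthogonality in Omega^{d-1}_{L^2} (polarization: ‖f+h‖ = ‖f-h‖) *)
Definition orth_top (d : nat) (X : complex) (f h : form) : Prop :=
  forall S1 S2, HasSum (canon X d) (wsq X (fun s => f s + h s)) S1 ->
                HasSum (canon X d) (wsq X (fun s => f s - h s)) S2 -> S1 = S2.

Definition Zspace (d : nat) (X : complex) (f : form) : Prop :=
  is_form X d f /\ L2_top d X f /\
  forall g, is_form X (d - 1) g -> L2_low (d - 1) X g ->
    L2_top d X (delta_low X g) -> orth_top d X f (delta_low X g).

(** * Spectrum (real part) of an operator A restricted to an invariant
    subspace H, forms identified by E: x is in the spectrum iff A - x is not
    a bijection of H. *)
Definition bij_on (H : form -> Prop) (E : form -> form -> Prop) (T : form -> form) : Prop :=
  (forall f, H f -> E (T f) zero_form -> E f zero_form) /\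
  (forall g, H g -> exists f, H f /\ E (T f) g).

Definition in_spec (H : form -> Prop) (E : form -> form -> Prop) (A : form -> form) (x : R) : Prop :=
  ~ bij_on H E (fun f s => A f s - x * f s).

Definition is_min_spec (H : form -> Prop) (E : form -> form -> Prop) (A : form -> form) (m : R) : Prop :=
  in_spec H E A m /\ forall x, in_spec H E A x -> m <= x.

Definition specZ (d : nat) (X : complex) (x : R) : Prop :=
  in_spec (Zspace d X) (feq X d) (lapl_up X) x.

Definition is_lambda (d : nat) (X : complex) (m : R) : Prop :=
  is_min_spec (Zspace d X) (feq X d) (lapl_up X) m.

Definition Kspace (d : nat) (Y : complex) (f : form) : Prop :=
  is_form Y (d - 1) f /\ feq Y (d - 2) (bdry Y f) zero_form.

Definition is_lambda_low (d : nat) (Y : complex) (m : R) : Prop :=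
  is_min_spec (Kspace d Y) (feq Y (d - 1)) (fun f => bdry Y (delta_low Y f)) m.

Definition adjc (d : nat) (X : complex) (a b : list nat) : Prop :=
  exists t, dcell X (S d) t /\ incl a t /\ incl b t.

Fixpoint within (d : nat) (X : complex) (R : nat) (a b : list nat) : Prop :=
  match R with
  | O => Permutation a b
  | S r => within d X r a b \/
           exists c, within d X r a c /\ dcell X d c /\ dcell X d b /\ adjc d X c b
  end.

Definition ball (d : nat) (X : complex) (R : nat) (sigma : list nat) (s : list nat) : Prop :=
  NoDup s /\ exists t, incl s t /\
    ((dcell X d t /\ within d X R sigma t) \/
     (dcell X (S d) t /\ forall u, NoDup u -> incl u t -> length u = d -> within d X R sigma u)).

Definition simp_iso (B1 B2 : list nat -> Prop) (phi : nat -> nat) : Prop :=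
  (forall s, B1 s -> B2 (map phi s)) /\
  (forall t, B2 t -> exists s, B1 s /\ Permutation (map phi s) t) /\
  (forall u v, B1 [u] -> B1 [v] -> phi u = phi v -> u = v).

Definition converges (d : nat) (Xs : nat -> complex) (X : complex) : Prop :=
  exists (sigmas : nat -> list nat) (sigma : list nat),
    (forall n, dcell (Xs n) d (sigmas n)) /\ dcell X d sigma /\
    forall R : nat, exists N : nat, forall n, (N <= n)%nat ->
      exists phi, simp_iso (ball d (Xs n) R (sigmas n)) (ball d X R sigma) phi /\
                  Permutation (map phi (sigmas n)) sigma.

(* Main.v *)
Require Import Defs.
From Stdlib Require Import Reals Lra Lia List Permutation Sorted Classical ClassicalEpsilon
  Relations FunctionalExtensionality PropExtensionality.
Import ListNotations.
Open Scope R_scope.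

(** All sums run over ordered cells: a form on [k]-vertex cells is summed over all lists listing
    the vertices of a cell. Moving the [i]-th vertex to the front is then a bijection of the index
    set, and this change of variables gives the adjunctions between [bdry] and the coboundaries.

    If [x] is in the spectrum on [Zspace d X], there are forms [f] with [lapl_up X f] close to
    [x f]; otherwise [T = lapl_up - x] would be bounded below on [Zspace], and iterating the
    contraction [1 - t T^2] would invert it. Truncating [f] to a ball and pulling it back along an
    isomorphism of balls gives a form [G] on [Xs n] that satisfies the same estimate. On the finite
    complex [Xs n], [lamn n] bounds the Rayleigh quotients on [Zspace] from below, so it remains to
    turn [G] into an element of [Zspace d (Xs n)]. If [x <> 0], take [lapl_up G], which is
    orthogonal to all coboundaries. If [lam = 0] and the third alternative holds, [f] is a cycle, so
    the boundary of [G] is small; [0] is not in the spectrum of [bdry delta_low] on [Kspace], so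
    [bdry delta_low h = bdry G] has a solution there, and [G - delta_low h] is a cycle with
    [delta_low h] small. *)

(** The obstacle is that membership in [Zspace] is a global condition. A form supported in a ball is
    carried to [Xs n] exactly, with its norm and its Laplacian, but its orthogonality to
    coboundaries is lost.

    Applying [lapl_up] restores orthogonality and multiplies the norm by roughly [x], so it gives
    nothing at [x = 0]. Subtracting a coboundary also works at [0], but its size must be controlled
    by the boundary of the form uniformly in [n], which is what the lower gap provides. The second
    alternative avoids [0] by passing to spectral points slightly above it, and the first one forces
    [lam <> 0].

    All tolerances are relative to the norm of [f], and the truncated form depends on [X] alone, so
    one form serves all large [n]. Ordered cells have a second advantage: an isomorphism of balls
    does not preserve increasing lists, but it does map ordered cells to ordered cells. *)

Definition eq_dec_c {A : Type} (x y : A) : {x = y} + {x <> y} :=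
  excluded_middle_informative (x = y).

Definition dec (P : Prop) : bool :=
  if excluded_middle_informative P then true else false.

Lemma dec_true (P : Prop) : dec P = true <-> P.
Proof. unfold dec; destruct (excluded_middle_informative P); split; intros; auto; discriminate. Qed.

Lemma dec_false (P : Prop) : dec P = false <-> ~ P.
Proof. unfold dec; destruct (excluded_middle_informative P); split; intros; auto; try discriminate; tauto. Qed.

Definition filt {A : Type} (P : A -> Prop) (L : list A) : list A := filter (fun a => dec (P a)) L.

Lemma in_filt {A} (P : A -> Prop) L a : In a (filt P L) <-> In a L /\ P a.
Proof. unfold filt; rewrite filter_In, dec_true; tauto. Qed.

Lemma nodup_filt {A} (P : A -> Prop) L : NoDup L -> NoDup (filt P L).
Proof. apply NoDup_filter. Qed.

Lemma NoDup_map_inj {A B} (h : A -> B) L :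
  (forall a a', In a L -> In a' L -> h a = h a' -> a = a') -> NoDup L -> NoDup (map h L).
Proof.
  intros Hi HL; induction HL as [|a L Ha HL IH]; simpl; constructor.
  - intros H; apply in_map_iff in H as [a' [E I]].
    apply Hi in E; simpl; auto; subst; auto.
  - apply IH; intros; apply Hi; simpl; auto.
Qed.

(** * Finite sums over lists *)

Definition sm {A : Type} (u : A -> R) (L : list A) : R := lsum (map u L).

Lemma lsum_app l1 l2 : lsum (l1 ++ l2) = lsum l1 + lsum l2.
Proof. unfold lsum; induction l1; simpl; [|rewrite IHl1]; lra. Qed.

Lemma sm_app {A} (u : A -> R) L1 L2 : sm u (L1 ++ L2) = sm u L1 + sm u L2.
Proof. unfold sm; now rewrite map_app, lsum_app. Qed.

Lemma sm_cons {A} (u : A -> R) a L : sm u (a :: L) = u a + sm u L.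
Proof. reflexivity. Qed.

Lemma sm_perm {A} (u : A -> R) L L' : Permutation L L' -> sm u L = sm u L'.
Proof. induction 1; rewrite ?sm_cons in *; try lra; auto. Qed.

Lemma sm_ext {A} (u v : A -> R) L : (forall a, In a L -> u a = v a) -> sm u L = sm v L.
Proof.
  induction L; intros H; auto. rewrite !sm_cons, H, IHL; simpl; auto.
  intros; apply H; simpl; auto.
Qed.

Lemma sm_add {A} (u v : A -> R) L : sm (fun a => u a + v a) L = sm u L + sm v L.
Proof. induction L; rewrite ?sm_cons, ?IHL; unfold sm; simpl; lra. Qed.

Lemma sm_scal {A} c (u : A -> R) L : sm (fun a => c * u a) L = c * sm u L.
Proof. induction L; rewrite ?sm_cons, ?IHL; unfold sm; simpl; lra. Qed.

Lemma sm_zero {A} (u : A -> R) L : (forall a, In a L -> u a = 0) -> sm u L = 0.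
Proof.
  induction L; intros H; auto. rewrite sm_cons, H, IHL; simpl; auto; try lra.
  intros; apply H; simpl; auto.
Qed.

Lemma sm_const {A} c (L : list A) : sm (fun _ => c) L = INR (length L) * c.
Proof.
  induction L; [unfold sm; simpl; lra|].
  rewrite sm_cons, IHL; simpl length; rewrite S_INR; lra.
Qed.

Lemma sm_le {A} (u v : A -> R) L : (forall a, In a L -> u a <= v a) -> sm u L <= sm v L.
Proof.
  induction L; intros H; [unfold sm; simpl; lra|]. rewrite !sm_cons.
  apply Rplus_le_compat; [apply H; simpl; auto | apply IHL; intros; apply H; simpl; auto].
Qed.

Lemma sm_ge0 {A} (u : A -> R) L : (forall a, In a L -> 0 <= u a) -> 0 <= sm u L.
Proof.
  intros H; rewrite <- (sm_zero (fun _ : A => 0) L) by auto; now apply sm_le.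
Qed.

Lemma sm_map {A B} (h : A -> B) (u : B -> R) L : sm u (map h L) = sm (fun a => u (h a)) L.
Proof. unfold sm; now rewrite map_map. Qed.

Lemma sm_flat_map {A B} (h : A -> list B) (u : B -> R) L :
  sm u (flat_map h L) = sm (fun a => sm u (h a)) L.
Proof. induction L; auto. simpl; rewrite sm_app, sm_cons, IHL; auto. Qed.

Lemma sm_filt_split {A} (u : A -> R) (P : A -> Prop) L :
  sm u L = sm u (filt P L) + sm u (filt (fun a => ~ P a) L).
Proof.
  induction L; [unfold sm; simpl; lra|].
  unfold filt; simpl. fold (filt P L) (filt (fun a => ~ P a) L).
  destruct (dec (P a)) eqn:E.
  - rewrite (proj2 (dec_false (~ P a))) by (rewrite dec_true in E; tauto).
    rewrite !sm_cons; lra.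
  - rewrite (proj2 (dec_true (~ P a))) by (rewrite dec_false in E; tauto).
    rewrite !sm_cons; lra.
Qed.

Lemma sm_filt {A} (u : A -> R) (P : A -> Prop) L :
  (forall a, In a L -> ~ P a -> u a = 0) -> sm u (filt P L) = sm u L.
Proof.
  intros H; rewrite (sm_filt_split u P L).
  rewrite (sm_zero u (filt (fun a => ~ P a) L)); [lra|].
  intros a Ha; apply in_filt in Ha as [? ?]; auto.
Qed.

Lemma sm_exchange {A B} (u : A -> B -> R) L M :
  sm (fun a => sm (u a) M) L = sm (fun b => sm (fun a => u a b) L) M.
Proof.
  induction L.
  - symmetry; apply sm_zero; auto.
  - rewrite sm_cons, IHL, <- sm_add; auto.
Qed.

(** Cauchy-Schwarz against the constant [1]. The factor [length L] becomes a degree in the bound for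
    [bdry] and a number of faces in the bound for [Dc]. *)
Lemma sm_CS {A} (u : A -> R) L : (sm u L) ^ 2 <= INR (length L) * sm (fun a => u a ^ 2) L.
Proof.
  induction L as [|a L IH]; [unfold sm; simpl; lra|].
  rewrite !sm_cons; simpl length; rewrite S_INR.
  set (s := sm u L) in *. set (q := sm (fun a => u a ^ 2) L) in *.
  set (n := INR (length L)) in *.
  assert (Hn : 0 <= n) by apply pos_INR.
  assert (Hq : 0 <= q) by (apply sm_ge0; intros; apply pow2_ge_0).
  destruct (Req_dec n 0) as [E|E].
  (* For empty [L] the division by [n] used in the other case is impossible, but the induction
     hypothesis already gives [s = 0]. *)
  - assert (s ^ 2 <= 0) by (rewrite E in IH; lra).
    assert (s = 0) by nra. rewrite E, H0. nra.
  - (* 2 x s <= n x^2 + s^2 / n *)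
    assert (2 * u a * s <= n * u a ^ 2 + q).
    { assert (s ^ 2 / n <= q).
      { apply Rmult_le_reg_l with n; [lra|].
        replace (n * (s ^ 2 / n)) with (s ^ 2) by (field; auto). lra. }
      assert (0 <= (n * u a - s) ^ 2 / n).
      { apply Rmult_le_pos; [apply pow2_ge_0 | left; apply Rinv_0_lt_compat; lra]. }
      replace ((n * u a - s) ^ 2 / n) with (n * u a ^ 2 - 2 * u a * s + s ^ 2 / n) in H0
        by (field; auto). lra. }
    nra.
Qed.

Lemma NoDup_ext_sm {A} (u : A -> R) L M :
  NoDup L -> NoDup M -> (forall a, In a L <-> In a M) -> sm u L = sm u M.
Proof. intros; apply sm_perm, NoDup_Permutation; auto. Qed.

(** * Unconditional sums *)

Definition subl {A : Type} (P : A -> Prop) (L : list A) : Prop :=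
  NoDup L /\ forall a, In a L -> P a.

(** Convergence along the net of finite subsets. The supremum in [HasSum] sees only positive terms,
    whereas inner products are sums of signed terms. *)
Definition has_sum {A : Type} (P : A -> Prop) (u : A -> R) (l : R) : Prop :=
  forall eps, 0 < eps -> exists F, subl P F /\
    forall L, subl P L -> incl F L -> Rabs (sm u L - l) < eps.

Definition summable {A : Type} (P : A -> Prop) (u : A -> R) : Prop := exists l, has_sum P u l.

Definition tsum {A : Type} (P : A -> Prop) (u : A -> R) : R := epsilon (inhabits 0) (has_sum P u).

Definition uni {A : Type} (L M : list A) : list A := nodup eq_dec_c (L ++ M).

Lemma in_uni {A} (L M : list A) a : In a (uni L M) <-> In a L \/ In a M.
Proof. unfold uni; rewrite nodup_In, in_app_iff; tauto. Qed.

Lemma subl_uni {A} (P : A -> Prop) L M : subl P L -> subl P M -> subl P (uni L M).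
Proof.
  intros [_ H1] [_ H2]; split; [apply NoDup_nodup|].
  intros a Ha; apply in_uni in Ha as [|]; auto.
Qed.

Lemma incl_uni_l {A} (L M : list A) : incl L (uni L M).
Proof. intros a Ha; apply in_uni; auto. Qed.

Lemma incl_uni_r {A} (L M : list A) : incl M (uni L M).
Proof. intros a Ha; apply in_uni; auto. Qed.

Lemma subl_nil {A} (P : A -> Prop) : subl P [].
Proof. split; [constructor | simpl; tauto]. Qed.

Lemma has_sum_unique {A} (P : A -> Prop) u l l' : has_sum P u l -> has_sum P u l' -> l = l'.
Proof.
  intros H H'. destruct (Req_dec l l') as [|E]; auto. exfalso.
  assert (He : 0 < Rabs (l - l') / 2) by (assert (0 < Rabs (l - l')) by (apply Rabs_pos_lt; lra); lra).
  destruct (H _ He) as [F [HF K]], (H' _ He) as [F' [HF' K']].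
  specialize (K _ (subl_uni P F F' HF HF') (incl_uni_l _ _)).
  specialize (K' _ (subl_uni P F F' HF HF') (incl_uni_r _ _)).
  set (x := sm u (uni F F')) in *.
  assert (Rabs (l - l') <= Rabs (x - l) + Rabs (x - l')); [|lra].
  replace (l - l') with ((x - l') - (x - l)) by ring.
  eapply Rle_trans; [apply Rabs_triang|]. rewrite Rabs_Ropp. lra.
Qed.

Lemma tsum_eq {A} (P : A -> Prop) u l : has_sum P u l -> tsum P u = l.
Proof.
  intros H; apply (has_sum_unique P u); auto.
  unfold tsum; apply epsilon_spec; eauto.
Qed.

Lemma tsum_spec {A} (P : A -> Prop) u : summable P u -> has_sum P u (tsum P u).
Proof. intros H; unfold tsum; apply epsilon_spec; auto. Qed.

Lemma has_sum_ext {A} (P : A -> Prop) u v l :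
  (forall a, P a -> u a = v a) -> has_sum P u l -> has_sum P v l.
Proof.
  intros E H eps He; destruct (H eps He) as [F [HF K]]; exists F; split; auto.
  intros L HL HI; rewrite <- (sm_ext u v); auto.
  intros a Ha; apply E, HL, Ha.
Qed.

Lemma has_sum_add {A} (P : A -> Prop) u v l m :
  has_sum P u l -> has_sum P v m -> has_sum P (fun a => u a + v a) (l + m).
Proof.
  intros H1 H2 eps He.
  destruct (H1 (eps/2)) as [F [HF K]]; [lra|]. destruct (H2 (eps/2)) as [F' [HF' K']]; [lra|].
  exists (uni F F'); split; [apply subl_uni; auto|]. intros L HL HI. rewrite sm_add.
  specialize (K L HL (fun a Ha => HI a (incl_uni_l F F' a Ha))).
  specialize (K' L HL (fun a Ha => HI a (incl_uni_r F F' a Ha))).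
  replace (sm u L + sm v L - (l + m)) with ((sm u L - l) + (sm v L - m)) by ring.
  eapply Rle_lt_trans; [apply Rabs_triang|]; lra.
Qed.

Lemma has_sum_scal {A} (P : A -> Prop) c u l :
  has_sum P u l -> has_sum P (fun a => c * u a) (c * l).
Proof.
  intros H eps He.
  assert (Hc : 0 < Rabs c + 1) by (pose proof (Rabs_pos c); lra).
  destruct (H (eps / (Rabs c + 1))) as [F [HF K]]; [apply Rdiv_lt_0_compat; lra|].
  exists F; split; auto. intros L HL HI. rewrite sm_scal.
  specialize (K L HL HI).
  replace (c * sm u L - c * l) with (c * (sm u L - l)) by ring. rewrite Rabs_mult.
  set (x := Rabs (sm u L - l)) in *.
  apply (Rmult_lt_compat_r (Rabs c + 1)) in K; auto.
  replace (eps / (Rabs c + 1) * (Rabs c + 1)) with eps in K by (field; lra).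
  assert (0 <= x) by apply Rabs_pos. pose proof (Rabs_pos c). nra.
Qed.

Lemma has_sum_zero {A} (P : A -> Prop) : has_sum P (fun _ : A => 0) 0.
Proof.
  intros eps He; exists []; split; [apply subl_nil|]; intros L _ _.
  rewrite sm_zero by auto. rewrite Rminus_0_r, Rabs_R0; auto.
Qed.

Lemma has_sum_le {A} (P : A -> Prop) u v l m :
  (forall a, P a -> u a <= v a) -> has_sum P u l -> has_sum P v m -> l <= m.
Proof.
  intros Huv H1 H2. apply Rnot_lt_le; intros Hlt.
  destruct (H1 ((l-m)/2)) as [F [HF K]]; [lra|]. destruct (H2 ((l-m)/2)) as [F' [HF' K']]; [lra|].
  specialize (K _ (subl_uni P F F' HF HF') (incl_uni_l _ _)).
  specialize (K' _ (subl_uni P F F' HF HF') (incl_uni_r _ _)).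
  apply Rabs_def2 in K; apply Rabs_def2 in K'.
  assert (sm u (uni F F') <= sm v (uni F F')); [|lra].
  apply sm_le; intros a Ha; apply Huv, (subl_uni P F F' HF HF'), Ha.
Qed.

Lemma sm_incl_le {A} (u : A -> R) L M :
  NoDup L -> NoDup M -> incl L M -> (forall a, In a M -> 0 <= u a) -> sm u L <= sm u M.
Proof.
  intros HL HM HI H0.
  rewrite (sm_filt_split u (fun a => In a L) M).
  rewrite (NoDup_ext_sm u L (filt (fun a => In a L) M)); auto.
  - assert (0 <= sm u (filt (fun a => ~ In a L) M)); [|lra].
    apply sm_ge0; intros a Ha; apply in_filt in Ha as [? ?]; auto.
  - now apply nodup_filt.
  - intros a; rewrite in_filt; split; [split; auto | tauto].
Qed.

Lemma has_sum_ub {A} (P : A -> Prop) u l L :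
  (forall a, P a -> 0 <= u a) -> has_sum P u l -> subl P L -> sm u L <= l.
Proof.
  intros H0 H HL. apply Rnot_lt_le; intros Hlt.
  destruct (H (sm u L - l)) as [F [HF K]]; [lra|].
  specialize (K _ (subl_uni P F L HF HL) (incl_uni_l _ _)). apply Rabs_def2 in K.
  assert (sm u L <= sm u (uni F L)); [|lra].
  apply sm_incl_le; [apply HL | apply (subl_uni P F L HF HL) | apply incl_uni_r|].
  intros a Ha; apply H0, (subl_uni P F L HF HL), Ha.
Qed.

Lemma has_sum_lub {A} (P : A -> Prop) u l :
  (forall a, P a -> 0 <= u a) ->
  is_lub (fun x => exists L, subl P L /\ x = sm u L) l -> has_sum P u l.
Proof.
  intros H0 [Hub Hl] eps He.
  destruct (classic (exists F, subl P F /\ l - eps < sm u F)) as [[F [HF K]]|N].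
  - exists F; split; auto. intros L HL HI.
    assert (sm u L <= l) by (apply Hub; eauto).
    assert (sm u F <= sm u L).
    { apply sm_incl_le; [apply HF | apply HL | auto | intros; apply H0, HL; auto]. }
    apply Rabs_def1; lra.
  - exfalso. assert (l <= l - eps); [|lra]. apply Hl.
    intros x [L [HL ->]]. apply Rnot_lt_le; intros ?; apply N; eauto.
Qed.

Lemma has_sum_is_lub {A} (P : A -> Prop) u l :
  (forall a, P a -> 0 <= u a) -> has_sum P u l ->
  is_lub (fun x => exists L, subl P L /\ x = sm u L) l.
Proof.
  intros H0 H; split.
  - intros x [L [HL ->]]; now apply (has_sum_ub P).
  - intros b Hb. apply Rnot_lt_le; intros Hlt.
    destruct (H (l - b)) as [F [HF K]]; [lra|].
    specialize (K F HF (incl_refl _)). apply Rabs_def2 in K.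
    assert (sm u F <= b) by (apply Hb; eauto). lra.
Qed.

Lemma summable_bounded {A} (P : A -> Prop) u M :
  (forall a, P a -> 0 <= u a) -> (forall L, subl P L -> sm u L <= M) ->
  summable P u /\ tsum P u <= M.
Proof.
  intros H0 HM.
  destruct (completeness (fun x => exists L, subl P L /\ x = sm u L)) as [l Hl].
  - exists M; intros x [L [HL ->]]; auto.
  - exists 0, []; split; [apply subl_nil | reflexivity].
  - assert (H := has_sum_lub P u l H0 Hl). split; [exists l; auto|].
    rewrite (tsum_eq P u l H). apply Hl. intros x [L [HL ->]]; auto.
Qed.

Lemma has_sum_ge0 {A} (P : A -> Prop) u l : (forall a, P a -> 0 <= u a) -> has_sum P u l -> 0 <= l.
Proof. intros H0 H; apply (has_sum_le P (fun _ => 0) u); auto using has_sum_zero. Qed.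

Lemma summable_dom0 {A} (P : A -> Prop) u v :
  (forall a, P a -> 0 <= u a <= v a) -> summable P v -> summable P u /\ tsum P u <= tsum P v.
Proof.
  intros H Hv. apply summable_bounded; [intros; apply H; auto|].
  intros L HL. apply Rle_trans with (sm v L).
  - apply sm_le; intros; apply H, HL; auto.
  - apply (has_sum_ub P); auto using tsum_spec. intros a Ha; destruct (H a Ha); lra.
Qed.

Lemma summable_add {A} (P : A -> Prop) u v :
  summable P u -> summable P v -> summable P (fun a => u a + v a).
Proof. intros [l H] [m K]; exists (l + m); now apply has_sum_add. Qed.

Lemma summable_scal {A} (P : A -> Prop) c u : summable P u -> summable P (fun a => c * u a).
Proof. intros [l H]; exists (c * l); now apply has_sum_scal. Qed.

Lemma summable_ext {A} (P : A -> Prop) u v :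
  (forall a, P a -> u a = v a) -> summable P u -> summable P v.
Proof. intros E [l H]; exists l; now apply (has_sum_ext P u). Qed.

(** [u] is the difference of the nonnegative families [u + v] and [v], the first of which is
    dominated by [2 * v]. *)
Lemma summable_dom {A} (P : A -> Prop) u v :
  (forall a, P a -> Rabs (u a) <= v a) -> summable P v -> summable P u.
Proof.
  intros H Hv.
  assert (K : summable P (fun a => u a + v a)).
  { apply (summable_dom0 P _ (fun a => 2 * v a)); [|apply summable_scal; auto].
    intros a Ha; specialize (H a Ha). pose proof (Rle_abs (u a)); pose proof (Rle_abs (- u a)). rewrite Rabs_Ropp in *. lra. }
  apply (summable_ext P (fun a => (u a + v a) + (-1) * v a)); [intros; ring|].
  apply summable_add; auto. apply summable_scal; auto.
Qed.

Lemma tsum_add {A} (P : A -> Prop) u v :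
  summable P u -> summable P v -> tsum P (fun a => u a + v a) = tsum P u + tsum P v.
Proof. intros; apply tsum_eq, has_sum_add; now apply tsum_spec. Qed.

Lemma tsum_scal {A} (P : A -> Prop) c u :
  summable P u -> tsum P (fun a => c * u a) = c * tsum P u.
Proof. intros; apply tsum_eq, has_sum_scal; now apply tsum_spec. Qed.

Lemma tsum_ext {A} (P : A -> Prop) u v :
  (forall a, P a -> u a = v a) -> summable P u -> tsum P u = tsum P v.
Proof. intros; symmetry; apply tsum_eq, (has_sum_ext P u); auto. now apply tsum_spec. Qed.

Lemma has_sum_sm {A B} (P : A -> Prop) (u : B -> A -> R) (l : B -> R) M :
  (forall b, In b M -> has_sum P (u b) (l b)) ->
  has_sum P (fun a => sm (fun b => u b a) M) (sm l M).
Proof.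
  induction M as [|b M IH]; intros H.
  - apply (has_sum_ext P (fun _ => 0)); [reflexivity|apply has_sum_zero].
  - apply (has_sum_ext P (fun a => u b a + sm (fun b => u b a) M)); [reflexivity|].
    rewrite sm_cons. apply has_sum_add; [apply H; simpl; auto | apply IH; intros; apply H; simpl; auto].
Qed.

Lemma summable_finite {A} (P : A -> Prop) u F :
  NoDup F -> (forall a, In a F <-> P a) -> has_sum P u (sm u F).
Proof.
  intros HF HP eps He. exists F; split; [split; auto; intros; apply HP; auto|].
  intros L [HL HL'] HI. rewrite (NoDup_ext_sm u L F); auto.
  - rewrite Rminus_diag_eq, Rabs_R0; auto.
  - intros a; split; auto. intros; apply HP; auto.
Qed.

(** A map with finite fibres, each listed explicitly. Two instances occur: dropping the first vertex
    of an ordered cell, and sorting an ordered cell. *)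
Definition fibres {A B : Type} (P : A -> Prop) (Q : B -> Prop) (p : A -> B) (fib : B -> list A) : Prop :=
  (forall a, P a -> Q (p a)) /\
  (forall b, Q b -> NoDup (fib b) /\ forall a, In a (fib b) <-> P a /\ p a = b).

Lemma fibres_flat {A B} (P : A -> Prop) (Q : B -> Prop) p fib L :
  fibres P Q p fib -> subl Q L ->
  subl P (flat_map fib L) /\ forall a, In a (flat_map fib L) <-> P a /\ In (p a) L.
Proof.
  intros [H1 H2] [HL HQ].
  assert (K : forall a, In a (flat_map fib L) <-> P a /\ In (p a) L).
  { intros a; rewrite in_flat_map; split.
    - intros [b [Hb Ha]]. apply (H2 b (HQ b Hb)) in Ha as [? <-]; auto.
    - intros [Ha Hp]; exists (p a); split; auto. apply (H2 (p a) (HQ _ Hp)); auto. }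
  split; auto. split; [|intros a Ha; apply K, Ha]. clear K.
  induction HL as [|b L Hb HL IH]; simpl; [constructor|].
  apply NoDup_app.
  - apply H2, HQ; simpl; auto.
  - apply IH; intros; apply HQ; simpl; auto.
  - intros a Ha Hf. apply in_flat_map in Hf as [b' [Hb' Ha']].
    apply H2 in Ha as [_ E]; [|apply HQ; simpl; auto].
    apply H2 in Ha' as [_ E']; [|apply HQ; simpl; auto]. subst; auto.
Qed.

Lemma has_sum_fibres {A B} (P : A -> Prop) (Q : B -> Prop) p fib u l :
  fibres P Q p fib -> has_sum P u l -> has_sum Q (fun b => sm u (fib b)) l.
Proof.
  intros HF H eps He. destruct (H eps He) as [F [HF' K]].
  exists (nodup eq_dec_c (map p F)). split.
  - split; [apply NoDup_nodup|]. intros b Hb. rewrite nodup_In, in_map_iff in Hb.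
    destruct Hb as [a [<- Ha]]. apply HF, HF', Ha.
  - intros L HL HI. destruct (fibres_flat P Q p fib L HF HL) as [K1 K2].
    rewrite <- sm_flat_map. apply K; auto.
    intros a Ha. apply K2; split; [apply HF', Ha|].
    apply HI, nodup_In, in_map, Ha.
Qed.

(** Grouping can hide cancellation, hence the sign condition. A finite list lies in the union of the
    fibres that it meets, so its sum is at most [l]; this gives summability, and uniqueness of sums
    identifies the value. *)
Lemma has_sum_fibres_inv {A B} (P : A -> Prop) (Q : B -> Prop) p fib u l :
  fibres P Q p fib -> (forall a, P a -> 0 <= u a) ->
  has_sum Q (fun b => sm u (fib b)) l -> has_sum P u l.
Proof.
  intros HF H0 H.
  assert (S : summable P u).
  { apply (summable_bounded P u l H0). intros L HL.
    set (M := nodup eq_dec_c (map p L)).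
    assert (HM : subl Q M).
    { split; [apply NoDup_nodup|]. intros b Hb. unfold M in Hb.
      rewrite nodup_In, in_map_iff in Hb. destruct Hb as [a [<- Ha]]. apply HF, HL, Ha. }
    destruct (fibres_flat P Q p fib M HF HM) as [K1 K2].
    apply Rle_trans with (sm u (flat_map fib M)).
    - apply sm_incl_le; [apply HL | apply K1 | | intros; apply H0, K1; auto].
      intros a Ha; apply K2; split; [apply HL, Ha | apply nodup_In, in_map, Ha].
    - rewrite sm_flat_map. apply (has_sum_ub Q); auto.
      intros b Hb; apply sm_ge0; intros a Ha. apply H0. apply (proj2 HF b Hb) in Ha; tauto. }
  destruct S as [m Hm]. replace l with m; auto.
  apply (has_sum_unique Q (fun b => sm u (fib b))); auto. now apply (has_sum_fibres P Q p).
Qed.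

(** [h] and [k] are mutually inverse only where the terms do not vanish. This is what an isomorphism
    of balls provides: it says nothing about cells outside the ball, where the transported forms are
    zero. *)
Lemma has_sum_transfer {A B} (P : A -> Prop) (Q : B -> Prop) (u : A -> R) (w : B -> R)
    (h : A -> B) (k : B -> A) l :
  (forall a, P a -> u a <> 0 -> Q (h a) /\ k (h a) = a /\ w (h a) = u a) ->
  (forall b, Q b -> w b <> 0 -> P (k b) /\ h (k b) = b /\ u (k b) = w b) ->
  has_sum Q w l -> has_sum P u l.
Proof.
  intros Hh Hk H eps He. destruct (H eps He) as [F [HF K]].
  exists (map k (filt (fun b => w b <> 0) F)). split; [split|].
  - apply NoDup_map_inj; [|apply nodup_filt, HF].
    intros b b' Hb Hb' E. apply in_filt in Hb as [Hb Nb]. apply in_filt in Hb' as [Hb' Nb'].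
    destruct (Hk b) as [_ [E1 _]]; auto; [apply HF; auto|].
    destruct (Hk b') as [_ [E2 _]]; auto; [apply HF; auto|]. congruence.
  - intros a Ha. apply in_map_iff in Ha as [b [<- Hb]]. apply in_filt in Hb as [Hb Nb].
    apply Hk; auto; apply HF; auto.
  - intros L HL HI.
    (* [F0] carries only zero terms; it is appended so that the list contains all of [F], as
       convergence along the net demands. *)
    set (L1 := filt (fun a => u a <> 0) L). set (F0 := filt (fun b => w b = 0) F).
    assert (HL1 : forall a, In a L1 -> P a /\ u a <> 0).
    { intros a Ha; apply in_filt in Ha as [Ha Na]; split; auto; apply HL; auto. }
    assert (E : sm u L = sm w (map h L1 ++ F0)).
    { rewrite sm_app, (sm_zero w F0), Rplus_0_r.
      - rewrite sm_map, <- (sm_filt u (fun a => u a <> 0) L).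
        + apply sm_ext; intros a Ha. symmetry; apply Hh; apply HL1; auto.
        + intros a _ N; destruct (Req_dec (u a) 0); tauto.
      - intros b Hb; apply in_filt in Hb; tauto. }
    rewrite E. apply K.
    + split.
      * apply NoDup_app; [| apply nodup_filt, HF |].
        -- apply NoDup_map_inj; [|apply nodup_filt, HL].
           intros a a' Ha Ha' E'. apply HL1 in Ha as [Ha Na]. apply HL1 in Ha' as [Ha' Na'].
           destruct (Hh a) as [_ [E1 _]]; auto. destruct (Hh a') as [_ [E2 _]]; auto. congruence.
        -- intros b Hb Hb'. apply in_map_iff in Hb as [a [<- Ha]]. apply HL1 in Ha as [Ha Na].
           apply in_filt in Hb' as [_ W]. destruct (Hh a) as [_ [_ E1]]; auto. congruence.
      * intros b Hb. apply in_app_iff in Hb as [Hb|Hb].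
        -- apply in_map_iff in Hb as [a [<- Ha]]. apply HL1 in Ha as [Ha Na]. now apply Hh.
        -- apply in_filt in Hb as [Hb _]. apply HF, Hb.
    + intros b Hb. apply in_app_iff.
      destruct (Req_dec (w b) 0) as [W|W].
      * right; apply in_filt; auto.
      * left. destruct (Hk b) as [K1 [K2 K3]]; auto; [apply HF; auto|].
        apply in_map_iff; exists (k b); split; auto. apply in_filt; split; [|congruence].
        apply HI, in_map, in_filt; auto.
Qed.

(** * Weighted l2 spaces *)

Definition lin {A : Type} (a : R) (f : A -> R) (b : R) (g : A -> R) : A -> R :=
  fun s => a * f s + b * g s.

(** For [c > 0] evaluate at the vertex [- b / c] of the parabola; [c = 0] forces [b = 0], and
    [c < 0] is impossible. In this form it yields Cauchy-Schwarz for semidefinite forms too. *)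
Lemma quadratic_disc a b c : (forall t, 0 <= a + 2 * t * b + t ^ 2 * c) -> b ^ 2 <= a * c.
Proof.
  intros H.
  destruct (Rtotal_order c 0) as [Hc|[Hc|Hc]].
  - pose proof (H 0) as H0. exfalso.
    (* Chosen so that [t > 1] and [t * - c] exceeds [|a| + 2|b| + 1], which makes the quadratic
       negative at [t]. *)
    set (t := (Rabs a + 2 * Rabs b + 1) / - c + 1).
    pose proof (Rabs_pos a) as Pa; pose proof (Rabs_pos b) as Pb.
    assert (Hx : 0 < (Rabs a + 2 * Rabs b + 1) / - c) by (apply Rdiv_lt_0_compat; lra).
    assert (Ht : 1 < t) by (unfold t; lra).
    assert (Htc : t * - c > Rabs a + 2 * Rabs b + 1).
    { unfold t. rewrite Rmult_plus_distr_r.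
      replace ((Rabs a + 2 * Rabs b + 1) / - c * - c) with (Rabs a + 2 * Rabs b + 1) by (field; lra). lra. }
    specialize (H t). pose proof (Rle_abs a); pose proof (Rle_abs b). nra.
  - subst c. destruct (Req_dec b 0) as [->|Hb]; [lra|]. exfalso.
    specialize (H (- (a + 1) / (2 * b))).
    replace (a + 2 * (- (a + 1) / (2 * b)) * b + (- (a + 1) / (2 * b)) ^ 2 * 0) with (-1) in H
      by (field; auto). lra.
  - specialize (H (- b / c)).
    replace (a + 2 * (- b / c) * b + (- b / c) ^ 2 * c) with ((a * c - b ^ 2) / c) in H
      by (field; lra).
    apply (Rmult_le_compat_r c) in H; [|lra].
    replace ((a * c - b ^ 2) / c * c) with (a * c - b ^ 2) in H by (field; lra). lra.
Qed.

Section WeightedL2.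
Context {A : Type} (P : A -> Prop) (W : A -> R).

Definition L2 (f : A -> R) : Prop := summable P (fun s => f s ^ 2 * W s).
Definition ip (f g : A -> R) : R := tsum P (fun s => f s * g s * W s).
Definition Nm (f : A -> R) : R := sqrt (ip f f).

Hypothesis HW : forall s, P s -> 0 < W s.

Lemma ip_summable f g : L2 f -> L2 g -> summable P (fun s => f s * g s * W s).
Proof.
  intros Hf Hg. apply (summable_dom P _ (fun s => f s ^ 2 * W s + g s ^ 2 * W s)).
  - intros s Hs. specialize (HW s Hs).
    rewrite <- Rmult_plus_distr_r, Rabs_mult, (Rabs_pos_eq (W s)) by lra.
    apply Rmult_le_compat_r; [lra|]. apply Rabs_le.
    pose proof (pow2_ge_0 (f s + g s)); pose proof (pow2_ge_0 (f s - g s)).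
    pose proof (pow2_ge_0 (f s)); pose proof (pow2_ge_0 (g s)). split; lra.
  - now apply summable_add.
Qed.

Lemma L2_lin a f b g : L2 f -> L2 g -> L2 (lin a f b g).
Proof.
  intros Hf Hg.
  apply (summable_dom0 P _ (fun s => 2 * a ^ 2 * (f s ^ 2 * W s) + 2 * b ^ 2 * (g s ^ 2 * W s))).
  - intros s Hs. specialize (HW s Hs). unfold lin. split.
    + apply Rmult_le_pos; [apply pow2_ge_0 | lra].
    + replace (2 * a ^ 2 * (f s ^ 2 * W s) + 2 * b ^ 2 * (g s ^ 2 * W s))
        with ((2 * (a * f s) ^ 2 + 2 * (b * g s) ^ 2) * W s) by ring.
      apply Rmult_le_compat_r; [lra|].
      pose proof (pow2_ge_0 (a * f s - b * g s)). lra.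
  - apply summable_add; now apply summable_scal.
Qed.

Lemma L2_ext f g : (forall s, P s -> f s = g s) -> L2 f -> L2 g.
Proof. intros E; apply summable_ext; intros s Hs; now rewrite E. Qed.

Lemma ip_sym f g : ip f g = ip g f.
Proof.
  unfold ip; f_equal; apply functional_extensionality; intros; ring.
Qed.

Lemma ip_ext f f' g g' : (forall s, P s -> f s = f' s) -> (forall s, P s -> g s = g' s) ->
  L2 f -> L2 g -> ip f g = ip f' g'.
Proof.
  intros E E' Hf Hg; apply tsum_ext; [intros s Hs; now rewrite E, E' | now apply ip_summable].
Qed.

Lemma ip_lin_l a f b g h : L2 f -> L2 g -> L2 h -> ip (lin a f b g) h = a * ip f h + b * ip g h.
Proof.
  intros Hf Hg Hh. unfold ip.
  rewrite <- !tsum_scal, <- tsum_add by (try apply summable_scal; now apply ip_summable).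
  f_equal; apply functional_extensionality; intros; unfold lin; ring.
Qed.

Lemma ip_lin_r a f b g h : L2 f -> L2 g -> L2 h -> ip h (lin a f b g) = a * ip h f + b * ip h g.
Proof. intros; rewrite ip_sym, ip_lin_l, (ip_sym f), (ip_sym g); auto. Qed.

Lemma ip_ge0 f : L2 f -> 0 <= ip f f.
Proof.
  intros Hf. apply (has_sum_ge0 P (fun s => f s * f s * W s)).
  - intros s Hs; specialize (HW s Hs); nra.
  - apply tsum_spec, ip_summable; auto.
Qed.

Lemma ip_lin2 a f b g : L2 f -> L2 g ->
  ip (lin a f b g) (lin a f b g) = a ^ 2 * ip f f + 2 * a * b * ip f g + b ^ 2 * ip g g.
Proof.
  intros Hf Hg. rewrite ip_lin_l, !ip_lin_r, (ip_sym g f) by (auto using L2_lin). ring.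
Qed.

Lemma ip_CS f g : L2 f -> L2 g -> ip f g ^ 2 <= ip f f * ip g g.
Proof.
  intros Hf Hg. apply quadratic_disc. intros t.
  replace (ip f f + 2 * t * ip f g + t ^ 2 * ip g g) with (ip (lin 1 f t g) (lin 1 f t g))
    by (rewrite ip_lin2; auto; ring).
  apply ip_ge0, L2_lin; auto.
Qed.

Lemma Nm_ge0 f : 0 <= Nm f.
Proof. apply sqrt_pos. Qed.

Lemma Nm_sq f : L2 f -> Nm f * Nm f = ip f f.
Proof. intros; apply sqrt_sqrt, ip_ge0; auto. Qed.

Lemma ip_le_Nm f g : L2 f -> L2 g -> Rabs (ip f g) <= Nm f * Nm g.
Proof.
  intros Hf Hg. unfold Nm. rewrite <- sqrt_mult by (apply ip_ge0; auto).
  rewrite <- (sqrt_Rsqr_abs (ip f g)). apply sqrt_le_1_alt.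
  unfold Rsqr. pose proof (ip_CS f g Hf Hg). nra.
Qed.

Lemma Nm_le_of_sq f B : L2 f -> 0 <= B -> ip f f <= B * B -> Nm f <= B.
Proof. intros Hf HB H. unfold Nm. rewrite <- (sqrt_square B HB). now apply sqrt_le_1_alt. Qed.

Lemma Nm_lin a f b g : L2 f -> L2 g -> Nm (lin a f b g) <= Rabs a * Nm f + Rabs b * Nm g.
Proof.
  intros Hf Hg. pose proof (Nm_ge0 f); pose proof (Nm_ge0 g).
  pose proof (Rabs_pos a); pose proof (Rabs_pos b).
  apply Nm_le_of_sq; [apply L2_lin; auto | nra |].
  rewrite ip_lin2 by auto. rewrite <- !Nm_sq by auto.
  pose proof (ip_le_Nm f g Hf Hg).
  assert (a * b * ip f g <= Rabs a * Rabs b * (Nm f * Nm g)).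
  { eapply Rle_trans; [apply Rle_abs|]. rewrite !Rabs_mult. apply Rmult_le_compat_l; nra. }
  assert (a ^ 2 = Rabs a * Rabs a) by (rewrite <- Rabs_mult, Rabs_pos_eq; nra).
  assert (b ^ 2 = Rabs b * Rabs b) by (rewrite <- Rabs_mult, Rabs_pos_eq; nra).
  nra.
Qed.

Lemma Nm_ext f g : (forall s, P s -> f s = g s) -> L2 f -> Nm f = Nm g.
Proof. intros E Hf; unfold Nm; f_equal; apply ip_ext; auto. Qed.

Lemma Nm_scal a f : L2 f -> Nm (lin a f 0 f) = Rabs a * Nm f.
Proof.
  intros Hf. unfold Nm. rewrite ip_lin2 by auto.
  replace (a ^ 2 * ip f f + 2 * a * 0 * ip f f + 0 ^ 2 * ip f f) with (Rsqr a * ip f f)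
    by (unfold Rsqr; ring).
  rewrite sqrt_mult; [|apply Rle_0_sqr | apply ip_ge0; auto]. now rewrite sqrt_Rsqr_abs.
Qed.

Lemma point_le f s : L2 f -> P s -> f s ^ 2 * W s <= ip f f.
Proof.
  intros Hf Hs. unfold ip.
  replace (f s ^ 2 * W s) with (sm (fun s => f s * f s * W s) [s]) by (unfold sm; simpl; ring).
  apply (has_sum_ub P).
  - intros a Ha; specialize (HW a Ha); nra.
  - apply tsum_spec, ip_summable; auto.
  - split; [constructor; simpl; auto; constructor|]. intros a [->|[]]; auto.
Qed.

Lemma Nm_zero f : L2 f -> Nm f <= 0 -> forall s, P s -> f s = 0.
Proof.
  intros Hf H s Hs. pose proof (Nm_ge0 f). pose proof (point_le f s Hf Hs) as Hp.
  rewrite <- Nm_sq in Hp by auto. replace (Nm f) with 0 in Hp by lra.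
  specialize (HW s Hs).
  assert (f s ^ 2 <= 0); [|nra].
  apply Rmult_le_reg_r with (W s); lra.
Qed.

Definition cvg (fs : nat -> A -> R) (f : A -> R) : Prop :=
  forall eps, 0 < eps -> exists N, forall k, (N <= k)%nat -> Nm (lin 1 (fs k) (-1) f) <= eps.

Lemma abs_le_Nm h s : L2 h -> P s -> Rabs (h s) * sqrt (W s) <= Nm h.
Proof.
  intros Hh Hs. rewrite <- sqrt_Rsqr_abs, <- sqrt_mult;
    [|apply Rle_0_sqr | specialize (HW s Hs); lra].
  apply sqrt_le_1_alt. unfold Rsqr. pose proof (point_le h s Hh Hs). simpl in *. lra.
Qed.

Lemma abs_lt_Nm h s eps : L2 h -> P s -> 0 < eps -> Nm h <= eps * sqrt (W s) / 2 -> Rabs (h s) < eps.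
Proof.
  intros Hh Hs He Hn. pose proof (abs_le_Nm h s Hh Hs).
  assert (Hw : 0 < sqrt (W s)) by (apply sqrt_lt_R0; auto).
  apply Rmult_lt_reg_r with (sqrt (W s)); auto.
  assert (0 < eps * sqrt (W s)) by (apply Rmult_lt_0_compat; auto). lra.
Qed.

Lemma cvg_point fs f s : (forall k, L2 (fs k)) -> L2 f -> cvg fs f -> P s ->
  Un_cv (fun k => fs k s) (f s).
Proof.
  intros Hk Hf Hc Hs eps He.
  assert (0 < sqrt (W s)) by (apply sqrt_lt_R0; auto).
  destruct (Hc (eps * sqrt (W s) / 2)) as [N HN]; [nra|].
  exists N. intros k Hkn. unfold Rdist.
  replace (fs k s - f s) with (lin 1 (fs k) (-1) f s) by (unfold lin; ring).
  apply abs_lt_Nm; auto. apply L2_lin; auto.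
Qed.

Lemma Un_cv_const c : Un_cv (fun _ => c) c.
Proof. intros eps He; exists O; intros; unfold Rdist; rewrite Rminus_diag_eq, Rabs_R0; auto. Qed.

Lemma Un_cv_sm {B} (u : nat -> B -> R) (l : B -> R) L :
  (forall b, In b L -> Un_cv (fun k => u k b) (l b)) -> Un_cv (fun k => sm (u k) L) (sm l L).
Proof.
  induction L as [|b L IH]; intros H.
  - exact (Un_cv_const 0).
  - apply (CV_plus (fun k => u k b) (fun k => sm (u k) L)); [apply H; simpl; auto|].
    apply IH; intros; apply H; simpl; auto.
Qed.

Lemma Un_cv_lim_le u l M N : Un_cv u l -> (forall k, (N <= k)%nat -> u k <= M) -> l <= M.
Proof.
  intros Hu HM. apply Rnot_lt_le; intros Hlt.
  destruct (Hu (l - M)) as [N' HN']; [lra|].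
  specialize (HN' (max N N') ltac:(lia)). specialize (HM (max N N') ltac:(lia)).
  unfold Rdist in HN'. apply Rabs_def2 in HN'. lra.
Qed.

Lemma Un_cv_sq_diff u l c w : Un_cv u l -> Un_cv (fun k => (c + -1 * u k) ^ 2 * w) ((c + -1 * l) ^ 2 * w).
Proof.
  intros Hu.
  assert (H1 : Un_cv (fun k => c + -1 * u k) (c + -1 * l)).
  { apply CV_plus; [apply Un_cv_const|]. apply CV_mult; auto using Un_cv_const. }
  apply CV_mult; [|apply Un_cv_const].
  simpl. apply CV_mult; auto. apply CV_mult; auto using Un_cv_const.
Qed.

(** Point evaluations are continuous because the weights are positive, so a Cauchy sequence has a
    pointwise limit. Norm convergence is then recovered from finite partial sums. *)
Lemma L2_complete fs : (forall k, L2 (fs k)) ->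
  (forall eps, 0 < eps -> exists N, forall k m, (N <= k)%nat -> (N <= m)%nat ->
     Nm (lin 1 (fs k) (-1) (fs m)) <= eps) ->
  exists f, L2 f /\ cvg fs f.
Proof.
  intros Hk Hc.
  assert (Hex : forall s, P s -> exists l, Un_cv (fun k => fs k s) l).
  { intros s Hs. destruct (R_complete (fun k => fs k s)) as [l Hl]; [|eauto].
    intros eps He.
    assert (Hsw : 0 < sqrt (W s)) by (apply sqrt_lt_R0; auto).
    destruct (Hc (eps * sqrt (W s) / 2)) as [N HN]; [nra|].
    exists N. intros k m Hkn Hmn. unfold Rdist.
    replace (fs k s - fs m s) with (lin 1 (fs k) (-1) (fs m) s) by (unfold lin; ring).
    apply abs_lt_Nm; auto. apply L2_lin; auto. }
  set (f := fun s => epsilon (inhabits 0) (fun l => Un_cv (fun k => fs k s) l)).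
  assert (Hf : forall s, P s -> Un_cv (fun k => fs k s) (f s)).
  { intros s Hs. unfold f. apply epsilon_spec, Hex, Hs. }
  assert (Hb : forall eps, 0 < eps -> exists N, forall k, (N <= k)%nat ->
     summable P (fun s => lin 1 (fs k) (-1) f s ^ 2 * W s) /\
     tsum P (fun s => lin 1 (fs k) (-1) f s ^ 2 * W s) <= eps * eps).
  { intros eps He. destruct (Hc eps He) as [N HN]. exists N. intros k Hkn.
    apply summable_bounded.
    - intros s Hs; specialize (HW s Hs); apply Rmult_le_pos; [apply pow2_ge_0 | lra].
    - intros L HL.
      (* With [k] and the finite list [L] fixed, [m] tends to infinity in the Cauchy estimate. *)
      apply (Un_cv_lim_le (fun m => sm (fun s => lin 1 (fs k) (-1) (fs m) s ^ 2 * W s) L) _ _ N).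
      + apply (Un_cv_sm (fun m s => lin 1 (fs k) (-1) (fs m) s ^ 2 * W s)
                 (fun s => lin 1 (fs k) (-1) f s ^ 2 * W s)). intros s Hs.
        apply (Un_cv_sq_diff (fun m => fs m s)), Hf, HL, Hs.
      + intros m Hm. specialize (HN k m Hkn Hm).
        apply Rle_trans with (ip (lin 1 (fs k) (-1) (fs m)) (lin 1 (fs k) (-1) (fs m))).
        * unfold ip.
          rewrite (sm_ext _ (fun s => lin 1 (fs k) (-1) (fs m) s * lin 1 (fs k) (-1) (fs m) s * W s))
            by (intros; ring).
          apply (has_sum_ub P); auto.
          -- intros s Hs; specialize (HW s Hs); nra.
          -- apply tsum_spec, ip_summable; apply L2_lin; auto.
        * rewrite <- Nm_sq by (apply L2_lin; auto).
          pose proof (Nm_ge0 (lin 1 (fs k) (-1) (fs m))). nra. }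
  assert (HL : L2 f).
  { destruct (Hb 1 Rlt_0_1) as [N HN].
    (* [f] is [fs N - (fs N - f)], a difference of two square-summable functions. *)
    apply (L2_ext (lin 1 (fs N) (-1) (lin 1 (fs N) (-1) f))); [intros; unfold lin; ring|].
    apply L2_lin; auto. apply HN; auto. }
  exists f; split; auto. intros eps He. destruct (Hb eps He) as [N HN]. exists N. intros k Hkn.
  apply Nm_le_of_sq; [apply L2_lin; auto | lra |].
  destruct (HN k Hkn) as [_ H2]. eapply Rle_trans; [|apply H2]. right.
  unfold ip; f_equal; apply functional_extensionality; intros; ring.
Qed.

(** * Bounded symmetric operators on closed subspaces *)

Record subsp (H : (A -> R) -> Prop) : Prop := {
  sub_L2 : forall f, H f -> L2 f;
  sub_lin : forall a f b g, H f -> H g -> H (lin a f b g);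
  sub_closed : forall fs f, (forall k, H (fs k)) -> L2 f -> cvg fs f -> H f }.

(** Linearity is stated pointwise on [P], since forms are functions on all lists and their values
    off the cells carry no meaning. *)
Record symop (H : (A -> R) -> Prop) (T : (A -> R) -> A -> R) (M : R) : Prop := {
  op_in : forall f, H f -> H (T f);
  op_lin : forall a f b g s, P s -> T (lin a f b g) s = a * T f s + b * T g s;
  op_sym : forall f g, H f -> H g -> ip (T f) g = ip f (T g);
  op_bd : forall f, H f -> Nm (T f) <= M * Nm f }.

Section Operator.
Variables (H : (A -> R) -> Prop) (T : (A -> R) -> A -> R) (M : R).
Hypothesis HH : subsp H.
Hypothesis HT : symop H T M.

Lemma symop_shift x : symop H (fun f s => T f s - x * f s) (M + Rabs x).
Proof.
  assert (E : forall f, (fun s => T f s - x * f s) = lin 1 (T f) (- x) f).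
  { intros; apply functional_extensionality; intros; unfold lin; ring. }
  split.
  - intros f Hf. rewrite E. apply HH; auto. apply HT; auto.
  - intros a f b g s Hs. rewrite (op_lin _ _ _ HT) by auto. unfold lin. ring.
  - intros f g Hf Hg. rewrite !E.
    rewrite ip_lin_l, ip_lin_r by (try apply HH; auto; apply HT; auto).
    rewrite (op_sym _ _ _ HT); auto.
  - intros f Hf. rewrite E.
    eapply Rle_trans; [apply Nm_lin; apply HH; auto; apply HT; auto|].
    rewrite Rabs_R1, Rabs_Ropp. pose proof (op_bd _ _ _ HT f Hf). lra.
Qed.

Lemma bounded_below_inj c : 0 < c -> (forall f, H f -> c * Nm f <= Nm (T f)) ->
  forall f, H f -> (forall s, P s -> T f s = 0) -> forall s, P s -> f s = 0.
Proof.
  intros Hc Hb f Hf E s Hs. apply Nm_zero; auto; [apply HH; auto|].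
  assert (E0 : Nm (T f) = 0).
  { assert (HL : L2 (T f)) by (apply HH, HT; auto).
    apply Rle_antisym; [|apply Nm_ge0].
    rewrite (Nm_ext (T f) (lin 0 (T f) 0 (T f))) by (auto; intros; unfold lin; rewrite E; auto; ring).
    eapply Rle_trans; [apply Nm_lin; auto|]. rewrite Rabs_R0; lra. }
  specialize (Hb f Hf). pose proof (Nm_ge0 f). nra.
Qed.

(* Richardson iteration: [1 - t T^2] is a contraction for small [t]. *)
Lemma bounded_below_surj c : 0 < c -> (forall f, H f -> c * Nm f <= Nm (T f)) ->
  forall g, H g -> exists f, H f /\ forall s, P s -> T f s = g s.
Proof.
  intros Hc Hb g Hg.
  (* [K] bounds [T] and is at least [c], hence positive. With [t = 1 / K^2] the number [1 - t c^2]
     lies in [[0, 1)]. *)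
  set (K := Rmax M 0 + c). assert (HK : c <= K /\ M <= K).
  { unfold K. pose proof (Rmax_l M 0); pose proof (Rmax_r M 0); lra. }
  assert (HbK : forall f, H f -> Nm (T f) <= K * Nm f).
  { intros f Hf. pose proof (op_bd _ _ _ HT f Hf). pose proof (Nm_ge0 f). nra. }
  assert (HL : forall f, H f -> L2 f) by apply HH.
  assert (HTi : forall f, H f -> H (T f)) by apply HT.
  set (t := / (K * K)).
  assert (Ht : 0 < t) by (apply Rinv_0_lt_compat; nra).
  assert (HtK : t * (K * K) = 1) by (unfold t; field; lra).
  set (step := fun f => lin 1 f t (lin 1 g (-1) (T (T f)))).
  set (fs := fun k => Nat.iter k step g).
  set (e := fun k => lin 1 g (-1) (T (T (fs k)))).
  assert (Hfs : forall k, H (fs k)).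
  { induction k; simpl; auto. unfold step. repeat (apply (sub_lin _ HH) || apply HTi); auto. }
  assert (He : forall k, H (e k)) by (intros; unfold e; repeat (apply (sub_lin _ HH) || apply HTi); auto).
  set (q := 1 - t * (c * c)).
  assert (Hq : 0 <= q < 1).
  { unfold q. assert (0 < t * (c * c)) by (apply Rmult_lt_0_compat; nra).
    assert (t * (c * c) <= t * (K * K)) by (apply Rmult_le_compat_l; nra). lra. }
  (* [op_lin] is an identity on [P] only, and [T] is not known to respect equality on [P]. The
     discrepancy has norm [0], so by boundedness its image under [T] vanishes as well. *)
  assert (TTlin : forall a f b h s, H f -> H h -> P s ->
     T (T (lin a f b h)) s = a * T (T f) s + b * T (T h) s).
  { intros a f b h s Hf Hh Hs. rewrite <- (op_lin _ _ _ HT) by auto.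
    assert (Hd : H (lin 1 (T (lin a f b h)) (-1) (lin a (T f) b (T h)))).
    { repeat (apply (sub_lin _ HH) || apply HTi); auto. }
    assert (Z : Nm (T (lin 1 (T (lin a f b h)) (-1) (lin a (T f) b (T h)))) <= 0).
    { eapply Rle_trans; [apply HbK; auto|].
      replace (Nm _) with 0; [lra|]. symmetry. apply Rle_antisym; [|apply Nm_ge0].
      rewrite (Nm_ext _ (lin 0 f 0 f)).
      - eapply Rle_trans; [apply Nm_lin; auto|]. rewrite Rabs_R0; lra.
      - intros r Hr. unfold lin at 1. rewrite (op_lin _ _ _ HT) by auto. unfold lin. ring.
      - auto. }
    pose proof (Nm_zero _ (HL _ (HTi _ Hd)) Z s Hs) as Z'.
    rewrite (op_lin _ _ _ HT) in Z' by auto. lra. }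
  (* By symmetry the squared norm is [|h|^2 - 2t|Th|^2 + t^2|TTh|^2]. Since [t K^2 = 1], one of the
     two copies of [t|Th|^2] absorbs the last term; the other is at least [t c^2 |h|^2]. *)
  assert (Hcontr : forall h, H h -> ip (lin 1 h (- t) (T (T h))) (lin 1 h (- t) (T (T h))) <= q * ip h h).
  { intros h Hh. rewrite ip_lin2 by auto.
    rewrite <- (op_sym _ _ _ HT) by auto.
    pose proof (HbK _ (HTi _ Hh)) as B1. pose proof (Hb _ Hh) as B2.
    rewrite <- !Nm_sq by auto.
    pose proof (Nm_ge0 h); pose proof (Nm_ge0 (T h)); pose proof (Nm_ge0 (T (T h))).
    set (n0 := Nm h) in *; set (n1 := Nm (T h)) in *; set (n2 := Nm (T (T h))) in *.
    assert (C1 : n2 * n2 <= (K * K) * (n1 * n1)).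
    { replace ((K * K) * (n1 * n1)) with ((K * n1) * (K * n1)) by ring.
      apply Rmult_le_compat; auto. }
    assert (C2 : (c * c) * (n0 * n0) <= n1 * n1).
    { replace ((c * c) * (n0 * n0)) with ((c * n0) * (c * n0)) by ring.
      apply Rmult_le_compat; auto; apply Rmult_le_pos; lra. }
    assert (C3 : t * t * (n2 * n2) <= t * (n1 * n1)).
    { apply Rle_trans with (t * t * ((K * K) * (n1 * n1))).
      - apply Rmult_le_compat_l; nra.
      - right. transitivity (t * (t * (K * K)) * (n1 * n1)); [ring|]. rewrite HtK; ring. }
    assert (C4 : t * ((c * c) * (n0 * n0)) <= t * (n1 * n1)) by (apply Rmult_le_compat_l; lra).
    unfold q. nra. }
  assert (Hestep : forall k s, P s -> e (S k) s = lin 1 (e k) (- t) (T (T (e k))) s).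
  { intros k s Hs. unfold e at 1. unfold lin at 1.
    change (fs (S k)) with (lin 1 (fs k) t (e k)). rewrite TTlin by auto.
    unfold lin at 1. unfold e at 2. unfold lin. ring. }
  set (r := sqrt q).
  assert (Hr : 0 <= r < 1).
  { unfold r. split; [apply sqrt_pos|]. rewrite <- sqrt_1. apply sqrt_lt_1; lra. }
  assert (Hen : forall k, Nm (e k) <= r ^ k * Nm (e O)).
  { induction k; [simpl; lra|].
    assert (Hl : H (lin 1 (e k) (- t) (T (T (e k))))) by (repeat (apply (sub_lin _ HH) || apply HTi); auto).
    rewrite (Nm_ext (e (S k)) _ (Hestep k)) by auto.
    apply Rle_trans with (r * Nm (e k)); [|simpl; rewrite Rmult_assoc; apply Rmult_le_compat_l; lra].
    pose proof (Nm_ge0 (e k)).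
    apply Nm_le_of_sq; [auto | nra |].
    eapply Rle_trans; [apply Hcontr; auto|]. rewrite <- Nm_sq by auto.
    rewrite <- (sqrt_sqrt q) by lra. fold r. right; ring. }
  assert (Hdiff : forall k j, Nm (lin 1 (fs (j + k)%nat) (-1) (fs k)) <= t * Nm (e O) / (1 - r) * r ^ k).
  (* The difference [r^k - r^(j+k)] gives a stronger bound than the one wanted, but one that closes
     under induction on [j]. *)
  { assert (G : forall k j, Nm (lin 1 (fs (j + k)%nat) (-1) (fs k))
                  <= t * Nm (e O) / (1 - r) * (r ^ k - r ^ (j + k))).
    { intros k j; induction j.
      - replace (r ^ k - r ^ (0 + k)) with 0 by (simpl; ring). rewrite Rmult_0_r.
        rewrite (Nm_ext _ (lin 0 g 0 g)).
        + eapply Rle_trans; [apply Nm_lin; auto|]. rewrite Rabs_R0; lra.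
        + intros s _. change (0 + k)%nat with k. unfold lin; ring.
        + apply L2_lin; auto.
      - rewrite (Nm_ext _ (lin 1 (lin 1 (fs (j + k)%nat) (-1) (fs k)) t (e (j + k)%nat))).
        + eapply Rle_trans; [apply Nm_lin; auto; apply L2_lin; auto|].
          rewrite Rabs_R1, (Rabs_pos_eq t) by lra.
          specialize (Hen (j + k)%nat).
          apply Rle_trans with (t * Nm (e O) / (1 - r) * (r ^ k - r ^ (j + k)) + t * (r ^ (j + k) * Nm (e O))).
          * apply (Rmult_le_compat_l t) in Hen; [|lra]. lra.
          * right. simpl. field. lra.
        + intros s Hs. change (fs (S j + k)%nat) with (lin 1 (fs (j + k)%nat) t (e (j + k)%nat)).
          unfold lin; ring.
        + apply L2_lin; auto. }
    intros k j. eapply Rle_trans; [apply G|]. apply Rmult_le_compat_l.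
    - apply Rmult_le_pos; [pose proof (Nm_ge0 (e O)); nra | left; apply Rinv_0_lt_compat; lra].
    - pose proof (pow_le r (j + k) (proj1 Hr)). lra. }
  set (C := t * Nm (e O) / (1 - r)).
  assert (HC : 0 <= C).
  { apply Rmult_le_pos; [pose proof (Nm_ge0 (e O)); nra | left; apply Rinv_0_lt_compat; lra]. }
  assert (Hpow : forall eps, 0 < eps -> exists N, forall k, (N <= k)%nat -> r ^ k < eps).
  { intros eps Heps. destruct (pow_lt_1_zero r) with (y := eps) as [N HN]; auto.
    - rewrite Rabs_pos_eq; lra.
    - exists N; intros k Hk. specialize (HN k Hk).
      rewrite Rabs_pos_eq in HN; auto. apply pow_le; lra. }
  destruct (L2_complete fs) as [f [Hf Hcv]]; auto.
  { intros eps Heps. destruct (Hpow (eps / (C + 1))) as [N HN]; [apply Rdiv_lt_0_compat; lra|].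
    assert (Hbd : forall k, (N <= k)%nat -> C * r ^ k <= eps).
    { intros k Hk. specialize (HN k Hk). pose proof (pow_le r k (proj1 Hr)).
      apply Rle_trans with ((C + 1) * (eps / (C + 1))); [|right; field; lra].
      apply Rmult_le_compat; lra. }
    exists N. intros k m Hk Hm. destruct (Nat.le_ge_cases k m) as [L|L].
    - rewrite (Nm_ext _ (lin (-1) (lin 1 (fs m) (-1) (fs k)) 0 (lin 1 (fs m) (-1) (fs k))));
        [|intros; unfold lin; ring | apply L2_lin; auto].
      rewrite Nm_scal by (apply L2_lin; auto). replace (Rabs (-1)) with 1 by (rewrite Rabs_left; lra).
      specialize (Hdiff k (m - k)%nat). replace (m - k + k)%nat with m in Hdiff by lia.
      fold C in Hdiff. specialize (Hbd k Hk). lra.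
    - specialize (Hdiff m (k - m)%nat). replace (k - m + m)%nat with k in Hdiff by lia.
      fold C in Hdiff. specialize (Hbd m Hm). lra. }
  assert (Hff : H f) by (apply (sub_closed _ HH fs); auto).
  (* The iteration solves [T (T f) = g], so [T f] is the preimage of [g]. *)
  exists (T f). split; auto.
  assert (Z : Nm (lin 1 (T (T f)) (-1) g) <= 0).
  { apply Rnot_lt_le. intros Hpos. set (z := Nm (lin 1 (T (T f)) (-1) g)) in *.
    destruct (Hpow (z / 2 / (Nm (e O) + 1))) as [N1 HN1].
    { pose proof (Nm_ge0 (e O)). apply Rdiv_lt_0_compat; lra. }
    destruct (Hcv (z / 4 / (K * K))) as [N2 HN2]; [apply Rdiv_lt_0_compat; nra|].
    set (k := max N1 N2). specialize (HN1 k ltac:(lia)). specialize (HN2 k ltac:(lia)).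
    assert (z <= K * K * Nm (lin 1 (fs k) (-1) f) + Nm (e k)).
    { unfold z. rewrite (Nm_ext _ (lin (-1) (T (T (lin 1 (fs k) (-1) f))) (-1) (e k))).
      - eapply Rle_trans; [apply Nm_lin; auto; apply HL; repeat (apply (sub_lin _ HH) || apply HTi); auto|].
        replace (Rabs (-1)) with 1 by (rewrite Rabs_left; lra).
        assert (Hl : H (lin 1 (fs k) (-1) f)) by (apply HH; auto).
        pose proof (HbK _ (HTi _ Hl)). pose proof (HbK _ Hl) as B2.
        apply (Rmult_le_compat_l K) in B2; lra.
      - intros s Hs. unfold lin at 2. rewrite TTlin by auto. unfold e. unfold lin. ring.
      - apply L2_lin; auto. }
    specialize (Hen k). pose proof (Nm_ge0 (e O)).
    assert (Nm (e k) <= z / 2).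
    { eapply Rle_trans; [apply Hen|].
      apply Rle_trans with (z / 2 / (Nm (e O) + 1) * (Nm (e O) + 1)); [|right; field; lra].
      pose proof (pow_le r k (proj1 Hr)). apply Rmult_le_compat; lra. }
    assert (K * K * Nm (lin 1 (fs k) (-1) f) <= z / 4).
    { apply Rle_trans with (K * K * (z / 4 / (K * K))); [apply Rmult_le_compat_l; nra | right; field; lra]. }
    lra. }
  intros s Hs. pose proof (Nm_zero _ (L2_lin _ _ _ _ (HL _ (HTi _ (HTi _ Hff))) (HL _ Hg)) Z s Hs) as E.
  unfold lin in E. lra.
Qed.

End Operator.
End WeightedL2.

(** * Spectra: approximate eigenforms, and compactness in finite dimension *)

Definition eqP {A : Type} (P : A -> Prop) (f g : A -> R) : Prop := forall s, P s -> f s = g s.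

(** The extraction satisfies [k <= phi k] without being increasing. This is enough for limits, and
    each [phi k] can be chosen independently of the others. *)
Lemma BW_subseq (u : nat -> R) M : (forall k, Rabs (u k) <= M) ->
  exists phi l, (forall k, (k <= phi k)%nat) /\ Un_cv (fun k => u (phi k)) l.
Proof.
  intros HM.
  destruct (Bolzano_Weierstrass u (fun c => - M <= c <= M)) as [l Hl].
  - apply compact_P3.
  - intros k. specialize (HM k). pose proof (Rle_abs (u k)); pose proof (Rle_abs (- u k)).
    rewrite Rabs_Ropp in *. lra.
  - assert (Hex : forall k, exists p, (k <= p)%nat /\ Rabs (u p - l) < / INR (S k)).
    { intros k. assert (Hp : 0 < / INR (S k)) by (apply Rinv_0_lt_compat, lt_0_INR; lia).
      destruct (Hl (disc l (mkposreal _ Hp)) k) as [p [Hk Hd]]; [|exists p; auto].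
      exists (mkposreal _ Hp). intros y Hy; exact Hy. }
    exists (fun k => epsilon (inhabits O) (fun p => (k <= p)%nat /\ Rabs (u p - l) < / INR (S k))), l.
    assert (Hs : forall k, let p := epsilon (inhabits O) (fun p => (k <= p)%nat /\ Rabs (u p - l) < / INR (S k)) in
       (k <= p)%nat /\ Rabs (u p - l) < / INR (S k)) by (intros k; apply epsilon_spec; auto).
    split; [intros k; apply Hs|].
    intros eps He. destruct (archimed_cor1 eps He) as [N [HN HN0]].
    exists N. intros k Hk. unfold Rdist. eapply Rlt_trans; [apply Hs|].
    eapply Rle_lt_trans; [|apply HN]. apply Rinv_le_contravar; [apply lt_0_INR; lia|].
    apply le_INR; lia.
Qed.

Lemma Un_cv_subseq u l phi : (forall k, (k <= phi k)%nat) -> Un_cv u l -> Un_cv (fun k => u (phi k)) l.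
Proof.
  intros Hp Hu eps He. destruct (Hu eps He) as [N HN]. exists N. intros k Hk. apply HN.
  specialize (Hp k). lia.
Qed.

Lemma BW_family {A : Type} (fs : nat -> A -> R) (M : A -> R) L :
  (forall k a, In a L -> Rabs (fs k a) <= M a) ->
  exists phi, (forall k, (k <= phi k)%nat) /\
    forall a, In a L -> exists l, Un_cv (fun k => fs (phi k) a) l.
Proof.
  induction L as [|a L IH]; intros HM.
  - exists (fun k => k); split; auto. simpl; tauto.
  - destruct IH as [phi [Hphi HL]]; [intros; apply HM; simpl; auto|].
    destruct (BW_subseq (fun k => fs (phi k) a) (M a)) as [psi [l [Hpsi Hl]]].
    { intros; apply HM; simpl; auto. }
    exists (fun k => phi (psi k)). split.
    + intros k. specialize (Hpsi k). specialize (Hphi (psi k)). lia.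
    + intros b [<-|Hb]; [exists l; auto|]. destruct (HL b Hb) as [l' Hl']. exists l'.
      apply (Un_cv_subseq (fun k => fs (phi k) b)); auto.
Qed.

Section Spectrum.
Context (P : list nat -> Prop) (W : list nat -> R).
Hypothesis HW : forall s, P s -> 0 < W s.
Variables (H : form -> Prop) (T : form -> form) (M : R).
Hypothesis HH : subsp P W H.
Hypothesis HT : symop P W H T M.

Notation L2' := (L2 P W). Notation ip' := (ip P W). Notation Nm' := (Nm P W).

Lemma shift_lin x f : (fun s => T f s - x * f s) = lin 1 (T f) (- x) f.
Proof. apply functional_extensionality; intros; unfold lin; ring. Qed.

Lemma spec_approx x : in_spec H (eqP P) T x -> forall eps, 0 < eps ->
  exists f, H f /\ 0 < Nm' f /\ Nm' (lin 1 (T f) (- x) f) < eps * Nm' f.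
Proof.
  intros Hx eps He. apply NNPP. intros N. apply Hx.
  pose proof (symop_shift P W HW H T M HH HT x) as HS.
  assert (Hb : forall f, H f -> eps * Nm' f <= Nm' (fun s => T f s - x * f s)).
  { intros f Hf. destruct (Rle_lt_dec (Nm' f) 0) as [Z|Z].
    - pose proof (Nm_ge0 P W f). pose proof (Nm_ge0 P W (fun s => T f s - x * f s)). nra.
    - apply Rnot_lt_le. intros L. apply N. exists f. rewrite <- shift_lin. auto. }
  split.
  - exact (bounded_below_inj P W HW H _ _ HH HS eps He Hb).
  - exact (bounded_below_surj P W HW H _ _ HH HS eps He Hb).
Qed.

(** For [x < 0], pairing [T f - x f] with an approximate eigenform [f] gives at least [- x |f|^2] by
    positivity, yet less than half of that by the choice of [f]. *)
Lemma spec_nonneg x : (forall f, H f -> 0 <= ip' (T f) f) -> in_spec H (eqP P) T x -> 0 <= x.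
Proof.
  intros Hpos Hx. apply Rnot_lt_le. intros Hlt.
  destruct (spec_approx x Hx (- x / 2)) as [f [Hf [Hn Ha]]]; [lra|].
  assert (Lf : L2' f) by (apply HH; auto). assert (LT : L2' (T f)) by (apply HH, HT; auto).
  pose proof (ip_le_Nm P W HW (lin 1 (T f) (- x) f) f (L2_lin P W HW _ _ _ _ LT Lf) Lf) as HC.
  rewrite ip_lin_l in HC by auto. pose proof (Hpos f Hf).
  pose proof (Rle_abs (1 * ip' (T f) f + - x * ip' f f)).
  rewrite <- (Nm_sq P W HW f Lf) in *.
  set (n := Nm' f) in *. set (m := Nm' (lin 1 (T f) (- x) f)) in *.
  assert (m * n < - x / 2 * n * n) by (apply Rmult_lt_compat_r; auto).
  assert (0 < - x * (n * n)) by (apply Rmult_lt_0_compat; nra). nra.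
Qed.

Variable F : list (list nat).
Hypothesis HF : NoDup F.
Hypothesis HFP : forall s, In s F <-> P s.

Lemma L2_finite f : L2' f.
Proof. eexists. apply (summable_finite P _ F); auto. Qed.

Lemma ip_finite f g : ip' f g = sm (fun s => f s * g s * W s) F.
Proof. apply tsum_eq, summable_finite; auto. Qed.

Lemma cvg_finite fs f : (forall s, P s -> Un_cv (fun k => fs k s) (f s)) -> cvg P W fs f.
Proof.
  intros Hc eps He.
  assert (K : Un_cv (fun k => sm (fun s => lin 1 (fs k) (-1) f s * lin 1 (fs k) (-1) f s * W s) F)
                 (sm (fun s => 0) F)).
  { apply (Un_cv_sm (fun k s => lin 1 (fs k) (-1) f s * lin 1 (fs k) (-1) f s * W s)). intros s Hs.
    assert (D : Un_cv (fun k => lin 1 (fs k) (-1) f s) (1 * f s + -1 * f s)).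
    { unfold lin. apply CV_plus; [|apply Un_cv_const].
      apply CV_mult; [apply Un_cv_const | apply Hc, HFP, Hs]. }
    replace 0 with ((1 * f s + -1 * f s) * (1 * f s + -1 * f s) * W s) by ring.
    apply CV_mult; [apply CV_mult; auto | apply Un_cv_const]. }
  rewrite sm_zero in K by auto.
  destruct (K (eps * eps)) as [N HN]; [nra|]. exists N. intros k Hk. specialize (HN k Hk).
  apply Nm_le_of_sq; [apply L2_finite | lra |]. rewrite ip_finite.
  unfold Rdist in HN. rewrite Rminus_0_r in HN.
  eapply Rle_trans; [apply Rle_abs | lra].
Qed.

(** Otherwise there are unit vectors whose images tend to [0]. Their coordinates over the finite
    list [F] are bounded, so a subsequence converges, to a unit vector killed by [T]. *)
Lemma inj_bounded_below : (forall f, H f -> eqP P (T f) zero_form -> eqP P f zero_form) ->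
  exists c, 0 < c /\ forall f, H f -> c * Nm' f <= Nm' (T f).
Proof.
  intros Hinj. apply NNPP. intros N.
  assert (Hex : forall k, exists f, H f /\ Nm' f = 1 /\ Nm' (T f) <= / INR (S k)).
  { intros k. assert (Hp : 0 < / INR (S k)) by (apply Rinv_0_lt_compat, lt_0_INR; lia).
    apply NNPP. intros N'. apply N. exists (/ INR (S k)). split; auto.
    intros f Hf. apply Rnot_lt_le. intros Hlt. apply N'.
    assert (Hn : 0 < Nm' f).
    { pose proof (Nm_ge0 P W f). pose proof (Nm_ge0 P W (T f)). nra. }
    exists (lin (/ Nm' f) f 0 f). split; [apply (sub_lin _ _ _ HH); auto|].
    assert (Ha : Rabs (/ Nm' f) = / Nm' f) by (apply Rabs_pos_eq; left; apply Rinv_0_lt_compat; auto).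
    split.
    - rewrite Nm_scal, Ha by (auto; apply L2_finite). field; lra.
    - rewrite (Nm_ext P W HW _ (lin (/ Nm' f) (T f) 0 (T f))).
      + rewrite Nm_scal, Ha by (auto; apply L2_finite).
        apply Rmult_le_reg_l with (Nm' f); auto.
        rewrite <- Rmult_assoc, Rinv_r, Rmult_1_l by lra. lra.
      + intros s Hs. rewrite (op_lin _ _ _ _ _ HT) by auto. reflexivity.
      + apply L2_finite. }
  set (fs := fun k => epsilon (inhabits zero_form)
     (fun f => H f /\ Nm' f = 1 /\ Nm' (T f) <= / INR (S k))).
  assert (Hfs : forall k, H (fs k) /\ Nm' (fs k) = 1 /\ Nm' (T (fs k)) <= / INR (S k)).
  { intros k. unfold fs. apply epsilon_spec, Hex. }
  destruct (BW_family fs (fun s => / sqrt (W s)) F) as [phi [Hphi Hl]].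
  { intros k s Hs. apply HFP in Hs.
    pose proof (abs_le_Nm P W HW (fs k) s (L2_finite _) Hs) as Hb.
    rewrite (proj1 (proj2 (Hfs k))) in Hb.
    assert (Hsw : 0 < sqrt (W s)) by (apply sqrt_lt_R0; auto).
    apply Rmult_le_reg_r with (sqrt (W s)); auto. rewrite Rinv_l by lra. auto. }
  set (f := fun s => epsilon (inhabits 0) (fun l => Un_cv (fun k => fs (phi k) s) l)).
  assert (Hc : cvg P W (fun k => fs (phi k)) f).
  { apply cvg_finite. intros s Hs. unfold f. apply epsilon_spec, Hl, HFP, Hs. }
  assert (Hf : H f).
  { apply (sub_closed _ _ _ HH (fun k => fs (phi k))); auto; [|apply L2_finite]. intros; apply Hfs. }
  assert (Z : eqP P (T f) zero_form).
  { intros s Hs. apply (Nm_zero P W HW (T f)); auto; [apply L2_finite|]. clear s Hs. apply Rnot_lt_le. intros Hz.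
    set (K := Rabs M + 1). assert (HK : 0 < K) by (pose proof (Rabs_pos M); unfold K; lra).
    destruct (Hc (Nm' (T f) / 4 / K)) as [N1 HN1]; [repeat apply Rdiv_lt_0_compat; lra|].
    destruct (archimed_cor1 (Nm' (T f) / 4)) as [N2 [HN2 HN20]]; [lra|].
    set (k := max N1 N2). specialize (HN1 k ltac:(lia)).
    destruct (Hfs (phi k)) as [Hk [_ Hk2]].
    assert (Hlin : H (lin 1 (fs (phi k)) (-1) f)) by (apply (sub_lin _ _ _ HH); auto).
    assert (B : Nm' (T f) <= Nm' (T (fs (phi k))) + Nm' (T (lin 1 (fs (phi k)) (-1) f))).
    { rewrite (Nm_ext P W HW (T f) (lin 1 (T (fs (phi k))) (-1) (T (lin 1 (fs (phi k)) (-1) f)))).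
      - eapply Rle_trans; [apply Nm_lin; auto; apply L2_finite|].
        replace (Rabs (-1)) with 1 by (rewrite Rabs_left; lra). rewrite Rabs_R1. lra.
      - intros s Hs. unfold lin at 1. rewrite (op_lin _ _ _ _ _ HT) by auto. ring.
      - apply L2_finite. }
    pose proof (op_bd _ _ _ _ _ HT _ Hlin) as B2.
    pose proof (Nm_ge0 P W (lin 1 (fs (phi k)) (-1) f)).
    assert (B3 : K * Nm' (lin 1 (fs (phi k)) (-1) f) <= Nm' (T f) / 4).
    { apply Rle_trans with (K * (Nm' (T f) / 4 / K)); [apply Rmult_le_compat_l; lra | right; field; lra]. }
    assert (M <= K) by (pose proof (Rle_abs M); unfold K; lra).
    assert (/ INR (S (phi k)) <= / INR N2).
    { apply Rinv_le_contravar; [apply lt_0_INR; lia|]. apply le_INR. specialize (Hphi k). lia. }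
    nra. }
  assert (E0 : Nm' f = 0).
  { apply Rle_antisym; [|apply Nm_ge0].
    rewrite (Nm_ext P W HW f (lin 0 f 0 f)).
    - rewrite Nm_scal, Rabs_R0 by (auto; apply L2_finite). lra.
    - intros s Hs. unfold lin. rewrite (Hinj f Hf Z s Hs). unfold zero_form. ring.
    - apply L2_finite. }
  destruct (Hc (1/2)) as [N1 HN1]; [lra|]. specialize (HN1 N1 (le_n _)).
  pose proof (Nm_lin P W HW 1 (lin 1 (fs (phi N1)) (-1) f) 1 f (L2_finite _) (L2_finite _)) as B.
  rewrite <- (Nm_ext P W HW (fs (phi N1))) in B; [|intros; unfold lin; ring | apply L2_finite].
  rewrite (proj1 (proj2 (Hfs (phi N1)))), E0, Rabs_R1 in B. lra.
Qed.

End Spectrum.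

(** * Rayleigh quotients over a finite index set *)

Section SpectrumMin.
Context (P : list nat -> Prop) (W : list nat -> R).
Hypothesis HW : forall s, P s -> 0 < W s.
Variables (H : form -> Prop) (T : form -> form) (M : R).
Hypothesis HH : subsp P W H.
Hypothesis HT : symop P W H T M.
Variable F : list (list nat).
Hypothesis HF : NoDup F.
Hypothesis HFP : forall s, In s F <-> P s.

(** Let [r] be the infimum of the Rayleigh quotients, obtained as the supremum of their lower
    bounds. If [r < m], then [S = T - r] is bijective, hence bounded below by compactness, and it is
    positive semidefinite. Cauchy-Schwarz for the form [<S f, g>] turns [|S f| >= c |f|] into a
    positive lower bound for [<S f, f>] on unit vectors, so [r] could be increased. *)
Lemma spec_min_finite m : (forall x, in_spec H (eqP P) T x -> m <= x) ->
  forall f, H f -> m * ip P W f f <= ip P W (T f) f.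
Proof.
  intros Hm f0 Hf0. apply Rnot_lt_le. intros Hlt.
  assert (HL : forall f, L2 P W f) by (intros; apply (L2_finite P W F); auto).
  set (E := fun r => forall f, H f -> r * ip P W f f <= ip P W (T f) f).
  assert (Hn0 : 0 < ip P W f0 f0).
  { pose proof (ip_ge0 P W HW f0 (HL _)). destruct (Req_dec (ip P W f0 f0) 0) as [Z|Z]; [|lra].
    exfalso. pose proof (ip_CS P W HW (T f0) f0 (HL _) (HL _)) as C. rewrite Z in *. nra. }
  assert (Hub : forall r, E r -> r <= ip P W (T f0) f0 / ip P W f0 f0).
  { intros r Hr. specialize (Hr f0 Hf0).
    apply Rmult_le_reg_r with (ip P W f0 f0); auto.
    replace (ip P W (T f0) f0 / ip P W f0 f0 * ip P W f0 f0) with (ip P W (T f0) f0) by (field; lra). auto. }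
  assert (Hray : ip P W (T f0) f0 / ip P W f0 f0 < m).
  { apply Rmult_lt_reg_r with (ip P W f0 f0); auto.
    replace (ip P W (T f0) f0 / ip P W f0 f0 * ip P W f0 f0) with (ip P W (T f0) f0) by (field; lra). auto. }
  assert (Habs : forall f, H f -> Rabs (ip P W (T f) f) <= Rabs M * ip P W f f).
  { intros f Hf. eapply Rle_trans; [apply (ip_le_Nm P W HW); auto|].
    rewrite <- (Nm_sq P W HW f) by auto. pose proof (op_bd _ _ _ _ _ HT f Hf).
    pose proof (Nm_ge0 P W f). pose proof (Rle_abs M).
    rewrite <- Rmult_assoc. apply Rmult_le_compat_r; auto.
    eapply Rle_trans; [apply H0|]. apply Rmult_le_compat_r; auto. }
  destruct (completeness E) as [r [Hr1 Hr2]].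
  { eexists. intros r Hr. apply Hub, Hr. }
  { exists (- Rabs M). intros f Hf. specialize (Habs f Hf).
    pose proof (Rle_abs (- ip P W (T f) f)) as Q. rewrite Rabs_Ropp in Q. lra. }
  assert (Er : E r).
  { intros f Hf. pose proof (ip_ge0 P W HW f (HL _)) as Hnn.
    destruct (Req_dec (ip P W f f) 0) as [Z|Z].
    - rewrite Z. specialize (Habs f Hf). rewrite Z in Habs.
      pose proof (Rle_abs (- ip P W (T f) f)) as Q. rewrite Rabs_Ropp in Q. lra.
    - apply Rmult_le_reg_r with (/ ip P W f f); [apply Rinv_0_lt_compat; lra|].
      rewrite Rmult_assoc, Rinv_r, Rmult_1_r by auto. apply Hr2. intros y Hy.
      specialize (Hy f Hf). apply Rmult_le_reg_r with (ip P W f f); [lra|].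
      rewrite Rmult_assoc, Rinv_l, Rmult_1_r by auto. auto. }
  assert (Hrm : r < m).
  { eapply Rle_lt_trans; [apply Hub, Er | auto]. }
  set (S := fun f : form => fun s => T f s - r * f s).
  assert (HS : symop P W H S (M + Rabs r)) by (apply symop_shift; auto).
  assert (Hbij : bij_on H (eqP P) S).
  { apply NNPP. intros N. apply Hm in N. lra. }
  destruct (inj_bounded_below P W HW H S (M + Rabs r) HH HS F HF HFP (proj1 Hbij)) as [c [Hc Hcb]].
  assert (Sip : forall f, ip P W (S f) f = ip P W (T f) f - r * ip P W f f).
  { intros f. unfold S. rewrite shift_lin, ip_lin_l by auto. ring. }
  assert (Spos : forall f, H f -> 0 <= ip P W (S f) f).
  { intros f Hf. rewrite Sip. specialize (Er f Hf). lra. }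
  set (K := Rabs M + Rabs r).
  assert (Sbd : forall f, H f -> ip P W (S f) f <= K * ip P W f f).
  { intros f Hf. rewrite Sip. specialize (Habs f Hf). pose proof (Rle_abs (ip P W (T f) f)).
    pose proof (Rle_abs (- r)) as Q. rewrite Rabs_Ropp in Q.
    pose proof (ip_ge0 P W HW f (HL _)). unfold K. nra. }
  assert (HK : 0 <= K) by (unfold K; pose proof (Rabs_pos M); pose proof (Rabs_pos r); lra).
  (* Cauchy-Schwarz for the semidefinite form <S f, g>, at g = S f *)
  assert (Scs : forall f, H f -> ip P W (S f) (S f) <= K * ip P W (S f) f).
  { intros f Hf. assert (HSf : H (S f)) by (apply HS; auto).
    assert (D : ip P W (S f) (S f) ^ 2 <= ip P W (S f) f * ip P W (S (S f)) (S f)).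
    { apply quadratic_disc. intros t.
      replace (ip P W (S f) f + 2 * t * ip P W (S f) (S f) + t ^ 2 * ip P W (S (S f)) (S f))
        with (ip P W (S (lin 1 f t (S f))) (lin 1 f t (S f))).
      - apply Spos. apply (sub_lin _ _ _ HH); auto.
      - rewrite (ip_ext P W HW _ (lin 1 (S f) t (S (S f))) _ (lin 1 f t (S f))); auto.
        + rewrite ip_lin_l, !ip_lin_r by auto.
          rewrite (op_sym _ _ _ _ _ HS (S f) f) by auto. ring.
        + intros s Hs. apply (op_lin _ _ _ _ _ HS); auto. }
    pose proof (Sbd (S f) HSf) as B. pose proof (Spos f Hf) as B0.
    pose proof (ip_ge0 P W HW (S f) (HL _)) as B1.
    set (y := ip P W (S f) (S f)) in *. set (z := ip P W (S f) f) in *.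
    destruct (Req_dec y 0) as [->|Hy]; [nra|].
    apply Rmult_le_reg_r with y; [lra|]. nra. }
  (* [K + 1] in place of [K] keeps the denominator positive when [K = 0]. *)
  assert (Enew : E (r + c * c / (K + 1))).
  { intros f Hf. specialize (Scs f Hf). specialize (Hcb f Hf). specialize (Spos f Hf).
    rewrite <- (Nm_sq P W HW (S f)) in Scs by auto.
    rewrite Sip in *. rewrite <- (Nm_sq P W HW f) in * by auto.
    pose proof (Nm_ge0 P W f). set (n := Nm P W f) in *. set (k := Nm P W (S f)) in *.
    assert (c * n * (c * n) <= k * k) by (apply Rmult_le_compat; nra).
    assert (c * c / (K + 1) * (n * n) <= ip P W (T f) f - r * (n * n)); [|lra].
    apply Rmult_le_reg_l with (K + 1); [lra|].
    replace ((K + 1) * (c * c / (K + 1) * (n * n))) with (c * n * (c * n)) by (field; lra). nra. }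
  specialize (Hr1 _ Enew).
  assert (0 < c * c / (K + 1)) by (apply Rdiv_lt_0_compat; nra). lra.
Qed.

End SpectrumMin.

(** * Orientations *)

Lemma adj_swap_perm s t : adj_swap s t -> Permutation s t.
Proof. intros [l1 a b l2]. apply Permutation_app_head, perm_swap. Qed.

Lemma adj_swap_cons v s t : adj_swap s t -> adj_swap (v :: s) (v :: t).
Proof. intros [l1 a b l2]. apply (AdjSwap (v :: l1)). Qed.

Lemma perm_par_perm b s t : perm_par b s t -> Permutation s t.
Proof. induction 1; auto. eapply Permutation_trans; eauto using adj_swap_perm. Qed.

Lemma perm_par_swap s t : adj_swap s t -> perm_par true s t.
Proof. intros H. apply (pp_step false s s t); auto. constructor. Qed.

Lemma perm_par_cons v b s t : perm_par b s t -> perm_par b (v :: s) (v :: t).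
Proof. induction 1; econstructor; eauto using adj_swap_cons. Qed.

Lemma dcell_perm X k s t : dcell X k s -> Permutation s t -> dcell X k t.
Proof.
  intros [H E] Hp. split; [eapply cell_perm; eauto|].
  rewrite <- E; symmetry; now apply Permutation_length.
Qed.

Definition sg (b : bool) : R := if b then -1 else 1.

(** [is_form] speaks of odd reorderings only. A nontrivial even one is an odd one followed by one
    more swap, which gives two sign changes. *)
Lemma is_form_par X k f b s t : is_form X k f -> dcell X k s -> perm_par b s t -> f t = sg b * f s.
Proof.
  intros Hf Hs Hp. destruct b; simpl; [rewrite (Hf s t); auto; ring|].
  inversion Hp as [|b' s' t' u Hp' Ha E1 E2 E3]; subst; [ring|].
  destruct b'; try discriminate.
  rewrite (Hf t' t); [rewrite (Hf s t'); auto; ring | | now apply perm_par_swap].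
  eapply dcell_perm; eauto using perm_par_perm.
Qed.

Lemma is_form_swap X k f :
  (forall s t, dcell X k s -> adj_swap s t -> f t = - f s) -> is_form X k f.
Proof.
  intros H.
  assert (G : forall b s t, perm_par b s t -> dcell X k s -> f t = sg b * f s).
  { induction 1 as [|b s t u Hp IH Ha]; intros Hs; [simpl; ring|].
    rewrite (H t u); auto; [rewrite IH by auto; destruct b; simpl; ring|].
    eapply dcell_perm; eauto using perm_par_perm. }
  intros s t Hs Hp. rewrite (G true s t); auto. simpl; ring.
Qed.

Lemma sg_odd i : sg (Nat.odd i) = (-1) ^ i.
Proof.
  induction i; [reflexivity|]. rewrite Nat.odd_succ, <- Nat.negb_odd. simpl pow. rewrite <- IHi.
  destruct (Nat.odd i); simpl; ring.
Qed.

(** * Faces *)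

Definition front (i : nat) (t : list nat) : list nat := nth i t O :: rem i t.
(** Inverse of [front i]: the head goes back to position [i]. The empty list is a filler case. *)
Definition ins (i : nat) (t : list nat) : list nat :=
  match t with [] => [] | a :: l => firstn i l ++ a :: skipn i l end.

Lemma rem_0 a l : rem 0 (a :: l) = l.
Proof. reflexivity. Qed.

Lemma rem_S i a l : rem (S i) (a :: l) = a :: rem i l.
Proof. reflexivity. Qed.

Lemma front_par i t : (i < length t)%nat -> perm_par (Nat.odd i) t (front i t).
Proof.
  revert i; induction t as [|a l IH]; intros i Hi; [simpl in Hi; lia|].
  destruct i as [|i]; [constructor|].
  rewrite Nat.odd_succ, <- Nat.negb_odd. simpl in Hi.
  apply (pp_step _ _ (a :: front i l)); [apply perm_par_cons, IH; lia|].
  exact (AdjSwap [] a (nth i l O) (rem i l)).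
Qed.

Lemma front_perm i t : (i < length t)%nat -> Permutation t (front i t).
Proof. intros; eapply perm_par_perm, front_par; auto. Qed.

Lemma ins_front i t : (i < length t)%nat -> ins i (front i t) = t.
Proof.
  revert i; induction t as [|a l IH]; intros i Hi; [simpl in Hi; lia|].
  destruct i as [|i]; [reflexivity|]. simpl in Hi.
  unfold front. rewrite rem_S. simpl nth. simpl. f_equal. apply (IH i); lia.
Qed.

Lemma front_ins i t : (i < length t)%nat -> front i (ins i t) = t.
Proof.
  destruct t as [|a l]; [simpl; lia|]. simpl length; intros Hi. simpl ins.
  revert i Hi; induction l as [|b l IH]; intros i Hi.
  - simpl in Hi. assert (i = O) by lia. subst. reflexivity.
  - destruct i as [|i]; [reflexivity|]. simpl in Hi. specialize (IH i ltac:(lia)).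
    unfold front in *. simpl firstn; simpl skipn. simpl app. rewrite rem_S. simpl nth.
    injection IH as E1 E2. rewrite E1, E2. reflexivity.
Qed.

Lemma ins_perm i t : (i < length t)%nat -> Permutation t (ins i t).
Proof.
  destruct t as [|a l]; [simpl; lia|]. intros _. simpl.
  rewrite <- (firstn_skipn i l) at 1. apply Permutation_middle.
Qed.

Lemma rem_length i t : (i < length t)%nat -> S (length (rem i t)) = length t.
Proof. intros Hi. symmetry. exact (Permutation_length (front_perm i t Hi)). Qed.

Lemma rem_cell X k t i : dcell X (S k) t -> (i <= k)%nat -> dcell X k (rem i t).
Proof.
  intros [H E] Hi. split; [|pose proof (rem_length i t ltac:(lia)); lia].
  assert (Hc : cell X (front i t)) by (apply (cell_perm X t); auto; apply front_perm; lia).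
  pose proof (cell_nodup X _ Hc) as N. inversion N; subst.
  apply (cell_sub X _ _ Hc); auto. intros x Hx; simpl; auto.
Qed.

Lemma tl_cell X k t : dcell X (S k) t -> dcell X k (tl t).
Proof.
  intros H. destruct t; [destruct H; discriminate|]. apply (rem_cell X k (n :: t) 0); auto; lia.
Qed.

Lemma rem_incl i t : incl (rem i t) t.
Proof.
  intros x Hx. unfold rem in Hx. rewrite <- (firstn_skipn i t). apply in_app_iff.
  apply in_app_iff in Hx as [|Hx]; auto. right.
  change (S i) with (1 + i)%nat in Hx. rewrite <- skipn_skipn in Hx.
  destruct (skipn i t); simpl in *; auto.
Qed.

(** The unweighted simplicial coboundary. [delta_top] is [Dc] after division by the degree, and
    [delta_low] is [Dc] followed by multiplication by the degree. *)
Definition Dc (G : form) : form :=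
  fun t => sm (fun i => (-1) ^ i * G (rem i t)) (seq 0 (length t)).

Lemma Dc_cons G a l : Dc G (a :: l) = G l - Dc (fun s => G (a :: s)) l.
Proof.
  unfold Dc. simpl length. simpl seq. rewrite sm_cons, <- seq_shift, sm_map.
  rewrite (sm_ext _ (fun i => -1 * ((-1) ^ i * G (a :: rem i l)))).
  - rewrite sm_scal. rewrite rem_0. simpl. ring.
  - intros i _. rewrite rem_S. simpl. ring.
Qed.

Lemma Dc_lin a f b g t : Dc (lin a f b g) t = a * Dc f t + b * Dc g t.
Proof.
  unfold Dc. rewrite <- !sm_scal, <- sm_add. apply sm_ext. intros; unfold lin; ring.
Qed.

(** [Dc_cons] expresses the value on [a :: l] through [Dc] of a different function on [l], so the
    induction runs over all [G] at once. *)
Lemma Dc_Dc G t : Dc (Dc G) t = 0.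
Proof.
  revert G; induction t as [|a l IH]; intros G; [reflexivity|].
  rewrite Dc_cons.
  replace (fun s => Dc G (a :: s)) with (lin 1 G (-1) (Dc (fun s => G (a :: s)))).
  - rewrite Dc_lin, IH. ring.
  - apply functional_extensionality; intros s. rewrite Dc_cons. unfold lin; ring.
Qed.

Lemma Dc_ext G G' t : (forall i, (i < length t)%nat -> G (rem i t) = G' (rem i t)) -> Dc G t = Dc G' t.
Proof. intros H. apply sm_ext. intros i Hi. apply in_seq in Hi. rewrite H by lia. auto. Qed.

(** [Q] is left free because the induction replaces [G] by [fun s => G (c :: s)], which alternates
    on a shifted set of lists. When the swapped pair is at the head, the two faces omitting one of
    its members trade places, with opposite signs. *)
Lemma Dc_swap (Q : list nat -> Prop) G s t :
  (forall u v, Q u -> adj_swap u v -> G v = - G u) ->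
  (forall i, (i < length s)%nat -> Q (rem i s)) -> adj_swap s t -> Dc G t = - Dc G s.
Proof.
  intros HG HQ Ha. destruct Ha as [l1 a b l2].
  revert Q G HG HQ; induction l1 as [|c l1 IH]; intros Q G HG HQ; simpl app in *.
  - rewrite !Dc_cons.
    rewrite (Dc_ext (fun s => G (b :: a :: s)) (lin (-1) (fun s => G (a :: b :: s)) 0 (fun s => 0))).
    + rewrite Dc_lin. ring.
    + intros i Hi. specialize (HQ (S (S i)) ltac:(simpl; lia)). rewrite !rem_S in HQ.
      rewrite (HG _ (b :: a :: rem i l2) HQ); [unfold lin; ring|].
      exact (AdjSwap [] a b (rem i l2)).
  - rewrite !Dc_cons.
    rewrite (IH (fun u => Q (c :: u)) (fun s => G (c :: s))).
    + rewrite (HG (l1 ++ a :: b :: l2)); [ring | | constructor].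
      apply (HQ O). simpl; lia.
    + intros u v Hu Hv. apply HG; auto. now apply adj_swap_cons.
    + intros i Hi. apply (HQ (S i)). simpl; lia.
Qed.

Lemma Dc_is_form X k G : is_form X k G -> is_form X (S k) (Dc G).
Proof.
  intros HG. apply is_form_swap. intros s t Hs Ha.
  apply (Dc_swap (dcell X k)); auto.
  - intros u v Hu Hv. apply HG; auto. now apply perm_par_swap.
  - intros i Hi. apply (rem_cell X k); auto. destruct Hs; lia.
Qed.

(** * Finite sums over neighbouring vertices *)

Lemma fsum_eq P g L : enumerates P L -> fsum P g = sm g L.
Proof.
  intros [H1 H2]. unfold fsum. destruct (excluded_middle_informative _) as [H|H].
  - destruct (constructive_indefinite_description _ H) as [L' [H1' H2']]; simpl.
    apply NoDup_ext_sm; auto. intros a. rewrite H2, H2'. tauto.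
  - exfalso; apply H; exists L; split; auto.
Qed.

Lemma fcard_eq P L : enumerates P L -> fcard P = length L.
Proof.
  intros [H1 H2]. unfold fcard. destruct (excluded_middle_informative _) as [H|H].
  - destruct (constructive_indefinite_description _ H) as [L' [H1' H2']]; simpl.
    apply Permutation_length, NoDup_Permutation; auto. intros a. rewrite H2, H2'. tauto.
  - exfalso; apply H; exists L; split; auto.
Qed.

Lemma fsum_lin P a g b h : fsum P (lin a g b h) = a * fsum P g + b * fsum P h.
Proof.
  unfold fsum. destruct (excluded_middle_informative _) as [H|H]; [|ring].
  destruct (constructive_indefinite_description _ H) as [L HL]; simpl.
  change (sm (lin a g b h) L = a * sm g L + b * sm h L).
  rewrite <- !sm_scal, <- sm_add. reflexivity.
Qed.

Lemma fsum_ext P g h : (forall v, P v -> g v = h v) -> fsum P g = fsum P h.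
Proof.
  intros E. unfold fsum. destruct (excluded_middle_informative _) as [H|H]; auto.
  destruct (constructive_indefinite_description _ H) as [L HL]; simpl.
  apply sm_ext. intros v Hv. apply E, HL, Hv.
Qed.

Lemma fsum_pred P Q g : (forall v, P v <-> Q v) -> fsum P g = fsum Q g.
Proof.
  intros E. replace P with Q; auto. apply functional_extensionality; intros v.
  apply propositional_extensionality. symmetry; apply E.
Qed.

Lemma fcard_pred P Q : (forall v, P v <-> Q v) -> fcard P = fcard Q.
Proof.
  intros E. replace P with Q; auto. apply functional_extensionality; intros v.
  apply propositional_extensionality. symmetry; apply E.
Qed.

Lemma nbv_perm X s t v : Permutation s t -> nbv X s v <-> nbv X t v.
Proof.
  assert (G : forall s t, Permutation s t -> nbv X s v -> nbv X t v).
  { intros s' t' Hp [H1 H2]. split.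
    - intros Hin; apply H1. eapply Permutation_in; [apply Permutation_sym|]; eauto.
    - eapply cell_perm; [|apply H2]. now constructor. }
  intros Hp; split; apply G; auto. now apply Permutation_sym.
Qed.

Lemma deg_perm X s t : Permutation s t -> deg X s = deg X t.
Proof. intros; apply fcard_pred; intros; now apply nbv_perm. Qed.

(** If no list exhausts the neighbours, every duplicate-free list of them extends, and one of length
    [S n] appears. *)
Lemma deg_le_enum X s n : deg_le X s n -> exists L, enumerates (nbv X s) L /\ (length L <= n)%nat.
Proof.
  intros H. apply NNPP. intros N.
  assert (G : forall m, exists L, NoDup L /\ (forall v, In v L -> nbv X s v) /\ length L = m).
  { induction m as [|m [L [H1 [H2 H3]]]].
    - exists []; split; [constructor | split; [simpl; tauto | reflexivity]].
    - destruct (classic (exists v, nbv X s v /\ ~ In v L)) as [[v [Hv Hn]]|N'].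
      + exists (v :: L). split; [constructor; auto|]. split; [|simpl; lia].
        intros u [<-|Hu]; auto.
      + exfalso. apply N. exists L. split; [split; auto|apply H; auto]. intros v. split; auto.
        intros Hv. apply NNPP. intros Hn. apply N'; eauto. }
  destruct (G (S n)) as [L [H1 [H2 H3]]]. specialize (H L H1 H2). lia.
Qed.

Definition fin_nb (X : complex) (k : nat) : Prop :=
  forall s, dcell X k s -> exists L, enumerates (nbv X s) L.

Definition nbl (X : complex) (s : list nat) : list nat :=
  epsilon (inhabits []) (enumerates (nbv X s)).

Lemma nbl_spec X k s : fin_nb X k -> dcell X k s -> enumerates (nbv X s) (nbl X s).
Proof. intros H Hs. unfold nbl. apply epsilon_spec, H, Hs. Qed.

Lemma deg_nbl X k s : fin_nb X k -> dcell X k s -> deg X s = length (nbl X s).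
Proof. intros H Hs. now apply fcard_eq, (nbl_spec X k). Qed.

Lemma bdry_nbl X k F s : fin_nb X k -> dcell X k s -> bdry X F s = sm (fun v => F (v :: s)) (nbl X s).
Proof. intros H Hs. now apply fsum_eq, (nbl_spec X k). Qed.

Lemma nbv_cell X k s v : dcell X k s -> nbv X s v <-> dcell X (S k) (v :: s).
Proof.
  intros [Hc E]. unfold nbv, dcell. simpl. split.
  - intros [_ H]; split; auto.
  - intros [H _]; split; auto. pose proof (cell_nodup X _ H) as N. now inversion N.
Qed.

Lemma bdry_lin X a f b g s : bdry X (lin a f b g) s = a * bdry X f s + b * bdry X g s.
Proof. unfold bdry. rewrite <- fsum_lin. reflexivity. Qed.

Lemma bdry_ext X k f g s : dcell X k s -> feq X (S k) f g -> bdry X f s = bdry X g s.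
Proof. intros Hs E. apply fsum_ext. intros v Hv. apply E. now apply nbv_cell. Qed.

Lemma bdry_is_form X k F : is_form X (S k) F -> is_form X k (bdry X F).
Proof.
  intros HF s t Hs Hp. unfold bdry.
  rewrite (fsum_pred (nbv X t) (nbv X s)) by (intros; symmetry; apply nbv_perm; eauto using perm_par_perm).
  rewrite (fsum_ext _ (fun v => F (v :: t)) (lin (-1) (fun v => F (v :: s)) 0 (fun _ => 0))).
  - rewrite fsum_lin. ring.
  - intros v Hv. unfold lin. rewrite (HF (v :: s) (v :: t)); [ring | now apply nbv_cell | now apply perm_par_cons].
Qed.

(** Turns a sum over ordered cells into an iterated sum over a face and its neighbouring vertices,
    which is how [bdry] enters. *)
Lemma tl_fibres X k : fin_nb X k ->
  fibres (dcell X (S k)) (dcell X k) (@tl nat) (fun s => map (fun v => v :: s) (nbl X s)).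
Proof.
  intros HX. split; [apply tl_cell|]. intros s Hs. destruct (nbl_spec X k s HX Hs) as [N E].
  split.
  - apply NoDup_map_inj; auto. intros a a' _ _ Ea. now injection Ea.
  - intros t. rewrite in_map_iff. split.
    + intros [v [<- Hv]]. split; auto. apply nbv_cell; auto. now apply E.
    + intros [Ht <-]. destruct t as [|v t]; [destruct Ht; discriminate|].
      exists v; split; auto. apply E. simpl in *. now apply (nbv_cell X k).
Qed.

(** Moving the [i]-th vertex to the front changes [F] by [(-1)^i], exactly the sign that the [i]-th
    face carries in [Dc]. *)
Lemma has_sum_front X k i (F G : form) l : (i <= k)%nat -> is_form X (S k) F ->
  has_sum (dcell X (S k)) (fun t => F t * G (tl t)) l ->
  has_sum (dcell X (S k)) (fun t => F t * ((-1) ^ i * G (rem i t))) l.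
Proof.
  intros Hi HF. apply (has_sum_transfer _ _ _ _ (front i) (ins i)).
  - intros t Ht _. assert (Hl : (i < length t)%nat) by (destruct Ht; lia).
    split; [|split].
    + eapply dcell_perm; eauto. now apply front_perm.
    + now apply ins_front.
    + rewrite (is_form_par X (S k) F _ t (front i t) HF Ht (front_par i t Hl)), sg_odd.
      simpl tl. ring.
  - intros t Ht _. assert (Hl : (i < length t)%nat) by (destruct Ht; lia).
    assert (Ht' : dcell X (S k) (ins i t)) by (eapply dcell_perm; eauto; now apply ins_perm).
    split; [|split]; auto; [now apply front_ins|].
    assert (Hl' : (i < length (ins i t))%nat) by (destruct Ht'; lia).
    pose proof (is_form_par X (S k) F _ _ _ HF Ht' (front_par i _ Hl')) as E.
    pose proof (front_ins i t Hl) as Ef. rewrite Ef, sg_odd in E. rewrite E.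
    replace (rem i (ins i t)) with (tl t) by (rewrite <- Ef at 1; reflexivity). ring.
Qed.

Lemma has_sum_front_sq X k i (G : form) l : (i <= k)%nat ->
  has_sum (dcell X (S k)) (fun t => G (tl t) ^ 2) l ->
  has_sum (dcell X (S k)) (fun t => G (rem i t) ^ 2) l.
Proof.
  intros Hi. apply (has_sum_transfer _ _ _ _ (front i) (ins i)).
  - intros t Ht _. assert (Hl : (i < length t)%nat) by (destruct Ht; lia).
    split; [|split]; auto; [|now apply ins_front].
    eapply dcell_perm; eauto. now apply front_perm.
  - intros t Ht _. assert (Hl : (i < length t)%nat) by (destruct Ht; lia).
    assert (Ht' : dcell X (S k) (ins i t)) by (eapply dcell_perm; eauto; now apply ins_perm).
    pose proof (front_ins i t Hl) as Ef.
    split; [|split]; auto.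
    replace (rem i (ins i t)) with (tl t) by (rewrite <- Ef at 1; reflexivity). ring.
Qed.

(** Both sums rearrange the single sum [l]: grouping by [tl] gives the boundary side, and each of
    the [S k] faces in [Dc] contributes a copy of [l]. The factor reflects that a cell with [S k]
    vertices has [S k] times as many orderings as one of its faces. *)
Lemma adjoint X k F G l : fin_nb X k -> is_form X (S k) F ->
  has_sum (dcell X (S k)) (fun t => F t * G (tl t)) l ->
  has_sum (dcell X k) (fun s => bdry X F s * G s) l /\
  has_sum (dcell X (S k)) (fun t => F t * Dc G t) (INR (S k) * l).
Proof.
  intros HX HF H. split.
  - apply (has_sum_ext _ (fun s => sm (fun t => F t * G (tl t)) (map (fun v => v :: s) (nbl X s)))).
    + intros s Hs. rewrite (bdry_nbl X k), sm_map by auto. simpl.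
      rewrite Rmult_comm, <- sm_scal. apply sm_ext; intros; ring.
    + apply (has_sum_fibres (dcell X (S k)) _ (@tl nat)); auto using tl_fibres.
  - apply (has_sum_ext _ (fun t => sm (fun i => F t * ((-1) ^ i * G (rem i t))) (seq 0 (S k)))).
    + intros t [_ Ht]. unfold Dc. rewrite Ht, sm_scal. reflexivity.
    + replace (INR (S k) * l) with (sm (fun _ : nat => l) (seq 0 (S k)))
        by (rewrite sm_const, length_seq; reflexivity).
      apply (has_sum_sm _ (fun i t => F t * ((-1) ^ i * G (rem i t)))).
      intros i Hi. apply in_seq in Hi. apply has_sum_front; auto; lia.
Qed.

Lemma has_sum_tl_sq X k (G : form) l : fin_nb X k ->
  has_sum (dcell X k) (fun s => INR (deg X s) * G s ^ 2) l ->
  has_sum (dcell X (S k)) (fun t => G (tl t) ^ 2) l.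
Proof.
  intros HX H.
  apply (has_sum_fibres_inv _ _ _ _ _ _ (tl_fibres X k HX)); [intros; apply pow2_ge_0|].
  eapply has_sum_ext; [|apply H]. intros s Hs. rewrite sm_map. simpl tl.
  rewrite sm_const, (deg_nbl X k) by auto. reflexivity.
Qed.

(** One factor [S k] comes from Cauchy-Schwarz over the faces, the other from the number of faces,
    which all contribute the same sum. *)
Lemma Dc_bd X k (G : form) : fin_nb X k -> summable (dcell X k) (fun s => INR (deg X s) * G s ^ 2) ->
  summable (dcell X (S k)) (fun t => Dc G t ^ 2) /\
  tsum (dcell X (S k)) (fun t => Dc G t ^ 2)
    <= INR (S k) ^ 2 * tsum (dcell X k) (fun s => INR (deg X s) * G s ^ 2).
Proof.
  intros HX Hs. pose proof (tsum_spec _ _ Hs) as H. set (l := tsum (dcell X k) _) in *.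
  pose proof (has_sum_tl_sq X k G l HX H) as H1.
  assert (H2 : has_sum (dcell X (S k))
     (fun t => INR (S k) * sm (fun i => G (rem i t) ^ 2) (seq 0 (S k))) (INR (S k) ^ 2 * l)).
  { replace (INR (S k) ^ 2 * l) with (INR (S k) * sm (fun _ : nat => l) (seq 0 (S k)))
      by (rewrite sm_const, length_seq; ring).
    apply has_sum_scal, (has_sum_sm _ (fun i t => G (rem i t) ^ 2)).
    intros i Hi. apply in_seq in Hi. apply has_sum_front_sq; auto; lia. }
  rewrite <- (tsum_eq _ _ _ H2). apply summable_dom0; [|eexists; apply H2].
  intros t [_ Ht]. split; [apply pow2_ge_0|].
  unfold Dc. rewrite Ht. eapply Rle_trans; [apply sm_CS|]. rewrite length_seq. right. f_equal.
  apply sm_ext. intros i _. rewrite Rpow_mult_distr, <- pow_mult, Nat.mul_comm, pow_mult.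
  replace ((-1) ^ 2) with 1 by ring. rewrite pow1. ring.
Qed.

Lemma bdry_bd X k (F : form) : fin_nb X k -> summable (dcell X (S k)) (fun t => F t ^ 2) ->
  summable (dcell X k) (fun s => bdry X F s ^ 2 * / INR (deg X s)) /\
  tsum (dcell X k) (fun s => bdry X F s ^ 2 * / INR (deg X s)) <= tsum (dcell X (S k)) (fun t => F t ^ 2).
Proof.
  intros HX Hs. pose proof (tsum_spec _ _ Hs) as H. set (l := tsum (dcell X (S k)) _) in *.
  apply (has_sum_fibres _ _ _ _ _ _ (tl_fibres X k HX)) in H.
  rewrite <- (tsum_eq _ _ _ H). apply summable_dom0; [|eexists; apply H].
  intros s Hsc. rewrite (deg_nbl X k), (bdry_nbl X k), sm_map by auto.
  (* Without neighbours both sides vanish, whatever the inverse of [0] is. *)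
  set (L := nbl X s). destruct L as [|v L'] eqn:EL.
  - unfold sm; simpl. split; right; ring.
  - rewrite <- EL. assert (Hp : 0 < INR (length L)) by (rewrite EL; simpl length; apply lt_0_INR; lia).
    assert (Hi : 0 < / INR (length L)) by (now apply Rinv_0_lt_compat).
    split; [apply Rmult_le_pos; [apply pow2_ge_0 | lra]|].
    apply Rmult_le_reg_r with (INR (length L)); auto. rewrite Rmult_assoc, Rinv_l by lra.
    rewrite Rmult_1_r, Rmult_comm. apply sm_CS.
Qed.

(** Both nested sums are extended by zero to all vertices below [N]. The summand is then
    antisymmetric in the two added vertices, so the sum equals its own negative. *)
Lemma bdry_bdry X k f : finite_complex X ->
  is_form X (S (S k)) f -> feq X k (bdry X (bdry X f)) zero_form.
Proof.
  intros [N HN] Hf s Hs.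
  assert (EN : forall j t, dcell X j t -> enumerates (nbv X t) (filt (nbv X t) (seq 0 N))).
  { intros j t Ht. split; [apply nodup_filt, seq_NoDup|]. intros v. rewrite in_filt, in_seq.
    split; [tauto|]. intros Hv. split; auto. split; [lia|]. simpl.
    apply (HN (v :: t)); [apply Hv | simpl; auto]. }
  set (u := fun v w => if dec (dcell X (S (S k)) (w :: v :: s)) then f (w :: v :: s) else 0).
  assert (E : bdry X (bdry X f) s = sm (fun v => sm (u v) (seq 0 N)) (seq 0 N)).
  { unfold bdry at 1. rewrite (fsum_eq _ _ _ (EN k s Hs)).
    rewrite <- (sm_filt _ (nbv X s) (seq 0 N)).
    - apply sm_ext. intros v Hv. apply in_filt in Hv as [_ Hv]. apply (nbv_cell X k) in Hv; auto.
      unfold bdry. rewrite (fsum_eq _ _ _ (EN _ _ Hv)).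
      rewrite <- (sm_filt (u v) (nbv X (v :: s)) (seq 0 N)).
      + apply sm_ext. intros w Hw. apply in_filt in Hw as [_ Hw]. apply (nbv_cell X (S k)) in Hw; auto.
        unfold u. now rewrite (proj2 (dec_true _) Hw).
      + intros w _ Hw. unfold u. rewrite (proj2 (dec_false _)); auto.
        intros Hc. apply Hw. now apply (nbv_cell X (S k)).
    - intros v _ Hv. apply sm_zero. intros w _. unfold u. rewrite (proj2 (dec_false _)); auto.
      intros Hc. apply Hv. apply (nbv_cell X k); auto. exact (tl_cell X _ _ Hc). }
  assert (A : forall v w, u v w = - u w v).
  { assert (Hsw : forall v w, dcell X (S (S k)) (w :: v :: s) -> dcell X (S (S k)) (v :: w :: s)).
    { intros v w Hc. eapply dcell_perm; eauto. constructor. }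
    intros v w. unfold u. destruct (dec (dcell X (S (S k)) (w :: v :: s))) eqn:E1.
    - rewrite dec_true in E1. rewrite (proj2 (dec_true _) (Hsw _ _ E1)).
      rewrite (Hf (w :: v :: s) (v :: w :: s)); auto; [ring|].
      apply perm_par_swap. exact (AdjSwap [] w v s).
    - rewrite dec_false in E1. rewrite (proj2 (dec_false _)); [ring|]. auto. }
  assert (E2 : sm (fun v => sm (u v) (seq 0 N)) (seq 0 N) = - sm (fun v => sm (u v) (seq 0 N)) (seq 0 N)).
  { rewrite sm_exchange at 1.
    rewrite (sm_ext _ (fun v => -1 * sm (u v) (seq 0 N))); [rewrite sm_scal; ring|].
    intros v _. rewrite <- sm_scal. apply sm_ext. intros w _. rewrite A; ring. }
  rewrite E. unfold zero_form. lra.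
Qed.

(** * Oriented versus canonical cells *)

Lemma perm_par_trans b c s t u : perm_par b s t -> perm_par c t u -> perm_par (xorb b c) s u.
Proof.
  intros H1 H2. induction H2 as [|c t u v H2 IH Ha].
  - now rewrite Bool.xorb_false_r.
  - replace (xorb b (negb c)) with (negb (xorb b c)) by (destruct b, c; reflexivity).
    econstructor; eauto.
Qed.

Lemma perm_perm_par s t : Permutation s t -> exists b, perm_par b s t.
Proof.
  induction 1 as [|x l l' _ [b IH]|x y l|l l' l'' _ [b IH1] _ [c IH2]].
  - exists false; constructor.
  - exists b; now apply perm_par_cons.
  - exists true. apply perm_par_swap. exact (AdjSwap [] y x l).
  - exists (xorb b c). eapply perm_par_trans; eauto.
Qed.

Lemma is_form_sq X k f s t : is_form X k f -> dcell X k s -> Permutation s t -> f t ^ 2 = f s ^ 2.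
Proof.
  intros Hf Hs Hp. destruct (perm_perm_par s t Hp) as [b Hb].
  rewrite (is_form_par X k f b s t) by auto. destruct b; simpl; ring.
Qed.

Lemma insert_sorted a t : StronglySorted lt t -> ~ In a t ->
  exists t', Permutation (a :: t) t' /\ StronglySorted lt t'.
Proof.
  induction 1 as [|b t Ht IH Hb]; intros Ha.
  - exists [a]. split; auto. constructor; constructor.
  - simpl in Ha. destruct (Nat.lt_ge_cases a b) as [L|L].
    + exists (a :: b :: t). split; auto. constructor; [constructor; auto|].
      constructor; auto. rewrite Forall_forall in *. intros x Hx. specialize (Hb x Hx). lia.
    + destruct IH as [t' [Hp Hs]]; [tauto|]. exists (b :: t'). split.
      * eapply Permutation_trans; [apply perm_swap|]. now constructor.
      * constructor; auto. rewrite Forall_forall in *. intros x Hx.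
        apply (Permutation_in x (Permutation_sym Hp)) in Hx as [<-|Hx]; [lia | auto].
Qed.

Lemma sorted_exists s : NoDup s -> exists t, Permutation s t /\ Sorted lt t.
Proof.
  intros H. assert (exists t, Permutation s t /\ StronglySorted lt t) as [t [Hp Hs]].
  { induction H as [|a s Ha Hs [t [Hp Ht]]].
    - exists []; split; auto; constructor.
    - destruct (insert_sorted a t Ht) as [t' [Hp' Ht']].
      + intros Hin. apply Ha. eapply Permutation_in; [apply Permutation_sym|]; eauto.
      + exists t'. split; auto. eapply Permutation_trans; [|apply Hp']. now constructor. }
  exists t; split; auto. now apply StronglySorted_Sorted.
Qed.

Lemma sorted_unique s t : Sorted lt s -> Sorted lt t -> Permutation s t -> s = t.
Proof.
  intros Hs Ht. apply Sorted_StronglySorted in Hs; [|intros x y z; lia].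
  apply Sorted_StronglySorted in Ht; [|intros x y z; lia].
  revert t Ht; induction Hs as [|a s Hs IH Ha]; intros t Ht Hp.
  - symmetry; now apply Permutation_nil.
  - destruct Ht as [|b t Ht Hb]; [apply Permutation_sym, Permutation_nil in Hp; auto|].
    rewrite Forall_forall in *.
    assert (a = b).
    { assert (H1 : In a (b :: t)) by (eapply Permutation_in; eauto; simpl; auto).
      assert (H2 : In b (a :: s)) by (eapply Permutation_in; [apply Permutation_sym; eauto|]; simpl; auto).
      destruct H1 as [|H1]; auto. destruct H2 as [|H2]; auto.
      specialize (Ha b H2). specialize (Hb a H1). lia. }
    subst b. f_equal. apply IH; auto. now apply Permutation_cons_inv in Hp.
Qed.

Fixpoint all_lists (N k : nat) : list (list nat) :=
  match k with
  | O => [[]]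
  | S k => flat_map (fun l => map (fun v => v :: l) (seq 0 N)) (all_lists N k)
  end.

Lemma in_all_lists N k l : In l (all_lists N k) <-> length l = k /\ forall v, In v l -> (v < N)%nat.
Proof.
  revert l; induction k as [|k IH]; intros l; simpl.
  - split; [intros [<-|[]]; simpl; tauto|]. intros [H _]. left. symmetry; now apply length_zero_iff_nil.
  - rewrite in_flat_map. split.
    + intros [t [Ht Hl]]. apply in_map_iff in Hl as [v [<- Hv]]. apply in_seq in Hv.
      apply IH in Ht as [H1 H2]. split; [simpl; lia|]. intros x [<-|Hx]; [lia | auto].
    + intros [H1 H2]. destruct l as [|v t]; [discriminate|]. exists t. split.
      * apply IH. split; [simpl in *; lia|]. intros x Hx; apply H2; simpl; auto.
      * apply in_map_iff. exists v. split; auto. apply in_seq.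
        specialize (H2 v (or_introl eq_refl)). lia.
Qed.

Lemma finite_lists (Q : list nat -> Prop) N k :
  (forall l, Q l -> length l = k /\ forall v, In v l -> (v < N)%nat) ->
  exists L, NoDup L /\ forall l, In l L <-> Q l.
Proof.
  intros H. exists (nodup eq_dec_c (filt Q (all_lists N k))). split; [apply NoDup_nodup|].
  intros l. rewrite nodup_In, in_filt, in_all_lists. split; [tauto|]. intros Hl; split; auto.
Qed.

Lemma orderings_exist k : exists L, NoDup L /\ forall p, In p L <-> Permutation (seq 0 k) p.
Proof.
  apply (finite_lists _ k k). intros l Hl. split.
  - rewrite <- (Permutation_length Hl). apply length_seq.
  - intros v Hv. apply (Permutation_in v (Permutation_sym Hl)), in_seq in Hv. lia.
Qed.

Lemma map_nth_seq_id (s : list nat) : map (fun i => nth i s O) (seq 0 (length s)) = s.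
Proof.
  induction s as [|a s IH]; [reflexivity|]. simpl. f_equal.
  rewrite <- seq_shift, map_map. exact IH.
Qed.

Lemma map_inj_in {A B} (h : A -> B) l l' :
  (forall a b, In a l -> In b l' -> h a = h b -> a = b) -> map h l = map h l' -> l = l'.
Proof.
  revert l'; induction l as [|a l IH]; intros [|b l'] H E; try discriminate; auto.
  injection E as E1 E2. f_equal; [apply H; simpl; auto|].
  apply IH; auto. intros; apply H; simpl; auto.
Qed.

(** The fibre over an increasing [s] consists of its reorderings, indexed by the permutations of the
    positions [0, ..., k - 1], and [q] is their number [k!]. *)
Lemma canon_fibres X k : exists p fib q, 0 < q /\ fibres (dcell X k) (canon X k) p fib /\
  forall u s, canon X k s -> (forall t, Permutation s t -> u t = u s) -> sm u (fib s) = q * u s.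
Proof.
  destruct (orderings_exist k) as [L [HL HLp]].
  set (p := fun s => epsilon (inhabits []) (fun t => Permutation s t /\ Sorted lt t)).
  assert (Hp : forall s, dcell X k s -> Permutation s (p s) /\ Sorted lt (p s)).
  { intros s [Hs _]. unfold p. apply epsilon_spec, sorted_exists, (cell_nodup X), Hs. }
  exists p, (fun s => map (fun o => map (fun i => nth i s O) o) L), (INR (length L)). split; [|split; [split|]].
  - apply lt_0_INR. destruct L as [|x L]; [|simpl; lia].
    exfalso. assert (H : In (seq 0 k) []) by (apply HLp; auto). destruct H.
  - intros s Hs. destruct (Hp s Hs) as [H1 H2]. split; auto. eapply dcell_perm; eauto.
  - intros s [[Hs Hk] Hsort]. split.
    + apply NoDup_map_inj; auto. intros o o' Ho Ho' E. apply HLp in Ho, Ho'.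
      revert E; apply map_inj_in. intros i j Hi Hj E.
      apply (Permutation_in i (Permutation_sym Ho)), in_seq in Hi.
      apply (Permutation_in j (Permutation_sym Ho')), in_seq in Hj.
      apply (proj1 (NoDup_nth s O)); auto; try lia. now apply (cell_nodup X).
    + intros t. rewrite in_map_iff. split.
      * intros [o [<- Ho]]. apply HLp in Ho.
        assert (Hst : Permutation s (map (fun i => nth i s O) o)).
        { rewrite <- (map_nth_seq_id s) at 1. rewrite Hk. now apply Permutation_map. }
        assert (Ht : dcell X k (map (fun i => nth i s O) o)) by (eapply dcell_perm; eauto; split; auto).
        split; auto. destruct (Hp _ Ht) as [H1 H2]. apply sorted_unique; auto.
        apply Permutation_sym. eapply Permutation_trans; eauto.
      * intros [Ht E]. destruct (Hp t Ht) as [H1 _]. rewrite E in H1.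
        rewrite <- (map_nth_seq_id s), Hk in H1.
        apply Permutation_map_inv in H1 as [o [Eo Ho]]. exists o. split; auto. now apply HLp.
  - intros u s [[Hs Hk] _] Hu. rewrite sm_map, (sm_ext _ (fun _ => u s)); [apply sm_const|].
    intros o Ho. apply Hu. apply HLp in Ho.
    rewrite <- (map_nth_seq_id s) at 1. rewrite Hk. now apply Permutation_map.
Qed.

(** Translates the sums of the definitions into sums over ordered cells. As [q] is chosen before
    [u], all squared norms are rescaled alike and orthogonality is unaffected. *)
Lemma canon_sum X k : exists q, 0 < q /\ forall u,
  (forall s t, dcell X k s -> Permutation s t -> u t = u s) -> (forall s, dcell X k s -> 0 <= u s) ->
  forall l, HasSum (canon X k) u l <-> has_sum (dcell X k) u (q * l).
Proof.
  destruct (canon_fibres X k) as [p [fib [q [Hq [Hf Hs]]]]]. exists q; split; auto.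
  intros u Hu H0 l.
  assert (Hc0 : forall s, canon X k s -> 0 <= u s) by (intros s [H _]; auto).
  assert (E : psums (canon X k) u = fun x => exists L, subl (canon X k) L /\ x = sm u L).
  { apply functional_extensionality; intros x. apply propositional_extensionality.
    split; intros [L H]; exists L; unfold subl, sm in *; tauto. }
  assert (Hsc : forall s, canon X k s -> sm u (fib s) = q * u s).
  { intros s H. apply Hs; auto. intros t Ht; apply Hu; auto. apply H. }
  unfold HasSum. rewrite E. split; intros H.
  - apply has_sum_lub in H; auto. apply (has_sum_fibres_inv _ (canon X k) p fib); auto.
    apply (has_sum_ext _ (fun s => q * u s)); [intros; symmetry; auto|]. now apply has_sum_scal.
  - apply has_sum_is_lub; auto. apply (has_sum_fibres _ (canon X k) p fib) in H; auto.
    apply (has_sum_scal _ (/ q)) in H.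
    replace (/ q * (q * l)) with l in H by (field; lra).
    revert H; apply has_sum_ext. intros s Hsc'. rewrite Hsc by auto. field; lra.
Qed.

(** * The upper Laplacian *)

Definition Wd (X : complex) : list nat -> R := fun s => / INR (deg X s).
Definition nf (X : complex) (f : form) : form := fun s => f s * Wd X s.

Lemma is_form_lin X k a f b g : is_form X k f -> is_form X k g -> is_form X k (lin a f b g).
Proof. intros Hf Hg s t Hs Hp. unfold lin. rewrite (Hf s t), (Hg s t) by auto. ring. Qed.

Lemma nf_is_form X k f : is_form X k f -> is_form X k (nf X f).
Proof.
  intros Hf s t Hs Hp. unfold nf, Wd. rewrite (Hf s t) by auto.
  rewrite (deg_perm X s t) by eauto using perm_par_perm. ring.
Qed.

Lemma delta_top_Dc X f t : delta_top X f t = Dc (nf X f) t.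
Proof. apply sm_ext. intros i _. unfold nf, Wd, Rdiv. ring. Qed.

Lemma delta_low_Dc X f s : delta_low X f s = INR (deg X s) * Dc f s.
Proof. reflexivity. Qed.

Lemma delta_top_is_form X k f : is_form X k f -> is_form X (S k) (delta_top X f).
Proof.
  intros Hf s t Hs Hp. rewrite !delta_top_Dc. eapply Dc_is_form; eauto. now apply nf_is_form.
Qed.

Lemma delta_low_is_form X k f : is_form X k f -> is_form X (S k) (delta_low X f).
Proof.
  intros Hf s t Hs Hp. rewrite !delta_low_Dc.
  rewrite (Dc_is_form X k f Hf s t), (deg_perm X s t) by eauto using perm_par_perm. ring.
Qed.

Lemma delta_low_lin X a f b g s : delta_low X (lin a f b g) s = a * delta_low X f s + b * delta_low X g s.
Proof. rewrite !delta_low_Dc, Dc_lin. ring. Qed.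

Lemma delta_top_lin X a f b g s : delta_top X (lin a f b g) s = a * delta_top X f s + b * delta_top X g s.
Proof.
  rewrite !delta_top_Dc, <- Dc_lin. apply Dc_ext. intros. unfold nf, lin. ring.
Qed.

Lemma lapl_is_form X k f : is_form X k f -> is_form X k (lapl_up X f).
Proof. intros; now apply bdry_is_form, delta_top_is_form. Qed.

Lemma lapl_lin X a f b g s : lapl_up X (lin a f b g) s = a * lapl_up X f s + b * lapl_up X g s.
Proof.
  unfold lapl_up. rewrite <- bdry_lin. unfold bdry. apply fsum_ext. intros v _.
  rewrite delta_top_lin. reflexivity.
Qed.

Lemma is_form_closed X k W fs f : (forall s, dcell X k s -> 0 < W s) ->
  (forall j, is_form X k (fs j)) -> (forall j, L2 (dcell X k) W (fs j)) -> L2 (dcell X k) W f ->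
  cvg (dcell X k) W fs f -> is_form X k f.
Proof.
  intros HW Hfs HL Hf Hc s t Hs Hp.
  assert (Ht : dcell X k t) by (eapply dcell_perm; eauto using perm_par_perm).
  pose proof (cvg_point _ _ HW fs f s HL Hf Hc Hs) as C1.
  pose proof (cvg_point _ _ HW fs f t HL Hf Hc Ht) as C2.
  apply (UL_sequence (fun j => fs j t)); auto.
  apply CV_opp in C1. intros eps He. destruct (C1 eps He) as [N HN]. exists N. intros j Hj.
  rewrite (Hfs j s t) by auto. exact (HN j Hj).
Qed.

Section Upper.
Variables (d : nat) (X : complex) (Dm : nat).
Hypothesis HU : uniform_dcomplex d X.
Hypothesis HD : forall s, dcell X d s -> deg_le X s Dm.

Notation Pd := (dcell X d).
Notation L2d := (L2 Pd (Wd X)).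
Notation ipd := (ip Pd (Wd X)).
Notation Nmd := (Nm Pd (Wd X)).

Lemma fin_top : fin_nb X d.
Proof. intros s Hs. destruct (deg_le_enum X s Dm (HD s Hs)) as [L [HL _]]. eauto. Qed.

Lemma deg_top_le s : Pd s -> INR (deg X s) <= INR Dm.
Proof.
  intros Hs. apply le_INR. destruct (deg_le_enum X s Dm (HD s Hs)) as [L [HL Hn]].
  unfold deg. now rewrite (fcard_eq _ L).
Qed.

(** Uniformity puts [s] in a [d]-cell, which has a vertex outside [s]. Positive degrees make the
    weights [Wd] positive and thus the norm definite. *)
Lemma deg_top_pos s : Pd s -> 0 < INR (deg X s).
Proof.
  intros Hs. apply lt_0_INR. destruct (fin_top s Hs) as [L HL].
  unfold deg. rewrite (fcard_eq _ L) by auto.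
  destruct HU as [_ [_ Hu]]. destruct Hs as [Hc Hk]. destruct (Hu s Hc) as [t [[Ht Htk] Hi]].
  assert (exists v, In v t /\ ~ In v s) as [v [Hv Hn]].
  { apply NNPP. intros N.
    assert (incl t s) by (intros v Hv; apply NNPP; intros Hn; apply N; eauto).
    pose proof (NoDup_incl_length (cell_nodup X t Ht) H). lia. }
  assert (nbv X s v).
  { split; auto. apply (cell_sub X t); auto.
    - constructor; auto. now apply (cell_nodup X).
    - intros x [<-|Hx]; auto. }
  apply HL in H. destruct L; [destruct H | simpl; lia].
Qed.

Lemma Wd_pos s : Pd s -> 0 < Wd X s.
Proof. intros; now apply Rinv_0_lt_compat, deg_top_pos. Qed.
Hint Resolve Wd_pos : core.

Lemma nf_sum f : L2d f -> has_sum Pd (fun s => INR (deg X s) * nf X f s ^ 2) (ipd f f).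
Proof.
  intros Hf. apply (has_sum_ext _ (fun s => f s * f s * Wd X s)).
  - intros s Hs. pose proof (deg_top_pos s Hs). unfold nf, Wd. field. lra.
  - apply tsum_spec, ip_summable; auto.
Qed.

Lemma delta_top_bd f : L2d f -> summable (dcell X (S d)) (fun t => delta_top X f t ^ 2) /\
  tsum (dcell X (S d)) (fun t => delta_top X f t ^ 2) <= INR (S d) ^ 2 * ipd f f.
Proof.
  intros Hf. pose proof (nf_sum f Hf) as H.
  destruct (Dc_bd X d (nf X f) fin_top) as [H1 H2]; [eexists; eauto|].
  rewrite (tsum_eq _ _ _ H) in H2.
  replace (fun t => delta_top X f t ^ 2) with (fun t => Dc (nf X f) t ^ 2); auto.
  apply functional_extensionality; intros; now rewrite delta_top_Dc.
Qed.

Lemma lapl_L2 f : L2d f -> L2d (lapl_up X f).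
Proof. intros Hf. apply (bdry_bd X d (delta_top X f) fin_top), delta_top_bd, Hf. Qed.

Lemma lapl_bd f : L2d f -> Nmd (lapl_up X f) <= INR (S d) * Nmd f.
Proof.
  intros Hf. pose proof (pos_INR (S d)). pose proof (Nm_ge0 Pd (Wd X) f).
  apply Nm_le_of_sq; auto using lapl_L2; [nra|].
  destruct (delta_top_bd f Hf) as [H1 H2].
  destruct (bdry_bd X d (delta_top X f) fin_top H1) as [H3 H4].
  replace (ipd (lapl_up X f) (lapl_up X f)) with
    (tsum Pd (fun s => bdry X (delta_top X f) s ^ 2 * / INR (deg X s))).
  - eapply Rle_trans; [apply H4|]. eapply Rle_trans; [apply H2|].
    rewrite <- (Nm_sq Pd (Wd X)) by auto. right; ring.
  - unfold ip. f_equal. apply functional_extensionality; intros; unfold lapl_up, Wd; ring.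
Qed.

(** Summation by parts: [adjoint] for [delta_top X f] and [nf X g]. The factor [/ INR (S d)] undoes
    the surplus of orderings of a [d]-cell. Symmetry and nonnegativity of the Laplacian are read off
    from the right-hand side. *)
Lemma green f g : is_form X d f -> L2d f -> L2d g ->
  ipd (lapl_up X f) g = / INR (S d) * tsum (dcell X (S d)) (fun t => delta_top X f t * delta_top X g t).
Proof.
  intros Ff Hf Hg.
  pose proof (has_sum_tl_sq X d (nf X g) _ fin_top (nf_sum g Hg)) as H1.
  assert (H2 : summable (dcell X (S d)) (fun t => delta_top X f t * nf X g (tl t))).
  { apply (summable_dom _ _ (fun t => delta_top X f t ^ 2 + nf X g (tl t) ^ 2)).
    - intros t _. apply Rabs_le. set (x := delta_top X f t). set (y := nf X g (tl t)).
      pose proof (pow2_ge_0 (x + y)); pose proof (pow2_ge_0 (x - y)).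
      pose proof (pow2_ge_0 x); pose proof (pow2_ge_0 y). split; lra.
    - apply summable_add; [now apply delta_top_bd | eexists; eauto]. }
  destruct H2 as [l H2].
  destruct (adjoint X d _ (nf X g) l fin_top (delta_top_is_form X d f Ff) H2) as [H3 H4].
  assert (H5 : has_sum (dcell X (S d)) (fun t => delta_top X f t * delta_top X g t) (INR (S d) * l)).
  { revert H4. apply has_sum_ext. intros t _. now rewrite (delta_top_Dc X g). }
  rewrite (tsum_eq _ _ _ H5), <- Rmult_assoc, Rinv_l, Rmult_1_l by (apply not_0_INR; lia).
  apply tsum_eq. revert H3; apply has_sum_ext. intros s _. unfold nf, lapl_up. ring.
Qed.

Lemma lapl_sym f g : is_form X d f -> is_form X d g -> L2d f -> L2d g ->
  ipd (lapl_up X f) g = ipd f (lapl_up X g).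
Proof.
  intros. rewrite (ip_sym _ _ f), !green by auto. f_equal. f_equal.
  apply functional_extensionality; intros; ring.
Qed.

Lemma lapl_nonneg f : is_form X d f -> L2d f -> 0 <= ipd (lapl_up X f) f.
Proof.
  intros Ff Hf. rewrite green by auto. apply Rmult_le_pos.
  - left; apply Rinv_0_lt_compat, lt_0_INR; lia.
  - apply (has_sum_ge0 (dcell X (S d)) (fun t => delta_top X f t * delta_top X f t)); [intros; nra|].
    apply tsum_spec. apply (summable_ext _ (fun t => delta_top X f t ^ 2)); [intros; ring|].
    now apply delta_top_bd.
Qed.

(** The degree in [delta_low] cancels the division in [delta_top], leaving [Dc (Dc g)]. *)
Lemma delta_top_low g t : dcell X (S d) t -> delta_top X (delta_low X g) t = 0.
Proof.
  intros Ht. rewrite delta_top_Dc, <- (Dc_Dc g t). apply Dc_ext. intros i Hi.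
  unfold nf, Wd. rewrite delta_low_Dc.
  assert (Pd (rem i t)) by (apply rem_cell; auto; destruct Ht; lia).
  pose proof (deg_top_pos _ H). field. lra.
Qed.

Lemma lapl_low g : feq X d (lapl_up X (delta_low X g)) zero_form.
Proof.
  intros s Hs. unfold lapl_up. rewrite (bdry_ext X d _ (lin 0 zero_form 0 zero_form)); auto.
  - rewrite bdry_lin. unfold zero_form at 3. ring.
  - intros t Ht. rewrite delta_top_low by auto. unfold lin, zero_form; ring.
Qed.

Lemma wsq_perm f : is_form X d f -> forall s t, Pd s -> Permutation s t -> wsq X f t = wsq X f s.
Proof.
  intros Ff s t Hs Hp. unfold wsq. rewrite (is_form_sq X d f s t), (deg_perm X s t) by auto. auto.
Qed.

Lemma wsq_nonneg f s : Pd s -> 0 <= wsq X f s.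
Proof.
  intros Hs. unfold wsq. apply Rmult_le_pos; [apply pow2_ge_0|]. left. now apply Wd_pos.
Qed.

Lemma L2_top_iff f : is_form X d f -> L2_top d X f <-> L2d f.
Proof.
  intros Ff. destruct (canon_sum X d) as [q [Hq H]].
  specialize (H (wsq X f) (wsq_perm f Ff) (wsq_nonneg f)). split.
  - intros [l Hl]. exists (q * l). now apply H.
  - intros [l Hl]. exists (/ q * l). apply H.
    rewrite <- Rmult_assoc, Rinv_r, Rmult_1_l by lra. exact Hl.
Qed.

(** The two squared norms compared by [orth_top] differ by [4 <f, h>], up to the common factor
    [q]. *)
Lemma orth_top_iff f h : is_form X d f -> is_form X d h -> L2d f -> L2d h ->
  orth_top d X f h <-> ipd f h = 0.
Proof.
  intros Ff Fh Hf Hh. destruct (canon_sum X d) as [q [Hq H]].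
  assert (G : forall b, has_sum Pd (wsq X (lin 1 f b h)) (ipd f f + 2 * b * ipd f h + b ^ 2 * ipd h h)).
  { intros b.
    replace (ipd f f + 2 * b * ipd f h + b ^ 2 * ipd h h) with (ipd (lin 1 f b h) (lin 1 f b h))
      by (rewrite ip_lin2 by auto; ring).
    apply (has_sum_ext _ (fun s => lin 1 f b h s * lin 1 f b h s * Wd X s)).
    - intros; unfold wsq, Wd, Rdiv; ring.
    - apply tsum_spec, ip_summable; auto; apply L2_lin; auto. }
  assert (K : forall b l, HasSum (canon X d) (wsq X (lin 1 f b h)) l <->
     q * l = ipd f f + 2 * b * ipd f h + b ^ 2 * ipd h h).
  { intros b l. assert (Fl : is_form X d (lin 1 f b h)) by (now apply is_form_lin).
    rewrite (H _ (wsq_perm _ Fl) (wsq_nonneg _)). split.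
    - intros Hl. eapply has_sum_unique; eauto.
    - intros ->. apply G. }
  assert (E1 : (fun s => f s + h s) = lin 1 f 1 h)
    by (apply functional_extensionality; intros; unfold lin; ring).
  assert (E2 : (fun s => f s - h s) = lin 1 f (-1) h)
    by (apply functional_extensionality; intros; unfold lin; ring).
  unfold orth_top. rewrite E1, E2. split.
  - intros Ho. specialize (Ho (/ q * (ipd f f + 2 * 1 * ipd f h + 1 ^ 2 * ipd h h))
                             (/ q * (ipd f f + 2 * (-1) * ipd f h + (-1) ^ 2 * ipd h h))).
    assert (E : / q * (ipd f f + 2 * 1 * ipd f h + 1 ^ 2 * ipd h h) =
                / q * (ipd f f + 2 * (-1) * ipd f h + (-1) ^ 2 * ipd h h)).
    { apply Ho; apply K; field; lra. }
    apply Rmult_eq_reg_l in E; [lra|]. apply Rinv_neq_0_compat; lra.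
  - intros Z l1 l2 H1 H2. apply K in H1. apply K in H2. rewrite Z in *.
    apply (Rmult_eq_reg_l q); lra.
Qed.

Lemma Zspace_iff f : (1 <= d)%nat -> Zspace d X f <-> is_form X d f /\ L2d f /\
  forall g, is_form X (d - 1) g -> L2_low (d - 1) X g -> L2d (delta_low X g) ->
    ipd f (delta_low X g) = 0.
Proof.
  intros Hd. unfold Zspace.
  assert (Fl : forall g, is_form X (d - 1) g -> is_form X d (delta_low X g)).
  { intros g Hg. replace d with (S (d - 1)) by lia. now apply delta_low_is_form. }
  split.
  - intros [Ff [Hf Ho]]. apply L2_top_iff in Hf; auto. split; [|split]; auto.
    intros g Fg Hg HL. apply orth_top_iff; auto. apply Ho; auto. now apply L2_top_iff; auto.
  - intros [Ff [Hf Ho]]. split; [|split]; auto; [now apply L2_top_iff|].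
    intros g Fg Hg HL. apply L2_top_iff in HL; auto. apply orth_top_iff; auto.
Qed.

Lemma lapl_Z f : (1 <= d)%nat -> is_form X d f -> L2d f -> Zspace d X (lapl_up X f).
Proof.
  intros Hd Ff Hf. apply Zspace_iff; auto. split; [|split].
  - now apply lapl_is_form.
  - now apply lapl_L2.
  - intros g Fg _ HL. rewrite green by auto.
    rewrite (tsum_eq _ _ 0); [ring|].
    apply (has_sum_ext _ (fun _ => 0)); [|apply has_sum_zero].
    intros t Ht. rewrite delta_top_low by auto. ring.
Qed.

Lemma Zspace_subsp : (1 <= d)%nat -> subsp Pd (Wd X) (Zspace d X).
Proof.
  intros Hd. split.
  - intros f Hf. apply Zspace_iff in Hf; tauto.
  - intros a f b g Hf Hg. apply Zspace_iff in Hf, Hg; auto. apply Zspace_iff; auto.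
    destruct Hf as [Ff [Lf Of]], Hg as [Fg [Lg Og]]. split; [|split].
    + now apply is_form_lin.
    + apply L2_lin; auto.
    + intros h Fh Hh HL. rewrite ip_lin_l, Of, Og by auto. ring.
  - intros fs f Hfs Hf Hc. apply Zspace_iff; auto.
    assert (K : forall k, is_form X d (fs k) /\ L2d (fs k) /\
      forall g, is_form X (d - 1) g -> L2_low (d - 1) X g -> L2d (delta_low X g) ->
        ipd (fs k) (delta_low X g) = 0) by (intros k; now apply Zspace_iff).
    split; [|split]; auto.
    + apply (is_form_closed X d (Wd X) fs); auto; intros; apply K.
    + intros g Fg Hg HL. set (h := delta_low X g) in *.
      (* Orthogonality passes to the limit: [|<f, h>| = |<fs k - f, h>|], and for suitable [k] the
         right side is at most half of the left. The [+ 1] in the tolerance covers [h] of norm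
         [0]. *)
      destruct (Req_dec (ipd f h) 0) as [|N]; auto. exfalso.
      assert (Hp : 0 < Rabs (ipd f h)) by (now apply Rabs_pos_lt).
      pose proof (Nm_ge0 Pd (Wd X) h) as Hn.
      destruct (Hc (Rabs (ipd f h) / 2 / (Nmd h + 1))) as [k Hk]; [apply Rdiv_lt_0_compat; lra|].
      specialize (Hk k (le_n _)). destruct (K k) as [Fk [Lk Ok]].
      pose proof (ip_le_Nm Pd (Wd X) Wd_pos (lin 1 (fs k) (-1) f) h (L2_lin _ _ Wd_pos _ _ _ _ Lk Hf) HL) as B.
      rewrite ip_lin_l, (Ok g Fg Hg HL : ipd (fs k) h = 0) in B by auto.
      replace (1 * 0 + -1 * ipd f h) with (- ipd f h) in B by ring. rewrite Rabs_Ropp in B.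
      assert (Nmd (lin 1 (fs k) (-1) f) * Nmd h <= Rabs (ipd f h) / 2 / (Nmd h + 1) * (Nmd h + 1)).
      { apply Rmult_le_compat; auto; try lra. apply Nm_ge0. }
      replace (Rabs (ipd f h) / 2 / (Nmd h + 1) * (Nmd h + 1)) with (Rabs (ipd f h) / 2) in H
        by (field; lra). lra.
Qed.

Lemma lapl_symop : (1 <= d)%nat -> symop Pd (Wd X) (Zspace d X) (lapl_up X) (INR (S d)).
Proof.
  intros Hd.
  assert (K : forall f, Zspace d X f -> is_form X d f /\ L2d f).
  { intros f Hf. apply Zspace_iff in Hf; tauto. }
  split.
  - intros f Hf. apply lapl_Z; auto; now apply K.
  - intros. apply lapl_lin.
  - intros f g Hf Hg. apply lapl_sym; now apply K.
  - intros f Hf. apply lapl_bd; now apply K.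
Qed.

End Upper.

(** * The lower Laplacian on [(d-2)]-forms, and cycles *)

Definition W1 : list nat -> R := fun _ => 1.

Lemma W1_pos (P : list nat -> Prop) s : P s -> 0 < W1 s.
Proof. intros _. unfold W1. lra. Qed.

Lemma Nm_le_sqrt {A B} (P : A -> Prop) W (Q : B -> Prop) V f g C :
  0 <= C -> 0 <= ip Q V g g -> ip P W f f <= C * ip Q V g g -> Nm P W f <= sqrt C * Nm Q V g.
Proof. intros HC Hg H. unfold Nm. rewrite <- sqrt_mult by auto. now apply sqrt_le_1_alt. Qed.

Lemma finite_cells X k : finite_complex X -> exists F, NoDup F /\ forall s, In s F <-> dcell X k s.
Proof.
  intros [N HN]. apply (finite_lists _ N k). intros s [H E]. split; auto. now apply HN.
Qed.

Lemma finite_fin_nb X k : finite_complex X -> fin_nb X k.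
Proof.
  intros [N HN] s Hs. exists (filt (nbv X s) (seq 0 N)). split; [apply nodup_filt, seq_NoDup|].
  intros v. rewrite in_filt, in_seq. split; [tauto|]. intros Hv. split; auto. split; [lia|].
  apply (HN (v :: s)); [apply Hv | simpl; auto].
Qed.

Section Lower.
Variables (e : nat) (X : complex) (Dm Dl : nat).
Notation d := (S (S e)).
Hypothesis HU : uniform_dcomplex d X.
Hypothesis HD : forall s, dcell X d s -> deg_le X s Dm.
Hypothesis HDl : forall s, dcell X (S e) s -> deg_le X s Dl.

Notation Pd := (dcell X d).
Notation L2d := (L2 Pd (Wd X)).
Notation ipd := (ip Pd (Wd X)).
Notation Nmd := (Nm Pd (Wd X)).
Notation Pl := (dcell X (S e)).
Notation L2l := (L2 Pl W1).
Notation ipl := (ip Pl W1).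

Let Wp : forall s, Pd s -> 0 < Wd X s := Wd_pos d X Dm HU HD.
Let W1p : forall s, Pl s -> 0 < W1 s := W1_pos Pl.

Lemma fin_low : fin_nb X (S e).
Proof. intros s Hs. destruct (deg_le_enum X s Dl (HDl s Hs)) as [L [HL _]]. eauto. Qed.

Lemma deg_low_le s : Pl s -> INR (deg X s) <= INR Dl.
Proof.
  intros Hs. apply le_INR. destruct (deg_le_enum X s Dl (HDl s Hs)) as [L [HL Hn]].
  unfold deg. now rewrite (fcard_eq _ L).
Qed.

Lemma sq_top f : L2d f -> summable Pd (fun s => f s ^ 2) /\ tsum Pd (fun s => f s ^ 2) <= INR Dm * ipd f f.
Proof.
  intros Hf. unfold ip.
  assert (Hs : summable Pd (fun s => f s * f s * Wd X s)) by (apply ip_summable; auto).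
  rewrite <- tsum_scal by auto. apply summable_dom0; [|now apply summable_scal].
  intros s Hs'. pose proof (deg_top_pos d X Dm HU HD s Hs'). pose proof (deg_top_le d X Dm HD s Hs').
  split; [apply pow2_ge_0|]. unfold Wd.
  apply Rle_trans with (INR (deg X s) * (f s * f s * / INR (deg X s))); [right; field; lra|].
  apply Rmult_le_compat_r; auto. apply Rmult_le_pos; [nra|]. left; now apply Rinv_0_lt_compat.
Qed.

Lemma sum_low h : L2l h -> summable Pl (fun s => INR (deg X s) * h s ^ 2) /\
  tsum Pl (fun s => INR (deg X s) * h s ^ 2) <= INR Dl * ipl h h.
Proof.
  intros Hh. unfold ip.
  assert (Hs : summable Pl (fun s => h s * h s * W1 s)) by (apply ip_summable; auto).
  rewrite <- tsum_scal by auto. apply summable_dom0; [|now apply summable_scal].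
  intros s Hs'. pose proof (deg_low_le s Hs'). pose proof (pos_INR (deg X s)).
  unfold W1. pose proof (pow2_ge_0 (h s)). split; nra.
Qed.

(** [bdry_bd] controls the sum weighted by inverse degrees. The bound [Dl] removes that weight, and
    [Dm] compares the plain square sum of [f] with its weighted norm. *)
Lemma bdry_low_bd f : L2d f ->
  L2l (bdry X f) /\ ipl (bdry X f) (bdry X f) <= INR Dl * INR Dm * ipd f f.
Proof.
  intros Hf. destruct (sq_top f Hf) as [H1 H2].
  destruct (bdry_bd X (S e) f fin_low H1) as [H3 H4].
  assert (K : forall s, Pl s -> 0 <= bdry X f s ^ 2 <= INR Dl * (bdry X f s ^ 2 * / INR (deg X s))).
  { intros s Hs. split; [apply pow2_ge_0|]. pose proof (deg_low_le s Hs) as Hle.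
    rewrite (deg_nbl X (S e)) in * by (auto using fin_low).
    rewrite (bdry_nbl X (S e)) by (auto using fin_low).
    destruct (nbl X s) as [|v L]; [unfold sm; simpl; right; ring|].
    assert (Hp : 0 < INR (length (v :: L))) by (apply lt_0_INR; simpl; lia).
    set (n := INR (length (v :: L))) in *. set (b := sm _ _ ^ 2).
    assert (0 <= b) by apply pow2_ge_0.
    apply Rle_trans with (n * (b * / n)); [right; field; lra|].
    apply Rmult_le_compat_r; auto. apply Rmult_le_pos; auto. left; now apply Rinv_0_lt_compat. }
  assert (E : (fun s => bdry X f s ^ 2) = (fun s => bdry X f s * bdry X f s * W1 s))
    by (apply functional_extensionality; intros; unfold W1; ring).
  destruct (summable_dom0 Pl (fun s => bdry X f s ^ 2) _ K) as [H5 H6]; [now apply summable_scal|].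
  rewrite tsum_scal in H6 by auto. split.
  - revert H5; apply summable_ext. intros; unfold W1; ring.
  - unfold ip at 1. rewrite <- E. pose proof (pos_INR Dl).
    apply (Rmult_le_compat_l (INR Dl)) in H4; auto.
    apply (Rmult_le_compat_l (INR Dl)) in H2; auto. lra.
Qed.

Lemma delta_low_bd h : L2l h ->
  L2d (delta_low X h) /\
  ipd (delta_low X h) (delta_low X h) <= INR Dm * (INR d ^ 2 * INR Dl) * ipl h h.
Proof.
  intros Hh. destruct (sum_low h Hh) as [H1 H2].
  destruct (Dc_bd X (S e) h fin_low H1) as [H3 H4].
  assert (K : forall s, Pd s -> 0 <= delta_low X h s ^ 2 * Wd X s <= INR Dm * Dc h s ^ 2).
  { intros s Hs. rewrite delta_low_Dc. unfold Wd.
    pose proof (deg_top_pos d X Dm HU HD s Hs). pose proof (deg_top_le d X Dm HD s Hs).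
    replace ((INR (deg X s) * Dc h s) ^ 2 * / INR (deg X s)) with (INR (deg X s) * Dc h s ^ 2)
      by (field; lra).
    pose proof (pow2_ge_0 (Dc h s)). split; nra. }
  destruct (summable_dom0 Pd _ _ K) as [H5 H6]; [now apply summable_scal|].
  rewrite tsum_scal in H6 by auto. split; auto.
  replace (ipd (delta_low X h) (delta_low X h)) with (tsum Pd (fun s => delta_low X h s ^ 2 * Wd X s)).
  - pose proof (pos_INR Dm). pose proof (pow2_ge_0 (INR d)).
    apply (Rmult_le_compat_l (INR d ^ 2)) in H2; auto.
    eapply Rle_trans; [apply H6|]. rewrite Rmult_assoc. apply Rmult_le_compat_l; auto. lra.
  - unfold ip. f_equal. apply functional_extensionality; intros; ring.
Qed.

Lemma adj_low f h : is_form X d f -> L2d f -> L2l h ->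
  ipd f (delta_low X h) = INR d * ipl (bdry X f) h.
Proof.
  intros Ff Hf Hh. destruct (sq_top f Hf) as [H1 _]. destruct (sum_low h Hh) as [H2 _].
  destruct H2 as [l2 H2]. apply has_sum_tl_sq in H2; [|apply fin_low].
  assert (H3 : summable Pd (fun t => f t * h (tl t))).
  { apply (summable_dom _ _ (fun t => f t ^ 2 + h (tl t) ^ 2)).
    - intros t _. apply Rabs_le. set (x := f t). set (y := h (tl t)).
      pose proof (pow2_ge_0 (x + y)); pose proof (pow2_ge_0 (x - y)).
      pose proof (pow2_ge_0 x); pose proof (pow2_ge_0 y). split; lra.
    - apply summable_add; auto. eexists; eauto. }
  destruct H3 as [l H3].
  destruct (adjoint X (S e) f h l fin_low Ff H3) as [H4 H5].
  replace (ipl (bdry X f) h) with l.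
  - apply tsum_eq. revert H5; apply has_sum_ext. intros s Hs. rewrite delta_low_Dc. unfold Wd.
    pose proof (deg_top_pos d X Dm HU HD s Hs). field; lra.
  - symmetry. apply tsum_eq. revert H4; apply has_sum_ext. intros; unfold W1; ring.
Qed.

(** Test [f] against the coboundary of its own boundary: by [adj_low] the pairing is [d] times the
    squared norm of [bdry X f]. The degree bounds make this test form admissible. *)
Lemma Z_ker f : Zspace d X f -> feq X (S e) (bdry X f) zero_form.
Proof.
  intros Hf. apply (Zspace_iff d X Dm HU HD) in Hf as [Ff [Lf Of]]; [|lia].
  assert (Fb : is_form X (S e) (bdry X f)) by (now apply bdry_is_form).
  destruct (bdry_low_bd f Lf) as [Lb _]. destruct (delta_low_bd _ Lb) as [Ld _].
  assert (Z : ipd f (delta_low X (bdry X f)) = 0).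
  { apply Of; auto. destruct (canon_sum X (S e)) as [q [Hq H]].
    destruct Lb as [l Hl]. exists (/ q * l). apply H.
    - intros s t Hs Hp. now apply (is_form_sq X (S e)).
    - intros; apply pow2_ge_0.
    - rewrite <- Rmult_assoc, Rinv_r, Rmult_1_l by lra. revert Hl; apply has_sum_ext.
      intros; unfold W1; ring. }
  rewrite adj_low in Z by auto.
  assert (Z' : ipl (bdry X f) (bdry X f) = 0).
  { apply Rmult_integral in Z as [Z|Z]; auto. exfalso; revert Z; apply not_0_INR; lia. }
  intros s Hs. apply (Nm_zero Pl W1 W1p (bdry X f)); auto. unfold Nm. rewrite Z', sqrt_0. lra.
Qed.

Hypothesis HF : finite_complex X.

Lemma low_L2 h : L2l h.
Proof.
  destruct (finite_cells X (S e) HF) as [F [H1 H2]]. exact (L2_finite Pl W1 F H1 H2 h).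
Qed.

(** Converse of [Z_ker] on a finite complex, where every [(d-2)]-form is square-summable and
    [adj_low] applies to all of them. *)
Lemma ker_Z f : is_form X d f -> L2d f -> feq X (S e) (bdry X f) zero_form -> Zspace d X f.
Proof.
  intros Ff Lf E. apply (Zspace_iff d X Dm HU HD); [lia|]. split; [|split]; auto.
  intros g Fg _ HL. rewrite adj_low by (auto using low_L2).
  unfold ip. rewrite (tsum_eq _ _ 0); [ring|].
  apply (has_sum_ext _ (fun _ => 0)); [|apply has_sum_zero].
  intros s Hs. rewrite E by auto. unfold zero_form. ring.
Qed.

Lemma Kspace_iff f : Kspace d X f <-> is_form X (S e) f /\ feq X e (bdry X f) zero_form.
Proof. unfold Kspace. replace (d - 2)%nat with e by lia. reflexivity. Qed.

Lemma Kspace_subsp : subsp Pl W1 (Kspace d X).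
Proof.
  split.
  - intros; apply low_L2.
  - intros a f b g Hf Hg. apply Kspace_iff in Hf as [Ff Ef], Hg as [Fg Eg]. apply Kspace_iff.
    split; [now apply is_form_lin|].
    intros s Hs. rewrite bdry_lin, Ef, Eg by auto. unfold zero_form; ring.
  - intros fs f Hfs Hf Hc. apply Kspace_iff. split.
    + apply (is_form_closed X (S e) W1 fs f); auto; [intros; apply Hfs | intros; apply low_L2].
    + intros s Hs. assert (HN : fin_nb X e) by (now apply finite_fin_nb).
      assert (C : Un_cv (fun k => sm (fun v => fs k (v :: s)) (nbl X s)) (sm (fun v => f (v :: s)) (nbl X s))).
      { apply (Un_cv_sm (fun k v => fs k (v :: s)) (fun v => f (v :: s))). intros v Hv.
        apply (cvg_point Pl W1 W1p fs f); auto; [intros; apply low_L2|].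
        apply nbv_cell; auto. now apply (nbl_spec X e s HN Hs). }
      rewrite <- (bdry_nbl X e f s HN Hs) in C.
      apply (UL_sequence _ _ _ C). intros eps He. exists O. intros k _.
      rewrite <- (bdry_nbl X e (fs k) s HN Hs). pose proof (Hfs k) as Ek.
      apply Kspace_iff in Ek as [_ Ek].
      rewrite Ek by auto. unfold zero_form, Rdist. rewrite Rminus_0_r, Rabs_R0. lra.
Qed.

(** Norm bound for a composition: the two factors are what [bdry_low_bd] and [delta_low_bd]
    allow. *)
Definition Ml : R := sqrt (INR Dl * INR Dm) * sqrt (INR Dm * (INR d ^ 2 * INR Dl)).

Lemma low_symop : symop Pl W1 (Kspace d X) (fun f => bdry X (delta_low X f)) Ml.
Proof.
  split.
  - intros f [Ff _]. apply Kspace_iff. split.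
    + now apply bdry_is_form, delta_low_is_form.
    + apply bdry_bdry; auto. now apply delta_low_is_form.
  - intros a f b g s _. rewrite <- bdry_lin. unfold bdry. apply fsum_ext. intros v _.
    apply delta_low_lin.
  - intros f g [Ff _] [Fg _].
    destruct (delta_low_bd f (low_L2 f)) as [Lf _]. destruct (delta_low_bd g (low_L2 g)) as [Lg _].
    pose proof (adj_low (delta_low X f) g (delta_low_is_form X _ _ Ff) Lf (low_L2 g)) as E1.
    pose proof (adj_low (delta_low X g) f (delta_low_is_form X _ _ Fg) Lg (low_L2 f)) as E2.
    rewrite ip_sym in E2. rewrite (ip_sym _ _ f). rewrite E1 in E2.
    apply Rmult_eq_reg_l in E2; auto. apply not_0_INR; lia.
  - intros f [Ff _]. destruct (delta_low_bd f (low_L2 f)) as [Lf B1].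
    destruct (bdry_low_bd _ Lf) as [Lb B2].
    pose proof (pos_INR Dl); pose proof (pos_INR Dm); pose proof (pow2_ge_0 (INR d)).
    unfold Ml. rewrite Rmult_assoc.
    eapply Rle_trans; [apply (Nm_le_sqrt _ _ _ _ _ _ (INR Dl * INR Dm)) with (3 := B2)|].
    + nra.
    + apply ip_ge0; auto.
    + apply Rmult_le_compat_l; [apply sqrt_pos|].
      apply Nm_le_sqrt; auto.
      * apply Rmult_le_pos; auto. apply Rmult_le_pos; auto.
      * apply ip_ge0; auto using low_L2.
Qed.

(** Let [h] solve [bdry (delta_low h) = bdry f] and put [x = <bdry f, h>]. Then
    [|delta_low h|^2 = d x] by [adj_low], the lower gap gives [c |h|^2 <= x], and Cauchy-Schwarz
    gives [x^2 <= |bdry f|^2 |h|^2]; hence [c x <= |bdry f|^2]. The correction is thus controlled by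
    the boundary it removes, with a constant depending only on [c] and [d]. *)
Lemma low_correction mu c f : is_lambda_low d X mu -> 0 < c -> c <= mu -> is_form X d f -> L2d f ->
  exists h, is_form X (S e) h /\ L2d (delta_low X h) /\
    Zspace d X (lin 1 f (-1) (delta_low X h)) /\
    c * (ipd (delta_low X h) (delta_low X h)) <= INR d * ipl (bdry X f) (bdry X f).
Proof.
  intros [_ Hmin] Hc Hmu Ff Lf.
  assert (Fb : is_form X (S e) (bdry X f)) by (now apply bdry_is_form).
  (* [mu > 0] bounds the spectrum from below, so [0] is outside it and the operator maps onto
     [Kspace]. *)
  assert (Hb : bij_on (Kspace d X) (feq X (S e)) (fun f s => bdry X (delta_low X f) s - 0 * f s)).
  { apply NNPP. intros N. apply Hmin in N. lra. }
  destruct (proj2 Hb (bdry X f)) as [h [Kh E]].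
  { apply Kspace_iff. split; auto. apply bdry_bdry; auto. }
  assert (E' : feq X (S e) (bdry X (delta_low X h)) (bdry X f)).
  { intros s Hs. specialize (E s Hs). simpl in E. lra. }
  clear E. destruct (proj1 (Kspace_iff h) Kh) as [Fh _]. exists h. pose proof (delta_low_is_form X _ _ Fh) as Fd.
  destruct (delta_low_bd h (low_L2 h)) as [Ld _].
  split; [|split; [|split]]; auto.
  - apply ker_Z; [now apply is_form_lin | apply L2_lin; auto |].
    intros s Hs. rewrite bdry_lin, E' by auto. unfold zero_form; ring.
  - destruct (finite_cells X (S e) HF) as [F [HF1 HF2]].
    pose proof (spec_min_finite Pl W1 W1p _ _ _ Kspace_subsp low_symop F HF1 HF2 mu Hmin h Kh) as B.
    rewrite (adj_low _ h Fd Ld (low_L2 h)).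
    set (x := ipl (bdry X (delta_low X h)) h) in *.
    assert (CS : x ^ 2 <= ipl (bdry X f) (bdry X f) * ipl h h).
    { unfold x. rewrite (ip_ext Pl W1 W1p _ (bdry X f) h h) by (auto using low_L2).
      apply ip_CS; auto using low_L2. }
    pose proof (ip_ge0 Pl W1 W1p h (low_L2 h)) as H0.
    pose proof (ip_ge0 Pl W1 W1p (bdry X f) (low_L2 _)) as H1.
    set (b := ipl (bdry X f) (bdry X f)) in *. set (n := ipl h h) in *.
    assert (Hxn : c * n <= x) by nra.
    assert (Hx : c * x <= b).
    { destruct (Req_dec x 0) as [->|Nx]; [lra|]. assert (0 < x) by nra.
      apply Rmult_le_reg_r with x; auto.
      assert (c * (b * n) <= b * x) by nra. nra. }
    pose proof (pos_INR d). nra.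
Qed.

End Lower.

(** * Distances and balls *)

Lemma within_cell d X r a s : within d X r a s -> dcell X d a -> dcell X d s.
Proof.
  revert s; induction r as [|r IH]; intros s H Ha; simpl in H.
  - eapply dcell_perm; eauto.
  - destruct H as [H|[c [_ [_ [H _]]]]]; auto.
Qed.

Lemma within_perm d X r a s t : dcell X d a -> within d X r a s -> Permutation s t -> within d X r a t.
Proof.
  revert s t; induction r as [|r IH]; intros s t Ha H Hp; simpl in *.
  - eapply Permutation_trans; eauto.
  - destruct H as [H|[c [H1 [H2 [H3 [u [Hu [Hc Hs]]]]]]]]; [left; eauto|]. right.
    exists c. split; [|split; [|split]]; auto; [eapply dcell_perm; eauto|].
    exists u. split; [|split]; auto. intros x Hx. apply Hs.
    eapply Permutation_in; [apply Permutation_sym|]; eauto.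
Qed.

Lemma within_mono d X r r' a s : (r <= r')%nat -> within d X r a s -> within d X r' a s.
Proof. induction 1; simpl; auto. Qed.

Lemma within_face d X r a c t s : dcell X d a -> within d X r a c -> dcell X (S d) t -> incl c t ->
  dcell X d s -> incl s t -> within d X (S r) a s.
Proof.
  intros Ha Hc Ht Hct Hs Hst. right. exists c. split; [|split; [|split]]; auto.
  - eapply within_cell; eauto.
  - exists t; auto.
Qed.

Lemma sub_face X d t u : dcell X (S d) t -> NoDup u -> incl u t -> length u = d -> dcell X d u.
Proof. intros [Ht _] Hn Hi Hl. split; auto. eapply cell_sub; eauto. Qed.

Lemma ball_cell d X R a s : ball d X R a s -> cell X s.
Proof.
  intros [Hn [t [Hi [[[Ht _] _]|[[Ht _] _]]]]]; eapply cell_sub; eauto.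
Qed.

Lemma ball_sub d X R a s t : ball d X R a s -> NoDup t -> incl t s -> ball d X R a t.
Proof.
  intros [_ [u [Hi H]]] Hn Ht. split; auto. exists u. split; auto. intros x Hx; auto.
Qed.

Lemma ball_within d X R a s : dcell X d s -> within d X R a s -> ball d X R a s.
Proof.
  intros Hs Hw. split; [apply (cell_nodup X), Hs|]. exists s. split; [apply incl_refl | auto].
Qed.

(** Every face of [t] shares the [d]-cell [t] with [s], so it is at most one step farther from [a];
    this is the lost unit of radius. *)
Lemma ball_top d X r R a s t : dcell X d a -> within d X r a s -> (S r <= R)%nat ->
  dcell X (S d) t -> incl s t -> ball d X R a t.
Proof.
  intros Ha Hs Hr Ht Hi. split; [apply (cell_nodup X), Ht|]. exists t. split; [apply incl_refl|].
  right. split; auto. intros u Hn Hu Hl. apply (within_mono d X (S r)); auto.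
  eapply within_face; eauto. eapply sub_face; eauto.
Qed.

(** A step between neighbours passes through a common [d]-cell and costs one unit of distance; a
    step that only reorders a cell costs nothing. *)
Lemma connected_within d X a : connected_top d X -> dcell X d a ->
  forall s, dcell X d s -> exists r, within d X r a s.
Proof.
  intros HC Ha s Hs. specialize (HC a s Ha Hs). apply clos_rt_rtn1 in HC.
  induction HC as [|y z Hyz Hay IH]; [exists O; simpl; auto|].
  destruct Hyz as [[Hy [Hz [t [Ht [[i [Hi Pi]] [z' [Pz [j [Hj Pj]]]]]]]]]|[Hy Hp]].
  - destruct (IH Hy) as [r Hr]. exists (S r). eapply (within_face d X r a y t); eauto.
    + intros x Hx. apply (rem_incl i t). exact (Permutation_in x (perm_par_perm _ _ _ Pi) Hx).
    + intros x Hx. apply (rem_incl j t), (Permutation_in x (perm_par_perm _ _ _ Pj)).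
      exact (Permutation_in x (perm_par_perm _ _ _ Pz) Hx).
  - destruct (IH Hy) as [r Hr]. exists r. eapply within_perm; eauto using perm_par_perm.
Qed.

Lemma connected_within_list d X a L : connected_top d X -> dcell X d a ->
  (forall s, In s L -> dcell X d s) -> exists r, forall s, In s L -> within d X r a s.
Proof.
  intros HC Ha. induction L as [|s L IH]; intros HL; [exists O; simpl; tauto|].
  destruct IH as [r Hr]; [intros; apply HL; simpl; auto|].
  destruct (connected_within d X a HC Ha s) as [r' Hr']; [apply HL; simpl; auto|].
  exists (max r r'). intros t [<-|Ht].
  - apply (within_mono d X r'); auto; lia.
  - apply (within_mono d X r); auto; lia.
Qed.

(** * Ball isomorphisms *)

(** [simp_iso] with an explicit inverse and no preferred side, so that each transfer lemma also runs
    backwards through [ball_iso_sym]. The maps are inverse to each other on vertices of the balls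
    only. *)
Record ball_iso (d : nat) (X1 X2 : complex) (R : nat) (a1 a2 : list nat) (phi psi : nat -> nat) : Prop := {
  bi_c1 : dcell X1 d a1;
  bi_c2 : dcell X2 d a2;
  bi_12 : forall s, ball d X1 R a1 s -> ball d X2 R a2 (map phi s);
  bi_21 : forall s, ball d X2 R a2 s -> ball d X1 R a1 (map psi s);
  bi_k1 : forall u, ball d X1 R a1 [u] -> psi (phi u) = u;
  bi_k2 : forall u, ball d X2 R a2 [u] -> phi (psi u) = u;
  bi_a1 : Permutation (map phi a1) a2;
  bi_a2 : Permutation (map psi a2) a1 }.

Lemma ball_iso_sym d X1 X2 R a1 a2 phi psi :
  ball_iso d X1 X2 R a1 a2 phi psi -> ball_iso d X2 X1 R a2 a1 psi phi.
Proof. intros []; split; auto. Qed.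

Lemma ball_vertex d X R a s u : ball d X R a s -> In u s -> ball d X R a [u].
Proof.
  intros Hs Hu. eapply ball_sub; eauto.
  - constructor; simpl; auto; constructor.
  - intros x [<-|[]]; auto.
Qed.

Lemma ball_iso_map d X1 X2 R a1 a2 phi psi s : ball_iso d X1 X2 R a1 a2 phi psi ->
  ball d X1 R a1 s -> map psi (map phi s) = s.
Proof.
  intros HI Hs. rewrite map_map. rewrite <- (map_id s) at 2. apply map_ext_in.
  intros u Hu. apply (bi_k1 _ _ _ _ _ _ _ _ HI). eapply ball_vertex; eauto.
Qed.

Lemma within_self d X R a : within d X R a a.
Proof. apply (within_mono d X 0); [lia | simpl; auto]. Qed.

Lemma simp_iso_ball_iso d X1 X2 R a1 a2 phi : dcell X1 d a1 -> dcell X2 d a2 ->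
  simp_iso (ball d X1 R a1) (ball d X2 R a2) phi -> Permutation (map phi a1) a2 ->
  exists psi, ball_iso d X1 X2 R a1 a2 phi psi.
Proof.
  intros C1 C2 [H12 [Hs Hi]] Ha.
  set (psi := fun v => epsilon (inhabits O) (fun u => ball d X1 R a1 [u] /\ phi u = v)).
  assert (Hpsi : forall v, ball d X2 R a2 [v] -> ball d X1 R a1 [psi v] /\ phi (psi v) = v).
  { intros v Hv. unfold psi. apply epsilon_spec. destruct (Hs [v] Hv) as [s [Hb Hp]].
    apply Permutation_sym, Permutation_length_1_inv in Hp.
    destruct s as [|u [|]]; try discriminate. injection Hp as E. exists u; auto. }
  assert (K1 : forall u, ball d X1 R a1 [u] -> psi (phi u) = u).
  { intros u Hu. destruct (Hpsi (phi u) (H12 [u] Hu)) as [Hb E]. now apply Hi. }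
  assert (KK : forall s, ball d X1 R a1 s -> map psi (map phi s) = s).
  { intros s Hb. rewrite map_map. rewrite <- (map_id s) at 2. apply map_ext_in.
    intros u Hu. apply K1. eapply ball_vertex; eauto. }
  exists psi. split; auto.
  (* [simp_iso] reaches [t] only up to the order of its vertices; balls are closed under
     reordering. *)
  - intros t Ht. destruct (Hs t Ht) as [s [Hb Hp]].
    assert (Hp' : Permutation s (map psi t)).
    { rewrite <- (KK s Hb). now apply Permutation_map. }
    eapply ball_sub; eauto.
    + eapply Permutation_NoDup; eauto. apply Hb.
    + intros x Hx. eapply Permutation_in; [apply Permutation_sym|]; eauto.
  - intros v Hv. now apply Hpsi.
  - rewrite <- (KK a1); [|apply ball_within; auto; now apply within_self].
    now apply Permutation_map, Permutation_sym.
Qed.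

Definition supp (d : nat) (X : complex) (r : nat) (a : list nat) (g : form) : Prop :=
  forall s, dcell X d s -> ~ within d X r a s -> g s = 0.

(** Agreement is asked on the full radius [R], beyond the supports, because the Laplacian near the
    edge of a support also reads values outside it. *)
Definition matches (d : nat) (X1 : complex) (R : nat) (a1 : list nat) (phi : nat -> nat) (g1 g2 : form) : Prop :=
  forall s, dcell X1 d s -> within d X1 R a1 s -> g1 s = g2 (map phi s).

Lemma supp_lapl d X r a g : dcell X d a -> supp d X r a g -> supp d X (S r) a (lapl_up X g).
Proof.
  intros Ha Hg s Hs Hn. unfold lapl_up, bdry.
  rewrite (fsum_ext _ _ (lin 0 (fun _ => 0) 0 (fun _ => 0))); [rewrite fsum_lin; ring|].
  intros v Hv. apply (nbv_cell X d) in Hv; auto. rewrite delta_top_Dc. unfold Dc.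
  rewrite sm_zero; [unfold lin; ring|]. intros i Hi. apply in_seq in Hi.
  assert (Hc : dcell X d (rem i (v :: s))) by (apply rem_cell; auto; destruct Hv; lia).
  unfold nf. rewrite Hg; auto; [ring|]. intros Hw. apply Hn.
  eapply (within_face d X r a (rem i (v :: s)) (v :: s)); eauto using rem_incl.
  intros x Hx; simpl; auto.
Qed.

Section Transfer.
Variables (d : nat) (X1 X2 : complex) (R : nat) (a1 a2 : list nat) (phi psi : nat -> nat).
Hypothesis HI : ball_iso d X1 X2 R a1 a2 phi psi.

Lemma iso_cell k s : ball d X1 R a1 s -> length s = k -> dcell X2 k (map phi s).
Proof.
  intros Hs Hl. split; [eapply ball_cell, (bi_12 _ _ _ _ _ _ _ _ HI); eauto|].
  now rewrite length_map.
Qed.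

Lemma iso_within r s : (r <= R)%nat -> within d X1 r a1 s ->
  within d X2 r a2 (map phi s) /\ dcell X2 d (map phi s).
Proof.
  pose proof (bi_c1 _ _ _ _ _ _ _ _ HI) as C1. pose proof (bi_c2 _ _ _ _ _ _ _ _ HI) as C2.
  intros Hr Hw.
  assert (Hc : dcell X2 d (map phi s)).
  { assert (Hs : dcell X1 d s) by (eapply within_cell; eauto).
    apply iso_cell; [|apply Hs]. apply ball_within; auto. eapply within_mono; eauto. }
  split; auto. revert s Hw Hc. induction r as [|r IH]; intros s Hw Hc; simpl in Hw.
  - simpl. eapply Permutation_trans; [apply Permutation_sym, (bi_a1 _ _ _ _ _ _ _ _ HI)|].
    now apply Permutation_map.
  - destruct Hw as [Hw|[c [Hwc [Hcc [Hs [t [Ht [H1 H2]]]]]]]].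
    + left. apply IH; auto; lia.
    + assert (Hcc' : dcell X2 d (map phi c)).
      { apply iso_cell; [|apply Hcc]. apply ball_within; auto. eapply within_mono; [|eauto]; lia. }
      apply (within_face d X2 r a2 (map phi c) (map phi t)); auto.
      * apply IH; auto; lia.
      * apply iso_cell; [|apply Ht]. eapply ball_top; eauto.
      * now apply incl_map.
      * now apply incl_map.
Qed.

Lemma iso_back r s : (r <= R)%nat -> within d X1 r a1 s -> map psi (map phi s) = s.
Proof.
  intros Hr Hw. eapply ball_iso_map; eauto.
  pose proof (bi_c1 _ _ _ _ _ _ _ _ HI) as C1.
  apply ball_within; [eapply within_cell; eauto | eapply within_mono; eauto].
Qed.

(** The layer between [r] and [R] puts the [d]-cell [v :: s] inside the ball, where [phi] respects
    cells. *)
Lemma iso_nbv r s v : (S r <= R)%nat -> within d X1 r a1 s -> nbv X1 s v ->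
  nbv X2 (map phi s) (phi v) /\ psi (phi v) = v.
Proof.
  intros Hr Hw Hv. pose proof (bi_c1 _ _ _ _ _ _ _ _ HI) as C1.
  assert (Hs : dcell X1 d s) by (eapply within_cell; eauto).
  apply (nbv_cell X1 d) in Hv; auto.
  assert (Hb : ball d X1 R a1 (v :: s)) by (eapply ball_top; eauto; intros x Hx; simpl; auto).
  split.
  - apply (nbv_cell X2 d); [apply (iso_within r); auto; lia|].
    apply (iso_cell (S d) (v :: s)); auto. apply Hv.
  - apply (bi_k1 _ _ _ _ _ _ _ _ HI). eapply ball_vertex; eauto. simpl; auto.
Qed.

End Transfer.

Section TransferForms.
Variables (d : nat) (X1 X2 : complex) (R : nat) (a1 a2 : list nat) (phi psi : nat -> nat).
Hypothesis HI : ball_iso d X1 X2 R a1 a2 phi psi.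
Let HJ := ball_iso_sym _ _ _ _ _ _ _ _ HI.
Let C1 : dcell X1 d a1 := bi_c1 _ _ _ _ _ _ _ _ HI.

Lemma iso_enum r s L : (S r <= R)%nat -> within d X1 r a1 s ->
  enumerates (nbv X1 s) L -> enumerates (nbv X2 (map phi s)) (map phi L).
Proof.
  intros Hr Hw [HL HLv]. split.
  - apply NoDup_map_inj; auto. intros u v Hu Hv E. apply HLv in Hu, Hv.
    rewrite <- (proj2 (iso_nbv _ _ _ _ _ _ _ _ HI r s u Hr Hw Hu)).
    rewrite <- (proj2 (iso_nbv _ _ _ _ _ _ _ _ HI r s v Hr Hw Hv)). now rewrite E.
  - intros v. rewrite in_map_iff. split.
    + intros [u [<- Hu]]. apply HLv in Hu. now apply (iso_nbv _ _ _ _ _ _ _ _ HI r).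
    + intros Hv. destruct (iso_within _ _ _ _ _ _ _ _ HI r s) as [Hw2 _]; auto; [lia|].
      destruct (iso_nbv _ _ _ _ _ _ _ _ HJ r (map phi s) v Hr Hw2 Hv) as [H1 H2].
      rewrite (iso_back _ _ _ _ _ _ _ _ HI r) in H1 by (auto; lia).
      exists (psi v). split; auto. now apply HLv.
Qed.

Hypothesis Hfin : fin_nb X1 d.

Lemma iso_deg r s : (S r <= R)%nat -> within d X1 r a1 s -> deg X1 s = deg X2 (map phi s).
Proof.
  intros Hr Hw. destruct (Hfin s) as [L HL]; [eapply within_cell; eauto|].
  unfold deg. rewrite (fcard_eq _ _ HL), (fcard_eq _ _ (iso_enum r s L Hr Hw HL)).
  now rewrite length_map.
Qed.

Lemma map_rem i t : map phi (rem i t) = rem i (map phi t).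
Proof. unfold rem. now rewrite map_app, firstn_map, skipn_map. Qed.

(** The Laplacian at [s] reads cells at distance up to [S r] and divides by their degrees; a degree
    takes one more layer to compare, whence [S (S r) <= R]. *)
Lemma matches_lapl r g1 g2 s : (S (S r) <= R)%nat -> within d X1 r a1 s ->
  matches d X1 R a1 phi g1 g2 -> lapl_up X1 g1 s = lapl_up X2 g2 (map phi s).
Proof.
  intros Hr Hw Hg. assert (Hs : dcell X1 d s) by (eapply within_cell; eauto).
  destruct (Hfin s Hs) as [L HL]. unfold lapl_up, bdry.
  rewrite (fsum_eq _ _ _ HL), (fsum_eq _ _ _ (iso_enum r s L ltac:(lia) Hw HL)), sm_map.
  apply sm_ext. intros v Hv. apply HL in Hv. apply (nbv_cell X1 d) in Hv; auto.
  rewrite !delta_top_Dc. change (phi v :: map phi s) with (map phi (v :: s)).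
  unfold Dc. rewrite length_map. apply sm_ext. intros i Hi. apply in_seq in Hi.
  rewrite <- map_rem. f_equal. unfold nf, Wd.
  assert (Hc : dcell X1 d (rem i (v :: s))) by (apply rem_cell; auto; destruct Hv; lia).
  assert (Hwi : within d X1 (S r) a1 (rem i (v :: s))).
  { apply (within_face d X1 r a1 s (v :: s)); auto using rem_incl. intros x Hx; simpl; auto. }
  rewrite (iso_deg (S r)) by auto. rewrite Hg; auto. eapply within_mono; [|eauto]; lia.
Qed.

Lemma matches_sum r g1 g2 l : (S r <= R)%nat -> supp d X1 r a1 g1 -> supp d X2 r a2 g2 ->
  (forall s, dcell X1 d s -> within d X1 r a1 s -> g1 s = g2 (map phi s)) ->
  has_sum (dcell X2 d) (fun s => g2 s * g2 s * Wd X2 s) l ->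
  has_sum (dcell X1 d) (fun s => g1 s * g1 s * Wd X1 s) l.
Proof.
  intros Hr S1 S2 Hg. apply (has_sum_transfer _ _ _ _ (map phi) (map psi)).
  - intros s Hs Hn.
    assert (Hw : within d X1 r a1 s).
    { apply NNPP; intros N; apply Hn. rewrite S1 by auto. ring. }
    destruct (iso_within _ _ _ _ _ _ _ _ HI r s) as [Hw2 Hs2]; auto; [lia|].
    split; [|split]; auto.
    + apply (iso_back _ _ _ _ _ _ _ _ HI r); auto; lia.
    + rewrite Hg by auto. unfold Wd. now rewrite (iso_deg r s).
  - intros t Ht Hn.
    assert (Hw : within d X2 r a2 t).
    { apply NNPP; intros N; apply Hn. rewrite S2 by auto. ring. }
    destruct (iso_within _ _ _ _ _ _ _ _ HJ r t) as [Hw2 Hs2]; auto; [lia|].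
    assert (E : map phi (map psi t) = t) by (apply (iso_back _ _ _ _ _ _ _ _ HJ r); auto; lia).
    split; [|split]; auto.
    rewrite Hg by auto. unfold Wd. rewrite (iso_deg r) by auto. now rewrite E.
Qed.

End TransferForms.

Section TransferBoundary.
Variables (e : nat) (X1 X2 : complex) (R : nat) (a1 a2 : list nat) (phi psi : nat -> nat).
Notation d := (S e).
Hypothesis HI : ball_iso d X1 X2 R a1 a2 phi psi.
Let HJ := ball_iso_sym _ _ _ _ _ _ _ _ HI.
Let C1 : dcell X1 d a1 := bi_c1 _ _ _ _ _ _ _ _ HI.
Hypothesis Hf1 : fin_nb X1 e.
Hypothesis Hf2 : fin_nb X2 e.

Lemma bdry_supp X r a g s : dcell X e s -> supp d X r a g -> bdry X g s <> 0 ->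
  exists v, within d X r a (v :: s) /\ dcell X d (v :: s).
Proof.
  intros Hs Hg Hn. apply NNPP. intros N. apply Hn. unfold bdry.
  rewrite (fsum_ext _ _ (lin 0 (fun _ => 0) 0 (fun _ => 0))); [rewrite fsum_lin; ring|].
  intros v Hv. apply (nbv_cell X e) in Hv; auto. rewrite Hg; [unfold lin; ring | auto |].
  intros Hw. apply N; eauto.
Qed.

Lemma tl_iso r s v : (r <= R)%nat -> within d X1 r a1 (v :: s) -> dcell X1 e s ->
  dcell X2 e (map phi s) /\ map psi (map phi s) = s.
Proof.
  intros Hr Hw Hs. assert (Hb : ball d X1 R a1 s).
  { apply (ball_sub d X1 R a1 (v :: s)).
    - apply ball_within; [eapply within_cell; eauto | eapply within_mono; eauto].
    - apply (cell_nodup X1), Hs.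
    - intros x Hx; simpl; auto. }
  split; [eapply iso_cell; eauto; apply Hs | eapply ball_iso_map; eauto].
Qed.

(** A [(d-2)]-cell of the ball may have neighbours outside it, so the two neighbour lists need not
    correspond. Only the vertices completing it to a cell of the support contribute, and between
    these [phi] is a bijection. *)
Lemma matches_bdry r g1 g2 s v : (r <= R)%nat -> within d X1 r a1 (v :: s) -> dcell X1 e s ->
  supp d X1 r a1 g1 -> supp d X2 r a2 g2 ->
  (forall s, dcell X1 d s -> within d X1 r a1 s -> g1 s = g2 (map phi s)) ->
  bdry X1 g1 s = bdry X2 g2 (map phi s).
Proof.
  intros Hr Hw Hs S1 S2 Hg. destruct (tl_iso r s v Hr Hw Hs) as [Hs2 Eb].
  rewrite (bdry_nbl X1 e), (bdry_nbl X2 e) by auto.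
  destruct (nbl_spec X1 e s Hf1 Hs) as [N1 M1]. destruct (nbl_spec X2 e _ Hf2 Hs2) as [N2 M2].
  set (L1 := nbl X1 s) in *. set (L2 := nbl X2 (map phi s)) in *.
  rewrite <- (sm_filt _ (fun w => within d X1 r a1 (w :: s)) L1).
  2:{ intros w Hw1 Hn. apply S1; auto. apply nbv_cell; auto. now apply M1. }
  rewrite <- (sm_filt _ (fun w => within d X2 r a2 (w :: map phi s)) L2).
  2:{ intros w Hw1 Hn. apply S2; auto. apply nbv_cell; auto. now apply M2. }
  assert (HF : forall w, In w (filt (fun w => within d X1 r a1 (w :: s)) L1) ->
     dcell X1 d (w :: s) /\ within d X1 r a1 (w :: s) /\ psi (phi w) = w).
  { intros w Hin. apply in_filt in Hin as [_ Hww]. split; [|split]; auto.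
    - eapply within_cell; eauto.
    - pose proof (iso_back _ _ _ _ _ _ _ _ HI r _ Hr Hww) as E. simpl in E. now injection E. }
  rewrite (sm_ext _ (fun w => g2 (phi w :: map phi s))).
  2:{ intros w Hin. destruct (HF w Hin) as [H1 [H2 _]]. now apply Hg. }
  rewrite <- (sm_map phi (fun w => g2 (w :: map phi s))). apply NoDup_ext_sm.
  - apply NoDup_map_inj; [|now apply nodup_filt]. intros u w Hu Hw' E.
    destruct (HF u Hu) as [_ [_ <-]]. destruct (HF w Hw') as [_ [_ <-]]. now rewrite E.
  - now apply nodup_filt.
  - intros w. rewrite in_map_iff, in_filt. split.
    + intros [u [<- Hu]]. destruct (HF u Hu) as [H1 [H2 _]].
      destruct (iso_within _ _ _ _ _ _ _ _ HI r _ Hr H2) as [H3 H4]. split; auto.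
      apply M2, (nbv_cell X2 e); auto.
    + intros [_ Hww]. destruct (iso_within _ _ _ _ _ _ _ _ HJ r _ Hr Hww) as [H3 H4].
      pose proof (iso_back _ _ _ _ _ _ _ _ HJ r _ Hr Hww) as E. simpl in E. injection E as E1 _.
      simpl in H3, H4. rewrite Eb in H3, H4.
      exists (psi w). split; auto. apply in_filt. split; auto. apply M1, (nbv_cell X1 e); auto.
Qed.

End TransferBoundary.

Lemma matches_bdry_sum e X1 X2 R a1 a2 phi psi r g1 g2 l :
  ball_iso (S e) X1 X2 R a1 a2 phi psi -> fin_nb X1 e -> fin_nb X2 e -> (r <= R)%nat ->
  supp (S e) X1 r a1 g1 -> supp (S e) X2 r a2 g2 ->
  (forall s, dcell X1 (S e) s -> within (S e) X1 r a1 s -> g1 s = g2 (map phi s)) ->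
  has_sum (dcell X2 e) (fun s => bdry X2 g2 s * bdry X2 g2 s * W1 s) l ->
  has_sum (dcell X1 e) (fun s => bdry X1 g1 s * bdry X1 g1 s * W1 s) l.
Proof.
  intros HI Hf1 Hf2 Hr S1 S2 Hg. pose proof (ball_iso_sym _ _ _ _ _ _ _ _ HI) as HJ.
  assert (Hg' : forall s, dcell X2 (S e) s -> within (S e) X2 r a2 s -> g2 s = g1 (map psi s)).
  { intros s Hs Hw. destruct (iso_within _ _ _ _ _ _ _ _ HJ r s Hr Hw) as [H1 H2].
    rewrite Hg by auto. now rewrite (iso_back _ _ _ _ _ _ _ _ HJ r s Hr Hw). }
  apply (has_sum_transfer _ _ _ _ (map phi) (map psi)).
  - intros s Hs Hn. destruct (bdry_supp e X1 r a1 g1 s) as [v [Hw _]]; auto.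
    { intros E; apply Hn; rewrite E; ring. }
    destruct (tl_iso _ _ _ _ _ _ _ _ HI r s v) as [H1 H2]; auto. split; [|split]; auto.
    rewrite (matches_bdry _ _ _ _ _ _ _ _ HI Hf1 Hf2 r g1 g2 s v); auto.
  - intros s Hs Hn. destruct (bdry_supp e X2 r a2 g2 s) as [v [Hw _]]; auto.
    { intros E; apply Hn; rewrite E; ring. }
    destruct (tl_iso _ _ _ _ _ _ _ _ HJ r s v) as [H1 H2]; auto. split; [|split]; auto.
    rewrite (matches_bdry _ _ _ _ _ _ _ _ HJ Hf2 Hf1 r g2 g1 s v); auto.
Qed.

Definition pull (d : nat) (X1 : complex) (r : nat) (a1 : list nat) (phi : nat -> nat) (g : form) : form :=
  fun s => if dec (within d X1 r a1 s) then g (map phi s) else 0.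

Lemma perm_par_map phi b s t : perm_par b s t -> perm_par b (map phi s) (map phi t).
Proof.
  induction 1 as [|b s t u _ IH Ha]; [constructor|]. econstructor; eauto.
  destruct Ha as [l1 x y l2]. rewrite !map_app. simpl. constructor.
Qed.

(** Between the radii [r] and [R] the pulled-back form is [0] by definition. There [g] vanishes at
    the image too: otherwise the image would be within [r], and [psi] would carry that distance
    back. *)
Lemma pull_spec d X1 X2 R a1 a2 phi psi r g :
  ball_iso d X1 X2 R a1 a2 phi psi -> (r <= R)%nat -> is_form X2 d g -> supp d X2 r a2 g ->
  is_form X1 d (pull d X1 r a1 phi g) /\ supp d X1 r a1 (pull d X1 r a1 phi g) /\
  matches d X1 R a1 phi (pull d X1 r a1 phi g) g.
Proof.
  intros HI Hr Fg Sg. pose proof (bi_c1 _ _ _ _ _ _ _ _ HI) as C1.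
  pose proof (ball_iso_sym _ _ _ _ _ _ _ _ HI) as HJ.
  split; [|split].
  - intros s t Hs Hp. unfold pull.
    assert (Ht : dcell X1 d t) by (eapply dcell_perm; eauto using perm_par_perm).
    destruct (classic (within d X1 r a1 s)) as [Hw|Hw].
    + rewrite (proj2 (dec_true _) Hw).
      rewrite (proj2 (dec_true (within d X1 r a1 t))) by (eapply within_perm; eauto using perm_par_perm).
      apply Fg; [|now apply perm_par_map]. now apply (iso_within _ _ _ _ _ _ _ _ HI r).
    + rewrite (proj2 (dec_false _) Hw).
      rewrite (proj2 (dec_false (within d X1 r a1 t))); [ring|].
      intros Hw'. apply Hw. eapply within_perm; eauto. eapply Permutation_sym, perm_par_perm; eauto.
  - intros s _ Hn. unfold pull. now rewrite (proj2 (dec_false _) Hn).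
  - intros s Hs Hw. unfold pull. destruct (dec (within d X1 r a1 s)) eqn:E; auto.
    rewrite dec_false in E. symmetry. apply Sg.
    + now apply (iso_within _ _ _ _ _ _ _ _ HI R).
    + intros Hw2. apply E. destruct (iso_within _ _ _ _ _ _ _ _ HJ r _ Hr Hw2) as [H _].
      now rewrite (iso_back _ _ _ _ _ _ _ _ HI R) in H.
Qed.

(** * Truncation *)

Definition trunc (d : nat) (X : complex) (r : nat) (a : list nat) (f : form) : form :=
  fun s => if dec (within d X r a s) then f s else 0.

Lemma trunc_is_form d X r a f : dcell X d a -> is_form X d f -> is_form X d (trunc d X r a f).
Proof.
  intros Ha Ff s t Hs Hp. unfold trunc.
  destruct (classic (within d X r a s)) as [Hw|Hw].
  - rewrite (proj2 (dec_true _) Hw).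
    rewrite (proj2 (dec_true (within d X r a t))) by (eapply within_perm; eauto using perm_par_perm).
    now apply Ff.
  - rewrite (proj2 (dec_false _) Hw).
    rewrite (proj2 (dec_false (within d X r a t))); [ring|].
    intros Hw'. apply Hw. eapply within_perm; eauto. eapply Permutation_sym, perm_par_perm; eauto.
Qed.

Lemma trunc_supp d X r a f : supp d X r a (trunc d X r a f).
Proof. intros s _ Hn. unfold trunc. now rewrite (proj2 (dec_false _) Hn). Qed.

(** A finite set [F] of cells carries all but [eps^2] of the squared norm, and connectedness places
    [F] in some ball around [a]. *)
Lemma trunc_approx d X W a f : connected_top d X -> dcell X d a ->
  (forall s, dcell X d s -> 0 < W s) -> L2 (dcell X d) W f ->
  forall eps, 0 < eps -> exists r, L2 (dcell X d) W (trunc d X r a f) /\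
    Nm (dcell X d) W (lin 1 f (-1) (trunc d X r a f)) <= eps.
Proof.
  intros HC Ha HW [l Hl] eps He.
  assert (H0 : forall s, dcell X d s -> 0 <= f s ^ 2 * W s).
  { intros s Hs. specialize (HW s Hs). apply Rmult_le_pos; [apply pow2_ge_0 | lra]. }
  destruct (Hl (eps * eps)) as [F [HF K]]; [nra|].
  destruct (connected_within_list d X a F HC Ha) as [r Hr]; [apply HF|].
  exists r.
  assert (B : summable (dcell X d) (fun s => lin 1 f (-1) (trunc d X r a f) s ^ 2 * W s) /\
     tsum (dcell X d) (fun s => lin 1 f (-1) (trunc d X r a f) s ^ 2 * W s) <= eps * eps).
  { apply summable_bounded.
    - intros s Hs. specialize (HW s Hs). apply Rmult_le_pos; [apply pow2_ge_0 | lra].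
    - intros L HL.
      rewrite <- (sm_filt _ (fun s => ~ within d X r a s) L).
      2:{ intros s _ Hn. apply NNPP in Hn. unfold lin, trunc. rewrite (proj2 (dec_true _) Hn). ring. }
      rewrite (sm_ext _ (fun s => f s ^ 2 * W s)).
      2:{ intros s Hin. apply in_filt in Hin as [_ Hn]. unfold lin, trunc.
          rewrite (proj2 (dec_false _) Hn). ring. }
      set (L' := filt (fun s => ~ within d X r a s) L).
      assert (HL' : subl (dcell X d) (F ++ L')).
      { split.
        - apply NoDup_app; [apply HF | apply nodup_filt, HL |].
          intros s H1 H2. apply in_filt in H2 as [_ H2]. apply H2, Hr, H1.
        - intros s Hin. apply in_app_iff in Hin as [H1|H1]; [apply HF, H1|].
          apply in_filt in H1 as [H1 _]. apply HL, H1. }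
      pose proof (has_sum_ub _ _ _ _ H0 Hl HL') as U. rewrite sm_app in U.
      specialize (K F HF (incl_refl _)). apply Rabs_def2 in K. lra. }
  destruct B as [B1 B2]. split.
  - apply (summable_dom0 _ _ (fun s => f s ^ 2 * W s)); [|exists l; auto].
    intros s Hs. unfold trunc. specialize (H0 s Hs). destruct (dec _); [lra|].
    split; [right; ring|]. lra.
  - apply Nm_le_of_sq; auto; [lra|]. eapply Rle_trans; [|apply B2]. right.
    unfold ip; f_equal; apply functional_extensionality; intros; ring.
Qed.

(** A finite list of neighbours of [s] lies, together with [s], in a ball around [a], and this ball
    is isomorphic to one in some [Xs n], where the bound is known. *)
Lemma low_deg_limit e X (Xs : nat -> complex) D : connected_top (S e) X ->
  converges (S e) Xs X -> (forall n s, dcell (Xs n) e s -> deg_le (Xs n) s D) ->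
  forall s, dcell X e s -> deg_le X s D.
Proof.
  intros HC [sn [a [Hsn [Ha Hcv]]]] HD s Hs L HN HL.
  (* A neighbour [v0] is needed to place [s] in the ball, since distance concerns cells with one
     vertex more than [s]. *)
  destruct L as [|v0 L0] eqn:EL; [simpl; lia|]. rewrite <- EL in *.
  destruct (connected_within_list (S e) X a (map (fun v => v :: s) L) HC Ha) as [r Hr].
  { intros t Ht. apply in_map_iff in Ht as [v [<- Hv]]. apply nbv_cell; auto. }
  destruct (Hcv r) as [n Hn]. destruct (Hn n (le_n _)) as [phi [Hphi Hpa]].
  destruct (simp_iso_ball_iso (S e) (Xs n) X r (sn n) a phi (Hsn n) Ha Hphi Hpa) as [psi HI].
  pose proof (ball_iso_sym _ _ _ _ _ _ _ _ HI) as HJ.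
  assert (Hw : forall v, In v L -> within (S e) X r a (v :: s)).
  { intros v Hv. apply Hr. apply in_map_iff; eauto. }
  destruct (tl_iso e X (Xs n) r a (sn n) psi phi HJ r s v0) as [H1 H2]; auto.
  { apply Hw. rewrite EL; simpl; auto. }
  rewrite <- (length_map psi L). apply (HD n (map psi s) H1).
  - apply NoDup_map_inj; auto. intros u w Hu Hw' E.
    pose proof (iso_back _ _ _ _ _ _ _ _ HJ r _ (le_n _) (Hw u Hu)) as E1.
    pose proof (iso_back _ _ _ _ _ _ _ _ HJ r _ (le_n _) (Hw w Hw')) as E2.
    simpl in E1, E2. injection E1 as E1 _. injection E2 as E2 _. congruence.
  - intros w Hin. apply in_map_iff in Hin as [v [<- Hv]]. apply (nbv_cell (Xs n) e); auto.
    apply (iso_within _ _ _ _ _ _ _ _ HJ r (v :: s)); auto.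
Qed.

(** * Transplanting approximate eigenforms *)

Notation Nmt d X := (Nm (dcell X d) (Wd X)).
Notation ipt d X := (ip (dcell X d) (Wd X)).
Notation L2t d X := (L2 (dcell X d) (Wd X)).
Notation ipw k X := (ip (dcell X k) W1).

Section Limit.
Variables (e : nat) (Xs : nat -> complex) (X : complex) (D : nat).
Notation d := (S (S e)).
Hypothesis HFn : forall n, finite_complex (Xs n).
Hypothesis HUn : forall n, uniform_dcomplex d (Xs n).
Hypothesis HU : uniform_dcomplex d X.
Hypothesis HC : connected_top d X.
Hypothesis HDn : forall n s, dcell (Xs n) d s -> deg_le (Xs n) s D.
Hypothesis HD : forall s, dcell X d s -> deg_le X s D.
Hypothesis Hcv : converges d Xs X.

Let Wp : forall s, dcell X d s -> 0 < Wd X s := Wd_pos d X D HU HD.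
Let Wpn : forall n s, dcell (Xs n) d s -> 0 < Wd (Xs n) s := fun n => Wd_pos d (Xs n) D (HUn n) (HDn n).

Lemma L2_all n f : L2t d (Xs n) f.
Proof.
  destruct (finite_cells (Xs n) d (HFn n)) as [F [H1 H2]]. exact (L2_finite _ _ F H1 H2 f).
Qed.

Lemma rayleigh n lam f : is_lambda d (Xs n) lam -> Zspace d (Xs n) f ->
  lam * (Nmt d (Xs n) f * Nmt d (Xs n) f) <= ipt d (Xs n) (lapl_up (Xs n) f) f.
Proof.
  intros [_ Hmin] Hf. destruct (finite_cells (Xs n) d (HFn n)) as [F [H1 H2]].
  rewrite Nm_sq by (auto using L2_all).
  apply (spec_min_finite _ _ (Wpn n) _ _ _ (Zspace_subsp d (Xs n) D (HUn n) (HDn n) ltac:(lia))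
    (lapl_symop d (Xs n) D (HUn n) (HDn n) ltac:(lia)) F H1 H2 lam); auto.
Qed.

(** [g] comes from [X] alone, before [n] is chosen. The quantities on [Xs n] equal those on [X], not
    merely approximately, as all cells involved lie in isomorphic balls. The clause on boundaries
    serves the correction at [x = 0]. *)
Lemma transplant f x eta : is_form X d f -> L2t d X f -> 0 < eta ->
  exists g, is_form X d g /\ L2t d X g /\ Nmt d X (lin 1 f (-1) g) <= eta /\
  forall N, exists n, (N <= n)%nat /\ exists G, is_form (Xs n) d G /\
    Nmt d (Xs n) G = Nmt d X g /\
    Nmt d (Xs n) (lin 1 (lapl_up (Xs n) G) (- x) G) = Nmt d X (lin 1 (lapl_up X g) (- x) g) /\
    (fin_nb X (S e) -> L2 (dcell X (S e)) W1 (bdry X g) ->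
       ipw (S e) (Xs n) (bdry (Xs n) G) (bdry (Xs n) G) = ipw (S e) X (bdry X g) (bdry X g)).
Proof.
  intros Ff Lf He. destruct Hcv as [sn [a [Hsn [Ha Hc]]]].
  destruct (trunc_approx d X (Wd X) a f HC Ha Wp Lf eta He) as [r [Lg Hg]].
  set (g := trunc d X r a f) in *.
  assert (Fg : is_form X d g) by (now apply trunc_is_form).
  assert (Sg : supp d X r a g) by apply trunc_supp.
  exists g. split; [|split; [|split]]; auto.
  (* The Laplacian of [g] lives within [S r], and comparing Laplacians there takes two more
     layers. *)
  intros N. destruct (Hc (3 + r)%nat) as [N' HN']. exists (max N N'). split; [lia|].
  set (n := max N N'). destruct (HN' n ltac:(lia)) as [phi [Hphi Hpa]].
  destruct (simp_iso_ball_iso d (Xs n) X (3 + r) (sn n) a phi (Hsn n) Ha Hphi Hpa) as [psi HI].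
  assert (Hfin : fin_nb (Xs n) d) by (apply finite_fin_nb, HFn).
  destruct (pull_spec d (Xs n) X (3 + r) (sn n) a phi psi r g HI ltac:(lia) Fg Sg) as [FG [SG MG]].
  set (G := pull d (Xs n) r (sn n) phi g) in *.
  exists G. split; [|split; [|split]]; auto.
  - unfold Nm. f_equal. apply tsum_eq.
    apply (matches_sum d (Xs n) X (3 + r) (sn n) a phi psi HI Hfin r G g); auto; [lia| |].
    + intros s Hs Hw. apply MG; auto. eapply within_mono; [|eauto]; lia.
    + apply tsum_spec, ip_summable; auto.
  - unfold Nm. f_equal. apply tsum_eq.
    apply (matches_sum d (Xs n) X (3 + r) (sn n) a phi psi HI Hfin (S r)
      (lin 1 (lapl_up (Xs n) G) (- x) G) (lin 1 (lapl_up X g) (- x) g)); auto; [lia| | | |].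
    + intros s Hs Hw. unfold lin. rewrite (supp_lapl d (Xs n) r (sn n) G (Hsn n) SG s Hs Hw).
      rewrite SG; auto; [ring|]. intros H; apply Hw; simpl; auto.
    + intros s Hs Hw. unfold lin. rewrite (supp_lapl d X r a g Ha Sg s Hs Hw).
      rewrite Sg; auto; [ring|]. intros H; apply Hw; simpl; auto.
    + intros s Hs Hw. unfold lin.
      rewrite (matches_lapl d (Xs n) X (3 + r) (sn n) a phi psi HI Hfin (S r) G g s); auto.
      rewrite (MG s); auto. eapply within_mono; [|eauto]; lia.
    + apply tsum_spec, ip_summable; auto; apply L2_lin; auto; now apply (lapl_L2 d X D HU HD).
  - intros Hfl Lb. apply tsum_eq.
    apply (matches_bdry_sum (S e) (Xs n) X (3 + r) (sn n) a phi psi r G g); auto; [|lia| |].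
    + apply finite_fin_nb, HFn.
    + intros s Hs Hw. apply MG; auto. eapply within_mono; [|eauto]; lia.
    + apply tsum_spec, ip_summable; auto. intros; apply (W1_pos (dcell X (S e))); auto.
Qed.

Let M : R := INR (S d).

(** [M + Rabs x] bounds the norm of [lapl_up - x], which is applied to [f - g]. *)
Lemma shift_bd f g x eta : L2t d X f -> L2t d X g -> Nmt d X (lin 1 f (-1) g) <= eta ->
  Nmt d X (lin 1 (lapl_up X g) (- x) g) <=
  Nmt d X (lin 1 (lapl_up X f) (- x) f) + (M + Rabs x) * eta.
Proof.
  intros Lf Lg He. set (h := lin 1 f (-1) g) in *.
  assert (Lh : L2t d X h) by (apply L2_lin; auto).
  pose proof (lapl_L2 d X D HU HD _ Lf). pose proof (lapl_L2 d X D HU HD _ Lg).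
  pose proof (lapl_L2 d X D HU HD _ Lh).
  rewrite (Nm_ext (dcell X d) (Wd X) Wp (lin 1 (lapl_up X g) (- x) g)
    (lin 1 (lin 1 (lapl_up X f) (- x) f) (-1) (lin 1 (lapl_up X h) (- x) h))).
  - eapply Rle_trans; [apply Nm_lin; auto; apply L2_lin; auto|].
    assert (Nmt d X (lin 1 (lapl_up X h) (- x) h) <= (M + Rabs x) * Nmt d X h).
    { eapply Rle_trans; [apply Nm_lin; auto|]. rewrite Rabs_R1, Rabs_Ropp.
      pose proof (lapl_bd d X D HU HD h Lh). unfold M. lra. }
    replace (Rabs (-1)) with 1 by (rewrite Rabs_left; lra). rewrite Rabs_R1.
    assert (0 <= M + Rabs x) by (pose proof (pos_INR (S d)); pose proof (Rabs_pos x); unfold M; lra).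
    apply (Rmult_le_compat_l (M + Rabs x)) in He; auto. lra.
  - assert (E : forall s, lapl_up X h s = 1 * lapl_up X f s + -1 * lapl_up X g s)
      by (intros; apply lapl_lin).
    intros s _. unfold lin. rewrite E. unfold h, lin. ring.
  - apply L2_lin; auto.
Qed.

Lemma Nm_close f g eta : L2t d X f -> L2t d X g -> Nmt d X (lin 1 f (-1) g) <= eta ->
  Nmt d X f - eta <= Nmt d X g.
Proof.
  intros Lf Lg He.
  assert (Nmt d X f <= Nmt d X (lin 1 f (-1) g) + Nmt d X g); [|lra].
  rewrite (Nm_ext _ _ Wp f (lin 1 (lin 1 f (-1) g) 1 g)) at 1; auto.
  - eapply Rle_trans; [apply Nm_lin; auto; apply L2_lin; auto|]. rewrite Rabs_R1. lra.
  - intros; unfold lin; ring.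
Qed.

Variables (lamn : nat -> R).
Hypothesis Hlamn : forall n, is_lambda d (Xs n) (lamn n).

(* The image of [lapl_up] is orthogonal to all coboundaries, so for [x <> 0] the form
   [lapl_up G] is the required test form in [Zspace]. *)
Lemma liminf_le_pos x : specZ d X x -> 0 < x ->
  forall eps, 0 < eps -> forall N, exists n, (N <= n)%nat /\ lamn n <= x + eps.
Proof.
  intros Hx Hpos eps He N.
  assert (HM : 0 < M) by (apply lt_0_INR; lia).
  (* In units of [b], [q * Q] collects the losses in the lower bound for the norm of [z]: [q x] from
     truncation and [q (1 + M + x)] from the approximate eigenvalue equation. [q] solves
     [q M Q = eps (x - q Q)], which makes [M s] at most [eps] times the norm of [z]. *)
  set (Q := 1 + M + 2 * x). assert (HQ : 0 < Q) by (unfold Q; lra).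
  set (q := eps * x / ((M + eps) * Q)).
  assert (HMQ : 0 < (M + eps) * Q) by (apply Rmult_lt_0_compat; lra).
  assert (Hq : 0 < q) by (apply Rdiv_lt_0_compat; auto; nra).
  assert (HqQ : q * ((M + eps) * Q) = eps * x) by (unfold q; field; lra).
  destruct (spec_approx (dcell X d) (Wd X) Wp (Zspace d X) (lapl_up X) M
    (Zspace_subsp d X D HU HD ltac:(lia)) (lapl_symop d X D HU HD ltac:(lia)) x Hx q Hq)
    as [f [Zf [Hb Hs]]].
  apply (Zspace_iff d X D HU HD) in Zf as [Ff [Lf _]]; [|lia].
  set (b := Nmt d X f) in *.
  destruct (transplant f x (q * b) Ff Lf) as [g [Fg [Lg [Hfg HG]]]]; [nra|].
  destruct (HG N) as [n [Hn [G [FG [E1 [E2 _]]]]]]. exists n. split; auto.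
  pose proof (shift_bd f g x _ Lf Lg Hfg) as B1. pose proof (Nm_close f g _ Lf Lg Hfg) as B2.
  rewrite <- E2 in B1. rewrite <- E1 in B2. fold b in B2. rewrite (Rabs_pos_eq x) in B1 by lra.
  set (L := lapl_up (Xs n)) in *. set (z := L G).
  set (SG := lin 1 (L G) (- x) G) in *. set (s := Nmt d (Xs n) SG) in *.
  assert (Zz : Zspace d (Xs n) z) by (apply (lapl_Z d (Xs n) D); auto using L2_all; lia).
  pose proof (rayleigh n (lamn n) z (Hlamn n) Zz) as HR. fold L in HR.
  set (nz := Nmt d (Xs n) z) in *.
  assert (B3 : x * Nmt d (Xs n) G <= nz + s).
  { rewrite <- (Rabs_pos_eq x) at 1 by lra. rewrite <- Nm_scal by (auto using L2_all).
    rewrite (Nm_ext _ _ (Wpn n) _ (lin 1 z (-1) SG)) by (auto using L2_all; intros; unfold SG, z, lin; ring).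
    eapply Rle_trans; [apply Nm_lin; auto using L2_all|].
    replace (Rabs (-1)) with 1 by (rewrite Rabs_left; lra). rewrite Rabs_R1. unfold nz, s. lra. }
  (* [z = x G + SG] gives [L z = x z + L SG], and [L SG] has norm at most [M s]. *)
  assert (B4 : ipt d (Xs n) (L z) z <= x * (nz * nz) + M * s * nz).
  { rewrite (ip_ext _ _ (Wpn n) _ (lin x z 1 (L SG)) z z); auto using L2_all.
    - rewrite ip_lin_l by (auto using L2_all). rewrite <- (Nm_sq _ _ (Wpn n) z) by (auto using L2_all).
      fold nz. pose proof (ip_le_Nm _ _ (Wpn n) (L SG) z (L2_all n _) (L2_all n _)) as C.
      pose proof (lapl_bd d (Xs n) D (HUn n) (HDn n) SG (L2_all n _)) as C2. fold L M s in C2. fold nz in C.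
      pose proof (Rle_abs (ipt d (Xs n) (L SG) z)).
      assert (0 <= nz) by apply Nm_ge0. nra.
    - intros t _. unfold lin. unfold SG, L. rewrite lapl_lin. unfold z, L. ring. }
  assert (Hsb : s <= q * b * (1 + M + x)) by lra.
  assert (Hz : b * (x - q * Q) <= nz).
  { assert (x * (b - q * b) <= x * Nmt d (Xs n) G) by (apply Rmult_le_compat_l; lra).
    unfold Q. nra. }
  assert (HqQ2 : q * Q < x).
  { apply Rmult_lt_reg_r with (M + eps); [lra|]. nra. }
  assert (Hnz : 0 < nz) by nra.
  assert (HMs : M * s <= eps * nz).
  { apply Rle_trans with (M * (q * b * (1 + M + x))); [apply Rmult_le_compat_l; lra|].
    apply Rle_trans with (eps * (b * (x - q * Q))); [|apply Rmult_le_compat_l; lra].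
    assert (q * (M * (1 + M + x)) <= eps * (x - q * Q)); [|nra].
    assert (q * (M * (1 + M + x)) <= q * (M * Q)); [|nra].
    apply Rmult_le_compat_l; [lra|]. apply Rmult_le_compat_l; unfold Q; lra. }
  apply Rmult_le_reg_r with (nz * nz); [nra|].
  eapply Rle_trans; [apply HR|]. eapply Rle_trans; [apply B4|]. nra.
Qed.

(** [lapl_up] vanishes on coboundaries, so subtracting one leaves the Laplacian estimate unchanged;
    what has to be watched is that the norm stays away from [0]. *)
Lemma liminf_le_zero Dl (mu : nat -> R) c : specZ d X 0 ->
  (forall n s, dcell (Xs n) (S e) s -> deg_le (Xs n) s Dl) ->
  (forall n, is_lambda_low d (Xs n) (mu n)) -> 0 < c -> (forall n, c <= mu n) ->
  forall eps, 0 < eps -> forall N, exists n, (N <= n)%nat /\ lamn n <= eps.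
Proof.
  intros Hx HDl Hmu Hc Hcm eps He N.
  assert (HDlX : forall s, dcell X (S e) s -> deg_le X s Dl) by (now apply (low_deg_limit (S e) X Xs)).
  assert (HM : 0 < M) by (apply lt_0_INR; lia).
  (* [C] bounds the squared norm of [bdry], and [K] is the resulting bound for the correction: by
     [low_correction] the norm of [delta_low h] is at most [K q b]. *)
  set (C := INR Dl * INR D). assert (HC0 : 0 <= C) by (apply Rmult_le_pos; apply pos_INR).
  set (K := sqrt (INR d * C / c)). assert (HK : 0 <= K) by apply sqrt_pos.
  assert (HKK : K * K = INR d * C / c).
  { apply sqrt_sqrt. apply Rmult_le_pos; [apply Rmult_le_pos; auto; apply pos_INR|].
    left; now apply Rinv_0_lt_compat. }
  assert (HT : 0 < (1 + M) + eps * (1 + K)) by nra.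
  (* Solution of [q (1 + M) = eps (1 - q (1 + K))]. Times [b], the left side bounds [s] from above,
     and [b (1 - q (1 + K))] bounds the norm of [z] from below. *)
  set (q := eps / ((1 + M) + eps * (1 + K))).
  assert (Hq : 0 < q) by (apply Rdiv_lt_0_compat; lra).
  assert (HqT : q * ((1 + M) + eps * (1 + K)) = eps) by (unfold q; field; lra).
  destruct (spec_approx (dcell X d) (Wd X) Wp (Zspace d X) (lapl_up X) M
    (Zspace_subsp d X D HU HD ltac:(lia)) (lapl_symop d X D HU HD ltac:(lia)) 0 Hx q Hq)
    as [f [Zf [Hb Hs]]].
  pose proof (Z_ker e X D Dl HU HD HDlX f Zf) as Kf.
  apply (Zspace_iff d X D HU HD) in Zf as [Ff [Lf _]]; [|lia].
  set (b := Nmt d X f) in *.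
  destruct (transplant f 0 (q * b) Ff Lf) as [g [Fg [Lg [Hfg HG]]]]; [nra|].
  destruct (HG N) as [n [Hn [G [FG [E1 [E2 E3]]]]]]. exists n. split; auto.
  destruct (bdry_low_bd e X D Dl HU HD HDlX g Lg) as [Lbg _].
  specialize (E3 (fin_low e X Dl HDlX) Lbg).
  pose proof (shift_bd f g 0 _ Lf Lg Hfg) as B1. pose proof (Nm_close f g _ Lf Lg Hfg) as B2.
  rewrite <- E2 in B1. rewrite <- E1 in B2. fold b in B2. rewrite Rabs_R0 in B1.
  (* As [f] is a cycle, [bdry g] is [- bdry (f - g)], which the truncation error [q b] controls. *)
  assert (Bg : ipw (S e) (Xs n) (bdry (Xs n) G) (bdry (Xs n) G) <= C * ((q * b) * (q * b))).
  { rewrite E3.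
    assert (Lh : L2t d X (lin 1 f (-1) g)) by (apply L2_lin; auto).
    destruct (bdry_low_bd e X D Dl HU HD HDlX _ Lh) as [Lbh Bh]. fold C in Bh.
    replace (ipw (S e) X (bdry X g) (bdry X g)) with
      (ipw (S e) X (bdry X (lin 1 f (-1) g)) (bdry X (lin 1 f (-1) g))).
    - eapply Rle_trans; [apply Bh|]. apply Rmult_le_compat_l; auto.
      rewrite <- (Nm_sq _ _ Wp) by auto. pose proof (Nm_ge0 (dcell X d) (Wd X) (lin 1 f (-1) g)).
      apply Rmult_le_compat; auto.
    - unfold ip. apply tsum_ext.
      + intros s Hs'. rewrite bdry_lin, (Kf s Hs'). unfold zero_form. ring.
      + apply ip_summable; auto. intros; apply (W1_pos (dcell X (S e))); auto. }
  destruct (low_correction e (Xs n) D Dl (HUn n) (HDn n) (HDl n) (HFn n) (mu n) c G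
    (Hmu n) Hc (Hcm n) FG (L2_all n G)) as [h [Fh [Ldh [Zz Bh]]]].
  set (z := lin 1 G (-1) (delta_low (Xs n) h)) in *.
  set (L := lapl_up (Xs n)) in *.
  pose proof (rayleigh n (lamn n) z (Hlamn n) Zz) as HR. fold L in HR.
  set (nz := Nmt d (Xs n) z) in *.
  assert (B3 : Nmt d (Xs n) (delta_low (Xs n) h) <= K * (q * b)).
  { assert (0 < q * b) by nra.
    apply Nm_le_of_sq; auto; [nra|].
    apply Rmult_le_reg_l with c; auto. eapply Rle_trans; [apply Bh|].
    replace (c * (K * (q * b) * (K * (q * b)))) with (c * (K * K) * ((q * b) * (q * b))) by ring.
    rewrite HKK. replace (c * (INR d * C / c)) with (INR d * C) by (field; lra).
    rewrite Rmult_assoc. apply Rmult_le_compat_l; auto. apply pos_INR. }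
  assert (B4 : Nmt d (Xs n) G <= nz + K * (q * b)).
  { rewrite (Nm_ext _ _ (Wpn n) G (lin 1 z 1 (delta_low (Xs n) h)))
      by (auto using L2_all; intros; unfold z, lin; ring).
    eapply Rle_trans; [apply Nm_lin; auto using L2_all|]. rewrite Rabs_R1. unfold nz. lra. }
  set (s := Nmt d (Xs n) (lin 1 (L G) (- 0) G)) in *.
  (* [L z] is [L G] because [L] kills [delta_low h]; the term [- 0] only matches the form whose norm
     is [s]. *)
  assert (B5 : ipt d (Xs n) (L z) z <= s * nz).
  { rewrite (ip_ext _ _ (Wpn n) _ (lin 1 (L G) (-0) G) z z); auto using L2_all.
    - eapply Rle_trans; [apply Rle_abs|]. apply (ip_le_Nm _ _ (Wpn n)); auto using L2_all.
    - intros t Ht. unfold z, L. rewrite lapl_lin.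
      rewrite (lapl_low d (Xs n) D (HUn n) (HDn n) h t Ht). unfold lin, zero_form. ring. }
  assert (Hsb : s <= q * b * (1 + M)) by lra.
  assert (Hz : b * (1 - q * (1 + K)) <= nz) by lra.
  assert (Hq1 : 0 < 1 - q * (1 + K)).
  { assert (0 < eps * (1 - q * (1 + K))); [nra|].
    apply Rmult_lt_reg_l with eps; auto. lra. }
  assert (Hnz : 0 < nz) by nra.
  assert (Hse : s <= eps * nz).
  { eapply Rle_trans; [apply Hsb|].
    apply Rle_trans with (eps * (b * (1 - q * (1 + K)))); [|apply Rmult_le_compat_l; lra].
    right. replace (eps * (b * (1 - q * (1 + K)))) with (b * (eps - q * (eps * (1 + K)))) by ring.
    rewrite <- HqT at 1. ring. }
  apply Rmult_le_reg_r with (nz * nz); [nra|].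
  eapply Rle_trans; [apply HR|]. eapply Rle_trans; [apply B5|]. nra.
Qed.

End Limit.

Theorem mainTheorem10 (d : nat) (Xs : nat -> complex) (X : complex)
    (lamn : nat -> R) (lam : R) :
  (2 <= d)%nat ->
  (forall n, finite_complex (Xs n)) ->
  (forall n, uniform_dcomplex d (Xs n)) -> uniform_dcomplex d X ->
  (forall n, connected_top d (Xs n)) -> connected_top d X ->
  (exists D : nat,
     (forall n s, dcell (Xs n) d s -> deg_le (Xs n) s D) /\
     (forall s, dcell X d s -> deg_le X s D)) ->
  converges d Xs X ->
  (forall n, is_lambda d (Xs n) (lamn n)) ->
  is_lambda d X lam ->
  ( ~ specZ d X 0
    \/ (specZ d X 0 /\ forall eps, 0 < eps -> exists x, specZ d X x /\ x <> 0 /\ Rabs x < eps)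
    \/ ((exists D : nat, forall n s, dcell (Xs n) (d - 1) s -> deg_le (Xs n) s D) /\
        exists mu : nat -> R, (forall n, is_lambda_low d (Xs n) (mu n)) /\
          exists c, 0 < c /\ forall n, c <= mu n) ) ->
  (* liminf_{n -> oo} lamn n <= lam *)
  forall eps, 0 < eps -> forall N : nat, exists n, (N <= n)%nat /\ lamn n <= lam + eps.
Proof.
  intros Hd HFn HUn HU _ HC [D [HDn HD]] Hcv Hlamn [Hlam Hmin] Hcase eps He N.
  destruct d as [|[|e]]; [lia | lia |].
  (* Turns [lam <> 0] into [0 < lam], and makes the spectral points accumulating at [0] positive. *)
  assert (Hnn : forall x, specZ (S (S e)) X x -> 0 <= x).
  { intros x. apply (spec_nonneg (dcell X (S (S e))) (Wd X) (Wd_pos _ X D HU HD) _ _ _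
      (Zspace_subsp _ X D HU HD ltac:(lia)) (lapl_symop _ X D HU HD ltac:(lia)) x).
    intros f Hf. apply (Zspace_iff _ X D HU HD) in Hf as [Ff [Lf _]]; [|lia].
    now apply (lapl_nonneg _ X D HU HD). }
  pose proof (Hnn lam Hlam) as Hlam0.
  destruct (Req_dec lam 0) as [Z|NZ].
  - subst lam. destruct Hcase as [H1|[[_ H2]|[[Dl HDl] [mu [Hmu [c [Hc Hcm]]]]]]].
    + exfalso; apply H1, Hlam.
    (* A nonzero spectral point below [eps / 2] stands in for [0]; the other half of [eps] is the
       tolerance at that point. *)
    + destruct (H2 (eps / 2)) as [x [Hx [Hx0 Hxe]]]; [lra|]. pose proof (Hnn x Hx).
      rewrite Rabs_pos_eq in Hxe by auto.
      destruct (liminf_le_pos e Xs X D HFn HUn HU HC HDn HD Hcv lamn Hlamn x Hx ltac:(lra) (eps / 2) ltac:(lra) N)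
        as [n [Hn Hle]]. exists n; split; auto; lra.
    + destruct (liminf_le_zero e Xs X D HFn HUn HU HC HDn HD Hcv lamn Hlamn Dl mu c Hlam HDl Hmu Hc Hcm eps He N)
        as [n [Hn Hle]]. exists n; split; auto; lra.
  - apply (liminf_le_pos e Xs X D HFn HUn HU HC HDn HD Hcv lamn Hlamn lam Hlam ltac:(lra) eps He N).
Qed.
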